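(* Let $\mu$ be a positive Borel measure on $[0,1)$, $\gamma>0$, $2\le p\le\infty$ and $0<q<\infty$. Then $\mathcal C_\mu$ maps $H(p,\infty,\gamma)$ into $H(p,q,\gamma)$ if and only if the sequence $(\mu_n(n+1)^{1-1/q})_{n\ge0}$ belongs to $\ell^q$.
   Context: $\mathbb D$ is the open unit disc of $\mathbb C$ and $\mathcal H(\mathbb D)$ the space of analytic functions on $\mathbb D$. Positive Borel measures on $[0,1)$ are understood to be finite. Put $\mu_n=\int_0^1t^n\,d\mu(t)$. For $f\in\mathcal H(\mathbb D)$, $f(z)=\sum_{n\ge0} a_nz^n$, $\mathcal C_\mu(f)(z)=\int_0^1\frac{f(tz)}{1-tz}\,d\mu(t)=\sum_{n=0}^\infty\mu_n\left(\sum_{k=0}^na_k\right)z^n$, $z\in\mathbb D$. For $f\in\mathcal H(\mathbb D)$ and $0<r<1$: $M_p(f,r)=\left(\int_0^{2\pi}|f(re^{i\theta})|^p\frac{d\theta}{2\pi}\right)^{1/p}$ for $0<p<\infty$, and $M_\infty(f,r)=\max_{|z|=r}|f(z)|$. For $0<p\le\infty$ and $\gamma>0$, $H(p,q,\gamma)$ is the space of $f\in\mathcal H(\mathbb D)$ with $\|f\|_{(p,q,\gamma)}<\infty$, where $\|f\|_{(p,q,\gamma)}=\left(\int_0^1(1-r)^{\gamma q-1}M_p^q(f,r)\,dr\right)^{1/q}$ if $0<q<\infty$, and $\|f\|_{(p,\infty,\gamma)}=\sup_{0<r<1}(1-r)^\gamma M_p(f,r)$. For $0<q<\infty$, $\ell^q$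 is the space of sequences $(x_n)_{n\ge 0}$ with $\sum_n|x_n|^q<\infty$. *)

(* Defs.v *)
From HB Require Import structures.
From mathcomp Require Import all_boot all_order all_algebra.
From mathcomp Require Import complex.
From mathcomp Require Import all_classical all_reals all_analysis.

Set Implicit Arguments.
Unset Strict Implicit.
Unset Printing Implicit Defensive.

Import Order.TTheory GRing.Theory Num.Theory.
Import numFieldTopology.Exports numFieldNormedType.Exports.

Local Open Scope classical_set_scope.
Local Open Scope ring_scope.

Section Defs.
Variable R : realType.
Implicit Types (f : R[i] -> R[i]) (z : R[i]) (r t gamma : R) (p q : \bar R).

(* Modulus as an element of R: the generic norm `|z| lives in R[i]. *)
Definition cabs z : R := Normc.normc z.

Definition unit_disc : set R[i] := [set z | cabs z < 1].

(* Local expandability in a convergent power series around each point of D.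
   A function f is total, but only its restriction to D is ever constrained. *)
Definition analytic_on_disc f : Prop :=
  forall z0, unit_disc z0 ->
    exists (e : R) (c : nat -> R[i]), 0 < e /\
      forall z, cabs (z - z0) < e ->
        series (fun n => c n * (z - z0) ^+ n : R[i]^o) @ \oo --> (f z : R[i]^o).

Definition circle_point r (theta : R) : R[i] :=
  Complex (r * cos theta) (r * sin theta).

(* M_p(f, r), for 0 < p <= +oo. The maximum over |z| = r is written as a
   supremum; it is attained when f is continuous. The value at p = -oo is
   irrelevant. *)
Definition integral_mean p f r : \bar R :=
  match p with
  | s%:E =>
      ((\int[@lebesgue_measure R]_(theta in `[0%R, (2 * pi)%R])
          ((cabs (f (circle_point r theta)) `^ s / (2 * pi))%R)%:E) `^ s^-1)%E
  | +oo%E => ereal_sup [set (cabs (f z))%:E | z in [set z | cabs z = r]]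
  | -oo%E => 0%E
  end.

(* The norm of H(p, q, gamma), for 0 < q <= +oo; again q = -oo is irrelevant. *)
Definition mixed_norm p q gamma f : \bar R :=
  match q with
  | s%:E =>
      ((\int[@lebesgue_measure R]_(r in `]0%R, 1%R[)
          (((1 - r) `^ (gamma * s - 1))%R%:E * integral_mean p f r `^ s))
        `^ s^-1)%E
  | +oo%E =>
      ereal_sup [set (((1 - r) `^ gamma)%R%:E * integral_mean p f r)%E
                | r in `]0, 1[]
  | -oo%E => 0%E
  end.

Definition mixed_norm_space p q gamma : set (R[i] -> R[i]) :=
  [set f | analytic_on_disc f /\ (mixed_norm p q gamma f < +oo)%E].

Definition moment (mu : {measure set (measurableTypeR R) -> \bar R}) (n : nat) : R :=
  \int[mu]_(t in `[0, 1[) (t ^+ n).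

(* The integral of a complex-valued function is taken componentwise. *)
Definition complex_integral (mu : {measure set (measurableTypeR R) -> \bar R}) (D : set R)
    (g : R -> R[i]) : R[i] :=
  Complex (\int[mu]_(t in D) complex.Re (g t))
          (\int[mu]_(t in D) complex.Im (g t)).

Definition cesaro_op (mu : {measure set (measurableTypeR R) -> \bar R}) f z : R[i] :=
  complex_integral mu `[0, 1[
    (fun t => f (t%:C%C * z) / (1 - t%:C%C * z)).

Definition ell (q : R) : set (nat -> R) :=
  [set x | (\sum_(0 <= n <oo) (`|x n| `^ q)%:E < +oo)%E].

End Defs.

(* Main.v *)
Require Import Defs.
From mathcomp Require Import all_boot all_order all_algebra.
From mathcomp Require Import complex.
From mathcomp Require Import all_classical all_reals all_analysis.
From mathcomp Require Import measurable_realfun ring lra.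

Import Order.TTheory GRing.Theory Num.Theory.
Import numFieldTopology.Exports numFieldNormedType.Exports.
Local Open Scope classical_set_scope.
Local Open Scope ring_scope.

(** The operator is the radial average [C_mu f (z) = int g (t z) dmu(t)] of
    [g z = f z / (1 - z)].  Local power series of [g] along the segment [0, z]
    can be re-expanded at [z] and integrated, so [C_mu f] is analytic.

    Sufficiency: if [M_p(f, r) <= K (1 - r) ^ (- gamma)], Minkowski's inequality
    gives [M_p(C_mu f, r) <= 2 K' int (1 - t r) ^ (- gamma - 1) dmu(t)].  On
    [1 - r ~ 2^-j] this is at most a constant times
    [w_j = sum_(k <= j) 2 ^ (k (gamma + 1)) mu_(2^k)], and [b_j = 2 ^ (- j gamma) w_j]
    satisfies [b_(j+1) = 2 ^ (- gamma) b_j + 2 ^ (j+1) mu_(2^(j+1))], so [b] is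
    q-summable as soon as [2 ^ j mu_(2^j)] is, for every [q > 0].

    Necessity: a test function [f] of growth [(1 - z) ^ (- gamma - 1/p)], obtained
    by averaging [(1 - t z) ^ (- m)] over [t] so that no fractional power of a
    complex number is needed, lies in [H(p, oo, gamma)].  On the arc of length
    comparable with [1 - r ~ 2^-j] around [r] all the integrands have almost zero
    argument, so [|C_mu f|] is at least a constant times
    [2 ^ (j (gamma + 1/p + 1)) mu_(2^j)] there, whence
    [M_p(C_mu f, r) >= c 2 ^ (j gamma) 2 ^ j mu_(2^j)].

    By Cauchy condensation, q-summability of [2 ^ j mu_(2^j)] is the condition
    on the moments in the statement. *)

(** * Modulus and convergence of complex sequences *)

(** Analyticity is given by local power series only, so neither Cauchy's formula nor one Taylor
    series valid on the whole disc is at hand. Local expansions are therefore carried with explicit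
    geometric error bounds ([expandable]), and a supremum argument ([interval_additive_ind]) joins
    the pieces of the segment [0, z]. Minkowski's inequality is derived without duality: a majorant
    N(t) of M_p(g, t r) is the weight in a Jensen inequality, and Tonelli's theorem exchanges t and
    theta. Complex integrals are taken componentwise, which costs a factor 2. The restriction p >= 2
    comes from the test function. The mean of |1 - z| ^ (- m p) is compared with the Poisson kernel,
    that is with |1 - z| ^ (- 2), and this asks for m p >= 2, where the integer m may be 1.
    Summability of b is read off its recursion rather than from a convolution inequality, because
    the triangle inequality in l^q fails for q < 1. *)

Section ComplexModulus.
Context {R : realType}.
Implicit Types (x y z : R[i]) (a : R).

Lemma cabs_ge0 z : 0 <= cabs z.
Proof. by case: z => a b; rewrite /cabs /=; exact: sqrtr_ge0. Qed.

Lemma cabs0 : cabs (0 : R[i]) = 0. Proof. exact: Normc.normc0. Qed.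

Lemma cabs1 : cabs (1 : R[i]) = 1. Proof. exact: Normc.normc1. Qed.

Lemma cabsM x y : cabs (x * y) = cabs x * cabs y.
Proof. exact: Normc.normcM. Qed.

Lemma cabsV x : cabs x^-1 = (cabs x)^-1.
Proof. exact: Normc.normcV. Qed.

Lemma cabs_div x y : cabs (x / y) = cabs x / cabs y.
Proof. by rewrite cabsM cabsV. Qed.

Lemma cabsN x : cabs (- x) = cabs x.
Proof. exact: normcN. Qed.

Lemma cabsX x n : cabs (x ^+ n) = cabs x ^+ n.
Proof. by elim: n => [|n IH]; rewrite ?expr0 ?cabs1// !exprS cabsM IH. Qed.

Lemma cabsD x y : cabs (x + y) <= cabs x + cabs y.
Proof. exact: le_normcD. Qed.

Lemma cabsB x y : cabs (x - y) <= cabs x + cabs y.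
Proof. by rewrite -(cabsN y); exact: cabsD. Qed.

Lemma cabs_subC x y : cabs (x - y) = cabs (y - x).
Proof. by rewrite -cabsN opprB. Qed.

Lemma cabs_triangle y x z : cabs (x - z) <= cabs (x - y) + cabs (y - z).
Proof. by rewrite (le_trans _ (cabsD _ _))// addrA subrK. Qed.

Lemma cabs_sub_ge x y : cabs x - cabs y <= cabs (x - y).
Proof. by rewrite lerBlDr -{1}(subrK y x) cabsD. Qed.

Lemma cabs_sum (I : Type) (s : seq I) (P : pred I) (F : I -> R[i]) :
  cabs (\sum_(i <- s | P i) F i) <= \sum_(i <- s | P i) cabs (F i).
Proof.
elim/big_ind2 : _ => [|u u' v v' hu hv|//]; first by rewrite cabs0.
by rewrite (le_trans (cabsD _ _))// lerD.
Qed.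

Lemma cabs_real a : cabs (a%:C)%C = `|a|.
Proof. by rewrite /cabs /= expr0n /= addr0 sqrtr_sqr. Qed.

Lemma cabs_nat n : cabs (n%:R : R[i]) = n%:R.
Proof. by rewrite -(rmorph_nat (real_complex R)) cabs_real normr_nat. Qed.

Lemma Re_le_cabs z : `|complex.Re z| <= cabs z.
Proof.
case: z => a b /=; rewrite -sqrtr_sqr /cabs/= ler_sqrt ?addr_ge0 ?sqr_ge0//.
by rewrite lerDl sqr_ge0.
Qed.

Lemma Im_le_cabs z : `|complex.Im z| <= cabs z.
Proof.
case: z => a b /=; rewrite -sqrtr_sqr /cabs/= ler_sqrt ?addr_ge0 ?sqr_ge0//.
by rewrite lerDr sqr_ge0.
Qed.

Lemma cabs_le_ReIm z : cabs z <= `|complex.Re z| + `|complex.Im z|.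
Proof.
case: z => a b /=; rewrite /cabs/= -(@ger0_norm _ (`|a| + `|b|)) ?addr_ge0//.
rewrite -sqrtr_sqr ler_sqrt ?sqr_ge0// sqrrD !real_normK ?num_real//.
by rewrite lerD2r lerDl mulrn_wge0// mulr_ge0.
Qed.

Lemma cabs_eq0 z : (cabs z == 0) = (z == 0).
Proof.
by apply/eqP/eqP => [/Normc.eq0_normc//|->]; exact: cabs0.
Qed.

Lemma cabs_normc z : `|z| = ((cabs z)%:C)%C.
Proof. by case: z. Qed.

(** The norm of [R[i]] takes values in [R[i]], where being positive forces the imaginary part to
    vanish; so limits can be handled through the real modulus. *)
Lemma cvg_cabsP (u : nat -> R[i]) (l : R[i]) :
  (u @ \oo --> (l : R[i]^o)) <-> (fun n => cabs (u n - l)) @ \oo --> (0 : R).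
Proof.
split=> [/(@cvgrPdist_lt _ (R[i]^o)) ul|/cvgrPdist_lt ul].
- apply/cvgrPdist_lt => e e0.
  have /ul : 0 < (e%:C)%C by rewrite ltcR.
  apply: filterS => n.
  by rewrite cabs_normc ltcR sub0r normrN ger0_norm ?cabs_ge0// cabs_subC.
- apply/(@cvgrPdist_lt _ (R[i]^o)) => -[e e'].
  rewrite ltcE /= => /andP[/eqP -> e0].
  apply: filterS (ul _ e0) => n.
  rewrite sub0r normrN ger0_norm ?cabs_ge0// cabs_normc -ltcR.
  by rewrite cabs_subC.
Qed.

Lemma cvg_cabs (u : nat -> R[i]) (l : R[i]) :
  (fun n => cabs (u n - l)) @ \oo --> (0 : R) ->
  (fun n => cabs (u n)) @ \oo --> cabs l.
Proof.
move=> ul; move/cvgrPdist_le : ul => ul; apply/cvgrPdist_le => e e0.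
apply: filterS (ul _ e0) => n.
rewrite sub0r normrN ger0_norm ?cabs_ge0// => h.
rewrite ler_norml; apply/andP; split.
  by rewrite lerNl opprB (le_trans (cabs_sub_ge _ _)).
by rewrite (le_trans (cabs_sub_ge _ _))// cabs_subC.
Qed.

Lemma geometric2_sum (n m : nat) :
  \sum_(n <= k < m) (2^-1 : R) ^+ k <= 2 / 2 ^+ n.
Proof.
have [mn|/ltnW nm] := leqP m n.
  by rewrite big_geq// mulr_ge0// invr_ge0 exprn_ge0.
suff -> : \sum_(n <= k < m) (2^-1 : R) ^+ k = 2 / 2 ^+ n - 2 / 2 ^+ m.
  by rewrite lerBlDr lerDl mulr_ge0// invr_ge0 exprn_ge0.
rewrite -(subnK nm); elim: (m - n)%N => [|d IH].
  by rewrite add0n big_geq// subrr.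
rewrite addSn big_nat_recr/= ?leq_addl// IH exprVn exprS.
rewrite invfM mulrA divff ?pnatr_eq0// mul1r.
by rewrite -[_ ^- _]mul1r; lra.
Qed.

Lemma cvg_geometric2 (B : R) : (fun n => B / 2 ^+ n) @ \oo --> (0 : R).
Proof.
rewrite (_ : (fun n => _) = geometric B (2^-1 : R)).
  by apply: cvg_geometric; rewrite ger0_norm ?invf_lt1 ?ltr1n ?invr_ge0.
by apply/funext => n; rewrite /geometric/= exprVn.
Qed.

Lemma geometric_cauchy_real (e : nat -> R) (B : R) :
  (forall k, `|e k| <= B / 2 ^+ k) ->
  exists l, forall K, `|l - \sum_(k < K) e k| <= 2 * B / 2 ^+ K.
Proof.
move=> eB.
have B0 : 0 <= B by have := eB 0%N; rewrite expr0 divr1; exact: le_trans.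
have diff n m : (n <= m)%N ->
    `|\sum_(k < m) e k - \sum_(k < n) e k| <= 2 * B / 2 ^+ n.
  move=> nm; rewrite -!(big_mkord xpredT) (big_cat_nat (leq0n n) nm)/= addrAC subrr add0r.
  apply: (le_trans (ler_norm_sum _ _ _)).
  apply: (@le_trans _ _ (\sum_(n <= k < m) B * 2^-1 ^+ k)).
    by apply: ler_sum_nat => k _; rewrite exprVn.
  by rewrite -mulr_sumr (mulrC 2) -mulrA ler_wpM2l// geometric2_sum.
have cs : cvgn (series e).
  apply: normed_cvg; apply: (@series_le_cvg _ _ (geometric B 2^-1)) => //=.
  - by move=> n; rewrite /geometric/= mulr_ge0// exprn_ge0.
  - by move=> n; rewrite /geometric/= exprVn.
  - by apply: is_cvg_geometric_series; rewrite ger0_norm ?invf_lt1 ?ltr1n.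
exists (limn (series e)) => K.
have c1 : (fun n => `|series e n - \sum_(k < K) e k|) @ \oo -->
    `|limn (series e) - \sum_(k < K) e k|.
  by apply: cvg_norm; apply: cvgB => //; exact: cvg_cst.
rewrite -(cvg_lim (@Rhausdorff _) c1); apply: limr_le; first by apply/cvg_ex; eexists; exact: c1.
near=> n; rewrite seriesEord; apply: diff.
by near: n; exists K.
Unshelve. all: by end_near. Qed.

(** Completeness with an explicit rate, so that infinitely many sums can later be truncated at the
    same index. The constant 4 adds the real constant 2 over both components. *)
Lemma geometric_cauchy (e : nat -> R[i]) (B : R) :
  (forall k, cabs (e k) <= B / 2 ^+ k) ->
  exists l, forall K, cabs (l - \sum_(k < K) e k) <= 4 * B / 2 ^+ K.
Proof.
move=> eB.
have [a ha] := @geometric_cauchy_real (fun k => complex.Re (e k)) B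
  (fun k => le_trans (Re_le_cabs _) (eB k)).
have [b hb] := @geometric_cauchy_real (fun k => complex.Im (e k)) B
  (fun k => le_trans (Im_le_cabs _) (eB k)).
exists (Complex a b) => K.
have -> : \sum_(k < K) e k =
    Complex (\sum_(k < K) complex.Re (e k)) (\sum_(k < K) complex.Im (e k)).
  elim: K => [|K IH]; first by rewrite !big_ord0.
  by rewrite !big_ord_recr /= IH; case: (e K).
rewrite (le_trans (cabs_le_ReIm _))//=.
have -> : 4 * B / 2 ^+ K = 2 * B / 2 ^+ K + 2 * B / 2 ^+ K by ring.
exact: lerD (ha K) (hb K).
Qed.

End ComplexModulus.

(** * Local power series expansions *)

Section Expandable.
Context {R : realType}.
Implicit Types (g f : R[i] -> R[i]) (w z h : R[i]).

(* Quantitative form of being given near [w] by a convergent power series: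
   geometric bounds on half of the disc of convergence. *)
Definition expandable g w := exists (rho M : R) (c : nat -> R[i]),
  [/\ 0 < rho, forall k, cabs (c k) * rho ^+ k <= M &
  forall h n, cabs h <= rho / 2 ->
    cabs (g (w + h) - \sum_(k < n) c k * h ^+ k) <= M / 2 ^+ n].

Lemma term_le (c : nat -> R[i]) (rho M : R) k h : 0 < rho ->
  cabs (c k) * rho ^+ k <= M -> cabs h <= rho / 2 ->
  cabs (c k * h ^+ k) <= M / 2 ^+ k.
Proof.
move=> rho0 cM hr; rewrite cabsM cabsX.
have : cabs h ^+ k <= (rho / 2) ^+ k by rewrite lerXn2r ?nnegrE ?cabs_ge0// divr_ge0// ltW.
move=> /(ler_wpM2l (cabs_ge0 (c k))) /le_trans; apply.
by rewrite expr_div_n mulrA ler_pM2r// invr_gt0 exprn_gt0.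
Qed.

Lemma coef_le (a s rho M : R) k : 0 <= a -> 0 < s -> s <= rho ->
  a * rho ^+ k <= M -> a * s ^+ k <= M.
Proof.
move=> a0 s0 srho; apply: le_trans; rewrite ler_wpM2l// lerXn2r ?nnegrE//.
  exact: ltW.
exact: le_trans (ltW s0) srho.
Qed.

Lemma sum_tail_le (e : nat -> R[i]) (B : R) (n m : nat) :
  (forall k, cabs (e k) <= B / 2 ^+ k) ->
  cabs (\sum_(n <= k < m) e k) <= 2 * B / 2 ^+ n.
Proof.
move=> eB; have B0 : 0 <= B.
  by have := eB 0%N; rewrite expr0 divr1; apply: le_trans; exact: cabs_ge0.
apply: (le_trans (cabs_sum _ _ _ _)).
apply: (@le_trans _ _ (\sum_(n <= k < m) B * 2^-1 ^+ k)).
  by apply: ler_sum_nat => k _; rewrite exprVn.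
by rewrite -mulr_sumr (mulrC 2) -mulrA ler_wpM2l// geometric2_sum.
Qed.

Lemma expandable_ge0 (M : R) rho (c : nat -> R[i]) :
  (forall k, cabs (c k) * rho ^+ k <= M) -> 0 <= M.
Proof.
by move=> /(_ 0%N); rewrite expr0 mulr1; apply: le_trans; exact: cabs_ge0.
Qed.

(** Convergence is used at [h = rho], half of the given radius: the partial sums there are bounded,
    and each term is a difference of two of them. For [cabs h <= rho / 2] the tail is then
    geometric, and its sum accounts for [2 * M0]. *)
Lemma analytic_expandable g : analytic_on_disc g ->
  forall w, cabs w < 1 -> expandable g w.
Proof.
move=> ga w w1; have [e [c [e0 cv]]] := ga w w1.
pose rho := e / 2; have rho0 : 0 < rho by rewrite divr_gt0.
have rhoe : rho < e by rewrite /rho; lra.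
have cvh h : cabs h <= rho -> 
   (fun n => cabs (\sum_(k < n) c k * h ^+ k - g (w + h))) @ \oo --> (0 : R).
  move=> hr; have /cv : cabs (w + h - w) < e.
    by rewrite (_ : w + h - w = h); [exact: le_lt_trans rhoe|ring].
  move=> /cvg_cabsP; apply: cvg_trans; apply: near_eq_cvg; near=> n.
  rewrite seriesEord/= (_ : w + h - w = h)//; ring.
have rhoC : cabs ((rho%:C)%C) <= rho by rewrite cabs_real ger0_norm// ltW.
have [M0 [M0r M0P]] : exists M, 0 <= M /\ forall k, cabs (c k) * rho ^+ k <= M.
  have := cvh _ rhoC => cr.
  have := cvg_seq_bounded (cvgP _ cr).
  move=> [M [Mr MP]].
  pose M1 := `|M| + 1.
  have M1P n : cabs (\sum_(k < n) c k * ((rho%:C)%C) ^+ k - g (w + (rho%:C)%C)) <= M1.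
    have := MP M1 _ n I; rewrite /=.
    rewrite ger0_norm ?cabs_ge0//; apply.
    by rewrite /M1 (le_lt_trans (ler_norm M))// ltrDl.
  exists (M1 + M1); split; first by rewrite !addr_ge0.
  move=> k; have -> : cabs (c k) * rho ^+ k = cabs (c k * (rho%:C)%C ^+ k).
    by rewrite cabsM cabsX cabs_real ger0_norm// ltW.
  have -> : c k * (rho%:C)%C ^+ k =
     (\sum_(j < k.+1) c j * (rho%:C)%C ^+ j - g (w + (rho%:C)%C)) -
     (\sum_(j < k) c j * (rho%:C)%C ^+ j - g (w + (rho%:C)%C)).
    by rewrite big_ord_recr/=; ring.
  by rewrite (le_trans (cabsB _ _))// lerD.
exists rho, (2 * M0), c; split => // [k|h n hr].
  by rewrite (le_trans (M0P k))// ler_peMl// ler1n.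
have hr' : cabs h <= rho by rewrite (le_trans hr)//; lra.
have c1 : (fun m => cabs (\sum_(k < m) c k * h ^+ k - \sum_(k < n) c k * h ^+ k))
   @ \oo --> cabs (g (w + h) - \sum_(k < n) c k * h ^+ k).
  apply: cvg_cabs; have := cvh _ hr'; apply: cvg_trans; apply: near_eq_cvg.
  by near=> m; congr cabs; ring.
rewrite -(cvg_lim (@Rhausdorff _) c1); apply: limr_le.
  by apply/cvg_ex; eexists; exact: c1.
near=> m; have nm : (n <= m)%N by near: m; exists n.
rewrite -!(big_mkord xpredT (fun k => c k * h ^+ k)).
rewrite (big_cat_nat (leq0n n) nm)//= addrAC subrr add0r.
by apply: sum_tail_le => k; exact: term_le (M0P k) hr.
Unshelve. all: by end_near. Qed.

Lemma expandable_analytic g : (forall w, cabs w < 1 -> expandable g w) ->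
  analytic_on_disc g.
Proof.
move=> ge w /ge[rho [M [c [rho0 cM gc]]]].
exists (rho / 2), c; split; first by rewrite divr_gt0.
move=> z zw; apply/cvg_cabsP.
apply: (@squeeze_cvgr _ _ _ _ (fun=> 0) (fun n => M / 2 ^+ n)).
- near=> n; rewrite cabs_ge0/= seriesEord/= cabs_subC.
  rewrite -[X in g X](subrKC w) gc// ltW//.
- exact: cvg_cst.
- exact: cvg_geometric2.
Unshelve. all: by end_near. Qed.

Lemma expandable_cst (a : R[i]) w : expandable (fun=> a) w.
Proof.
exists 1, (cabs a), (fun k => if k == 0%N then a else 0); split => // [k|h n _].
  by rewrite expr1n mulr1; case: eqP => // _; rewrite cabs0 cabs_ge0.
case: n => [|n]; first by rewrite big_ord0 subr0 expr0 divr1.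
rewrite big_ord_recl/= big1 ?expr0 ?mulr1 ?addr0 ?subrr ?cabs0.
  by rewrite divr_ge0 ?cabs_ge0// exprn_ge0.
by move=> i _; rewrite mul0r.
Qed.

Lemma expandableD g1 g2 w : expandable g1 w -> expandable g2 w ->
  expandable (fun z => g1 z + g2 z) w.
Proof.
move=> [r1 [M1 [c1 [r10 cM1 gc1]]]] [r2 [M2 [c2 [r20 cM2 gc2]]]].
pose r := Num.min r1 r2.
have r0 : 0 < r by rewrite lt_min r10.
have rr1 : r <= r1 by rewrite ge_min lexx.
have rr2 : r <= r2 by rewrite ge_min lexx orbT.
exists r, (M1 + M2), (fun k => c1 k + c2 k); split => // [k|h n hr].
  apply: (@le_trans _ _ (cabs (c1 k) * r ^+ k + cabs (c2 k) * r ^+ k)).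
    by rewrite -mulrDl ler_wpM2r ?cabsD// exprn_ge0// ltW.
  apply: lerD.
  - exact: coef_le (cabs_ge0 _) r0 rr1 (cM1 k).
  - exact: coef_le (cabs_ge0 _) r0 rr2 (cM2 k).
have -> : g1 (w + h) + g2 (w + h) - \sum_(k < n) (c1 k + c2 k) * h ^+ k =
  (g1 (w + h) - \sum_(k < n) c1 k * h ^+ k) +
  (g2 (w + h) - \sum_(k < n) c2 k * h ^+ k).
  under eq_bigr do rewrite mulrDl.
  by rewrite big_split/=; ring.
rewrite (le_trans (cabsD _ _))// mulrDl lerD//.
  by rewrite gc1// (le_trans hr)// ler_pM2r.
by rewrite gc2// (le_trans hr)// ler_pM2r.
Qed.

Lemma eq_expandable g1 g2 w (e : R) : 0 < e ->
  (forall z, cabs (z - w) < e -> g1 z = g2 z) -> expandable g1 w -> expandable g2 w.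
Proof.
move=> e0 g12 [r1 [M1 [c1 [r10 cM1 gc1]]]].
pose r := Num.min r1 e.
have r0 : 0 < r by rewrite lt_min r10.
have rr1 : r <= r1 by rewrite ge_min lexx.
have rr2 : r <= e by rewrite ge_min lexx orbT.
exists r, M1, c1; split => // [k|h n hr].
  exact: coef_le (cabs_ge0 _) r0 rr1 (cM1 k).
rewrite -g12; first by rewrite gc1// (le_trans hr)// ler_pM2r.
have -> : w + h - w = h by ring.
by rewrite (le_lt_trans hr)//; lra.
Qed.

(** The error bound at [h = 0] gives [g w = c 0] in the limit. What remains of the series has a
    factor [h], and its shifted coefficients obey the bound [M / rho]. *)
Lemma expandable_lipschitz g w : expandable g w -> exists (r L : R),
  [/\ 0 < r, 0 <= L & forall h, cabs h <= r -> cabs (g (w + h) - g w) <= L * cabs h].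
Proof.
move=> [rho [M [c [rho0 cM gc]]]].
have M0 := expandable_ge0 _ _ _ cM.
have g0 : g w = c 0%N.
  apply/eqP; rewrite -subr_eq0 -cabs_eq0 eq_le cabs_ge0 andbT.
  apply/ler_addgt0Pr => e e0; rewrite add0r.
  have : (fun n => M / 2 ^+ n) @ \oo --> (0 : R) by exact: cvg_geometric2.
  move=> /cvgrPdist_le/(_ _ e0)[n _ /(_ n.+1 (leqnSn n))].
  rewrite sub0r normrN; apply: le_trans.
  apply: le_trans (ler_norm _).
  have := gc 0 n.+1; rewrite addr0 cabs0 big_ord_recl/= big1 ?expr0 ?mulr1 ?addr0.
    by apply; rewrite divr_ge0// ltW.
  by move=> i _; rewrite expr0n/= mulr0.
exists (rho / 2), (2 * M / rho); split; [by rewrite divr_gt0| |].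
  by rewrite divr_ge0 ?mulr_ge0// ltW.
move=> h hr; apply/ler_addgt0Pr => e e0.
have : (fun n => M / 2 ^+ n) @ \oo --> (0 : R) by exact: cvg_geometric2.
move=> /cvgrPdist_le/(_ _ e0)[n _ /(_ n.+1 (leqnSn n))].
rewrite sub0r normrN => ne.
have {}ne : cabs (g (w + h) - \sum_(k < n.+1) c k * h ^+ k) <= e.
  by apply: le_trans ne; apply: le_trans (ler_norm _); exact: gc.
apply: (le_trans (cabs_triangle (\sum_(k < n.+1) c k * h ^+ k) _ _)).
rewrite addrC; apply: lerD => //.
rewrite g0 big_ord_recl/= expr0 mulr1 addrAC subrr add0r.
under eq_bigr do rewrite /bump /= add1n exprSr mulrA.
rewrite -mulr_suml cabsM ler_wpM2r ?cabs_ge0//.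
have -> : 2 * M / rho = 2 * (M / rho) / 2 ^+ 0 by rewrite expr0 divr1 mulrA.
rewrite -(big_mkord xpredT (fun k => c k.+1 * h ^+ k)); apply: sum_tail_le => k.
apply: (@term_le (fun k => c k.+1) rho) => //=.
by rewrite ler_pdivlMr// -mulrA -exprSr.
Qed.

(* If [g = \sum c_n (z - w)^n] then [g / (1 - z)] has the coefficients given by
   [(1 - w) d_n = c_n + d_(n-1)]. *)
Fixpoint cesaro_coef w (c : nat -> R[i]) n : R[i] :=
  if n is m.+1 then (c n + cesaro_coef w c m) / (1 - w) else c 0%N / (1 - w).

Lemma expandable_cesaro g w : cabs w < 1 -> expandable g w ->
  expandable (fun z => g z / (1 - z)) w.
Proof.
move=> w1 [rho [M [c [rho0 cM gc]]]].
have M0 := expandable_ge0 _ _ _ cM.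
pose a := 1 - w; pose d := cesaro_coef w c.
have a0 : 0 < cabs a.
  rewrite lt_neqAle cabs_ge0 andbT eq_sym cabs_eq0 /a subr_eq0.
  by apply/negP => /eqP w1'; move: w1; rewrite -w1' cabs1 ltxx.
have an0 : a != 0 by rewrite -cabs_eq0 gt_eqF.
(* The cap [cabs a / 2] lets the recursion preserve the bound [2 * M / cabs a] on
   [cabs (d k) * s ^+ k], and keeps [a - h] away from 0. *)
pose s := Num.min rho (cabs a / 2).
have s0 : 0 < s by rewrite lt_min rho0 divr_gt0.
have srho : s <= rho by rewrite ge_min lexx.
have sa : s <= cabs a / 2 by rewrite ge_min lexx orbT.
have cs k : cabs (c k) * s ^+ k <= M.
  exact: coef_le (cabs_ge0 _) s0 srho (cM k).
have dS n : d n.+1 * a = c n.+1 + d n by rewrite /d/= -/a divfK.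
have d0 : d 0%N * a = c 0%N by rewrite /d/= -/a divfK.
have ds k : cabs (d k) * s ^+ k <= 2 * M / cabs a.
  elim: k => [|k IH].
    rewrite expr0 mulr1 ler_pdivlMr// -cabsM d0.
    by have := cs 0%N; rewrite expr0 mulr1 => /le_trans; apply; lra.
  rewrite ler_pdivlMr// mulrAC -cabsM dS.
  apply: (@le_trans _ _ ((cabs (c k.+1) + cabs (d k)) * s ^+ k.+1)).
    by rewrite ler_wpM2r ?cabsD// exprn_ge0// ltW.
  rewrite mulrDl (_ : 2 * M = M + M); last by ring.
  apply: lerD; first exact: cs.
  rewrite exprSr mulrA; apply: (@le_trans _ _ (2 * M / cabs a * (cabs a / 2))).
    by apply: ler_pM => //; rewrite ?mulr_ge0 ?cabs_ge0 ?exprn_ge0// ltW.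
  by rewrite mulrA mulfVK ?gt_eqF//; lra.
(* Telescoping: the truncated series of the quotient, times the denominator, misses the truncated
   series of [g] by a single term. *)
have idn h n : (a - h) * \sum_(k < n.+1) d k * h ^+ k =
    \sum_(k < n.+1) c k * h ^+ k - d n * h ^+ n.+1.
  elim: n => [|n IH].
    by rewrite !big_ord_recl !big_ord0/= !addr0 !expr0 !mulr1 expr1 -d0; ring.
  rewrite big_ord_recr mulrDr {}IH [in RHS]big_ord_recr/=.
  have -> : c n.+1 = d n.+1 * a - d n by rewrite dS; ring.
  by rewrite (exprS _ n.+1); ring.
(* The first summand serves the coefficients and the case [n = 0]. The second serves the other
   remainders, where two errors bounded by [M / 2 ^+ n] are divided by [a - h], of modulus at least
   [cabs a / 2]. *)
pose M' := (2 * M / cabs a + 4 * M / cabs a).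
have M'0 : 0 <= M' by rewrite addr_ge0// divr_ge0// ?mulr_ge0// ltW.
exists s, M', d; split => // [k|h n hs].
  by rewrite (le_trans (ds k))// /M' lerDl divr_ge0// ?mulr_ge0// ltW.
have ha : cabs a / 2 <= cabs (a - h).
  apply: le_trans (cabs_sub_ge _ _); move: hs sa a0; lra.
have ah0 : 0 < cabs (a - h) by rewrite (lt_le_trans _ ha)// divr_gt0.
have ahn0 : a - h != 0 by rewrite -cabs_eq0 gt_eqF.
have hrho : cabs h <= rho / 2 by rewrite (le_trans hs)// ler_pM2r.
have -> : 1 - (w + h) = a - h by rewrite /a; ring.
have ga : cabs (g (w + h)) <= M by have := gc h 0%N hrho; rewrite big_ord0 subr0 expr0 divr1.
have bnd x : 0 <= x -> x / cabs (a - h) <= x * 2 / cabs a.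
  move=> x0; rewrite -mulrA ler_wpM2l// -(invrK (2 / cabs a)) lef_pV2 ?posrE//.
    by rewrite invf_div.
  by rewrite invr_gt0 divr_gt0.
case: n => [|n].
  rewrite big_ord0 subr0 cabs_div expr0 divr1.
  apply: (le_trans (bnd _ (cabs_ge0 _))).
  apply: (@le_trans _ _ (M * 2 / cabs a)).
    by rewrite ler_pM2r ?invr_gt0// ler_pM2r.
  by rewrite /M' (mulrC M) lerDl divr_ge0// ?mulr_ge0// ltW.
have -> : g (w + h) / (a - h) - \sum_(k < n.+1) d k * h ^+ k =
  ((g (w + h) - \sum_(k < n.+1) c k * h ^+ k) + d n * h ^+ n.+1) / (a - h).
  apply: (mulIf ahn0); rewrite mulfVK// mulrBl mulfVK// [X in _ - X]mulrC idn.
  by ring.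
rewrite cabs_div; apply: (le_trans (bnd _ (cabs_ge0 _))).
have e1 : cabs (g (w + h) - \sum_(k < n.+1) c k * h ^+ k) <= M / 2 ^+ n.+1 by exact: gc.
have e2 : cabs (d n * h ^+ n.+1) <= M / 2 ^+ n.+1.
  rewrite exprSr mulrA cabsM.
  apply: (@le_trans _ _ ((2 * M / cabs a / 2 ^+ n) * (cabs a / 4))).
    apply: ler_pM; rewrite ?cabs_ge0//; first exact: term_le (ds n) hs.
    by move: hs sa; lra.
  rewrite exprSr invfM.
  have n0 : (2 : R) ^+ n != 0 by rewrite expf_neq0.
  have a0' : cabs a != 0 by rewrite gt_eqF.
  rewrite le_eqVlt; apply/orP; left; apply/eqP.
  move: (2 ^+ n) n0 => P P0.
  by field; rewrite P0 a0'.
apply: (@le_trans _ _ ((M / 2 ^+ n.+1 + M / 2 ^+ n.+1) * 2 / cabs a)).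
  rewrite ler_pM2r ?invr_gt0// ler_pM2r//.
  by rewrite (le_trans (cabsD _ _))// lerD.
rewrite -mulrDl.
have -> : (M + M) / 2 ^+ n.+1 * 2 / cabs a = (4 * M / cabs a) / 2 ^+ n.+1.
  have : (2 : R) ^+ n.+1 != 0 by rewrite expf_neq0.
  move: (2 ^+ n.+1) => P P0; have a0' : cabs a != 0 by rewrite gt_eqF.
  by field; rewrite a0' P0.
rewrite ler_pM2r ?invr_gt0 ?exprn_gt0//.
by rewrite /M' lerDr divr_ge0// ?mulr_ge0// ltW.
Qed.

Lemma expandable_geometric m w : cabs w < 1 ->
  expandable (fun z => (1 - z) ^- m) w.
Proof.
move=> w1; elim: m => [|m IH].
  by rewrite (_ : (fun z => _) = fun=> 1); [exact: expandable_cst|apply/funext => z; rewrite expr0 invr1].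
rewrite (_ : (fun z => _) = fun z => (1 - z) ^- m / (1 - z)).
  exact: expandable_cesaro.
by apply/funext => z; rewrite exprS invfM mulrC.
Qed.

End Expandable.

(** * Complex-valued integrals *)

Section ComplexIntegral.
Context {R : realType} (nu : {finite_measure set (measurableTypeR R) -> \bar R}).
Implicit Types (D A B : set (measurableTypeR R)) (g : R -> R[i]).

Definition cintegrable D g :=
  nu.-integrable D (EFin \o (fun t => complex.Re (g t))) /\
  nu.-integrable D (EFin \o (fun t => complex.Im (g t))).

Lemma eq_complex_integral D g1 g2 : (forall t, D t -> g1 t = g2 t) ->
  complex_integral nu D g1 = complex_integral nu D g2.
Proof.
move=> g12; congr Complex; apply: eq_Rintegral => t /set_mem Dt; by rewrite g12.
Qed.

Lemma eq_cintegrable D g1 g2 : measurable D -> (forall t, D t -> g1 t = g2 t) ->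
  cintegrable D g1 -> cintegrable D g2.
Proof.
move=> mD g12 [iR iI]; split.
  by apply: eq_integrable iR => // t /set_mem Dt /=; rewrite g12.
by apply: eq_integrable iI => // t /set_mem Dt /=; rewrite g12.
Qed.

Lemma cintegrable0 D : measurable D -> cintegrable D (fun=> 0).
Proof.
by move=> mD; split; rewrite (_ : EFin \o _ = cst 0%E)//; exact: integrable0.
Qed.

Lemma complex_integral0 D : measurable D -> complex_integral nu D (fun=> 0) = 0.
Proof.
by move=> mD; congr Complex; rewrite /= Rintegral_cst// mul0r.
Qed.

Lemma cintegrableD D g1 g2 : measurable D -> cintegrable D g1 -> cintegrable D g2 ->
  cintegrable D (fun t => g1 t + g2 t).
Proof.
move=> mD [r1 i1] [r2 i2]; split.
- apply: eq_integrable (integrableD mD r1 r2) => // t _.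
  by rewrite /=; case: (g1 t) (g2 t) => a b [].
- apply: eq_integrable (integrableD mD i1 i2) => // t _.
  by rewrite /=; case: (g1 t) (g2 t) => a b [].
Qed.

Lemma complex_integralD D g1 g2 : measurable D -> cintegrable D g1 -> cintegrable D g2 ->
  complex_integral nu D (fun t => g1 t + g2 t) =
  complex_integral nu D g1 + complex_integral nu D g2.
Proof.
move=> mD [r1 i1] [r2 i2]; rewrite /complex_integral.
rewrite [RHS]/GRing.add/=; congr Complex.
- rewrite -RintegralD//; apply: eq_Rintegral => t _.
  by case: (g1 t) (g2 t) => a b [].
- rewrite -RintegralD//; apply: eq_Rintegral => t _.
  by case: (g1 t) (g2 t) => a b [].
Qed.

Lemma cintegrableN D g : measurable D -> cintegrable D g ->
  cintegrable D (fun t => - g t).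
Proof.
move=> mD [r1 i1]; split.
- apply: eq_integrable (integrableN r1) => // t _.
  by rewrite /=; case: (g t).
- apply: eq_integrable (integrableN i1) => // t _.
  by rewrite /=; case: (g t).
Qed.

Lemma complex_integralB D g1 g2 : measurable D -> cintegrable D g1 -> cintegrable D g2 ->
  complex_integral nu D (fun t => g1 t - g2 t) =
  complex_integral nu D g1 - complex_integral nu D g2.
Proof.
move=> mD c1 c2; apply/eqP; rewrite eq_sym subr_eq -complex_integralD//.
  by apply/eqP/eq_complex_integral => t _; rewrite subrK.
by apply: cintegrableD => //; exact: cintegrableN.
Qed.

Lemma cintegrable_scale D (c : R[i]) (f : R -> R) : measurable D ->
  nu.-integrable D (EFin \o f) -> cintegrable D (fun t => c * ((f t)%:C)%C).
Proof.
move=> mD fi; case: c => a b; split.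
- apply: eq_integrable (integrableZl mD a fi) => // t _.
  by rewrite /= mulr0 subr0 EFinM.
- apply: eq_integrable (integrableZl mD b fi) => // t _.
  by rewrite /= mulr0 add0r EFinM.
Qed.

Lemma complex_integral_scale D (c : R[i]) (f : R -> R) : measurable D ->
  nu.-integrable D (EFin \o f) ->
  complex_integral nu D (fun t => c * ((f t)%:C)%C) = c * ((\int[nu]_(t in D) f t)%:C)%C.
Proof.
move=> mD fi; case: c => a b.
have cm x : Complex a b * (x%:C)%C = Complex (a * x) (b * x).
  by apply/eqP; rewrite eq_complex/= !mulr0 subr0 add0r !eqxx.
rewrite cm; congr Complex; rewrite -RintegralZl//; apply: eq_Rintegral => t _.
  by rewrite cm.
by rewrite cm.
Qed.

Lemma cintegrable_sum D (F : nat -> R -> R[i]) n : measurable D ->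
  (forall k, cintegrable D (F k)) -> cintegrable D (fun t => \sum_(k < n) F k t).
Proof.
move=> mD Fi; elim: n => [|n IH].
  apply: eq_cintegrable (cintegrable0 _ mD) => // t _; by rewrite big_ord0.
apply: eq_cintegrable (cintegrableD _ _ _ mD IH (Fi n)) => // t _.
by rewrite big_ord_recr.
Qed.

Lemma complex_integral_sum D (F : nat -> R -> R[i]) n : measurable D ->
  (forall k, cintegrable D (F k)) ->
  complex_integral nu D (fun t => \sum_(k < n) F k t) =
  \sum_(k < n) complex_integral nu D (F k).
Proof.
move=> mD Fi; elim: n => [|n IH].
  rewrite big_ord0 -[RHS](complex_integral0 _ mD).
  by apply: eq_complex_integral => t _; rewrite big_ord0.
rewrite big_ord_recr/= -IH -complex_integralD//; last exact: cintegrable_sum.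
by apply: eq_complex_integral => t _; rewrite big_ord_recr.
Qed.

Lemma complex_integral_setU A B g : measurable A -> measurable B ->
  [disjoint A & B] -> cintegrable (A `|` B) g ->
  complex_integral nu (A `|` B) g = complex_integral nu A g + complex_integral nu B g.
Proof.
move=> mA mB AB [gr gi]; rewrite [RHS]/GRing.add/=.
by congr Complex; rewrite Rintegral_setU.
Qed.

(** Real and imaginary parts are estimated separately, whence the factor 2; only orders of magnitude
    matter in the end. *)
Lemma complex_integral_le D g (N : R -> R) : measurable D ->
  nu.-integrable D (EFin \o N) -> cintegrable D g ->
  (forall t, D t -> cabs (g t) <= N t) ->
  cabs (complex_integral nu D g) <= 2 * \int[nu]_(t in D) N t.
Proof.
move=> mD Ni [gr gi] gN; rewrite (le_trans (cabs_le_ReIm _))//= mulrDl mul1r.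
apply: lerD.
- apply: (le_trans (le_normr_Rintegral mD gr)); apply: le_Rintegral => //.
    exact: integrable_norm.
  by move=> t Dt; rewrite (le_trans (Re_le_cabs _))// gN.
- apply: (le_trans (le_normr_Rintegral mD gi)); apply: le_Rintegral => //.
    exact: integrable_norm.
  by move=> t Dt; rewrite (le_trans (Im_le_cabs _))// gN.
Qed.

Lemma bounded_integrable D (f : R -> R) (B : R) : measurable D ->
  measurable_fun D f -> (forall t, D t -> `|f t| <= B) ->
  nu.-integrable D (EFin \o f).
Proof.
move=> mD mf fB; apply: measurable_bounded_integrable => //.
  by rewrite -ge0_fin_numE// fin_num_measure.
exists B; split; first exact: num_real.
by move=> x Bx t /= Dt; rewrite (le_trans (fB t Dt))// ltW.
Qed.

Lemma complex_integral_le_cst D g (B : R) : measurable D ->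
  cintegrable D g -> (forall t, D t -> cabs (g t) <= B) ->
  cabs (complex_integral nu D g) <= 2 * (B * fine (nu D)).
Proof.
move=> mD gi gB; rewrite -Rintegral_cst//; apply: complex_integral_le => //.
apply: (@bounded_integrable _ _ `|B|) => //; exact: measurable_cst.
Qed.

End ComplexIntegral.

(** * Continuity of analytic functions along curves in the disc *)

Section DiscContinuity.
Context {R : realType} {T : topologicalType}.

Lemma continuous_comp_disc (g : R[i] -> R[i]) (phi : T -> R[i]) :
  (forall w, cabs w < 1 -> expandable g w) ->
  (forall x, cabs (phi x) < 1) ->
  continuous (fun x => complex.Re (phi x)) ->
  continuous (fun x => complex.Im (phi x)) ->
  forall x (e : R), 0 < e -> \forall y \near x, cabs (g (phi y) - g (phi x)) <= e.
Proof.
move=> ge phi1 cR cI x e e0.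
have [r [L [r0 L0 gL]]] := expandable_lipschitz _ _ (ge _ (phi1 x)).
pose d := Num.min r (e / (L + 1)).
have L10 : 0 < L + 1 by lra.
have d0 : 0 < d by rewrite lt_min r0 divr_gt0.
have d20 : 0 < d / 2 by rewrite divr_gt0.
have /cvgrPdist_le/(_ _ d20) nR := cR x.
have /cvgrPdist_le/(_ _ d20) nI := cI x.
near=> y.
have yd : cabs (phi y - phi x) <= d.
  rewrite cabs_subC (le_trans (cabs_le_ReIm _))// (_ : d = d / 2 + d / 2); last by lra.
  apply: lerD.
  - have : `|complex.Re (phi x) - complex.Re (phi y)| <= d / 2 by near: y.
    by case: (phi x) (phi y) => a b [].
  - have : `|complex.Im (phi x) - complex.Im (phi y)| <= d / 2 by near: y.
    by case: (phi x) (phi y) => a b [].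
rewrite -(subrKC (phi x) (phi y)).
rewrite (le_trans (gL _ (le_trans yd _)))//; first by rewrite ge_min lexx.
apply: (@le_trans _ _ (L * (e / (L + 1)))).
  by rewrite ler_wpM2l// (le_trans yd)// ge_min lexx orbT.
rewrite mulrA ler_pdivrMr// mulrC ler_wpM2l//; lra.
Unshelve. all: by end_near. Qed.

Lemma continuous_cabs_disc (g : R[i] -> R[i]) (phi : T -> R[i]) :
  (forall w, cabs w < 1 -> expandable g w) ->
  (forall x, cabs (phi x) < 1) ->
  continuous (fun x => complex.Re (phi x)) ->
  continuous (fun x => complex.Im (phi x)) ->
  continuous (fun x => cabs (g (phi x))).
Proof.
move=> ge phi1 cR cI x; apply/cvgrPdist_le => e e0.
apply: filterS (continuous_comp_disc _ _ ge phi1 cR cI x _ e0) => y h.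
rewrite ler_norml; apply/andP; split.
  by rewrite lerNl opprB (le_trans (cabs_sub_ge _ _)).
by rewrite (le_trans (cabs_sub_ge _ _))// cabs_subC.
Qed.

Lemma continuous_ReIm_disc (g : R[i] -> R[i]) (phi : T -> R[i]) :
  (forall w, cabs w < 1 -> expandable g w) ->
  (forall x, cabs (phi x) < 1) ->
  continuous (fun x => complex.Re (phi x)) ->
  continuous (fun x => complex.Im (phi x)) ->
  continuous (fun x => complex.Re (g (phi x))) /\
  continuous (fun x => complex.Im (g (phi x))).
Proof.
move=> ge phi1 cR cI; split => x; apply/cvgrPdist_le => e e0.
- apply: filterS (continuous_comp_disc _ _ ge phi1 cR cI x _ e0) => y h.
  apply: le_trans h; rewrite cabs_subC; apply: le_trans (Re_le_cabs _).
  by case: (g (phi x)) (g (phi y)) => a b [].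
- apply: filterS (continuous_comp_disc _ _ ge phi1 cR cI x _ e0) => y h.
  apply: le_trans h; rewrite cabs_subC; apply: le_trans (Im_le_cabs _).
  by case: (g (phi x)) (g (phi y)) => a b [].
Qed.

End DiscContinuity.

(** * Radial averages of analytic functions *)

(** Compactness of [0, 1] in additive form. Let [A] be the set of the x reached from 0. Some x in
    [A] lies within [d] of [sup A], so the local hypothesis leads from x to [y], beyond [sup A]
    unless [y = 1]. *)
Lemma interval_additive_ind {R : realType} (P : R -> R -> Prop) :
  (forall t, 0 <= t <= 1 -> exists2 d : R, 0 < d &
    forall a b, 0 <= a -> a <= b -> b <= 1 -> `|a - t| <= d -> `|b - t| <= d -> P a b) ->
  (forall a b c, 0 <= a -> a <= b -> b <= c -> c <= 1 -> P a b -> P b c -> P a c) ->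
  P 0 1.
Proof.
move=> Ploc Padd.
pose A := [set x : R | 0 <= x <= 1 /\ P 0 x].
have A0 : A 0.
  split; first by rewrite lexx ler01.
  have [|d d0] := Ploc 0; first by rewrite lexx ler01.
  by apply; rewrite ?subrr ?normr0// ltW.
have Aub : ubound A 1 by move=> x [/andP[]].
have hA : has_sup A by split; [exists 0|exists 1].
have s0 : 0 <= sup A by apply: ub_le_sup => //; case: hA.
have s1 : sup A <= 1 by apply: ge_sup => //; exists 0.
have [|d d0 dP] := Ploc (sup A); first by rewrite s0 s1.
have [x Ax sx] := sup_adherent d0 hA.
have xs : x <= sup A by apply: ub_le_sup => //; case: hA.
pose y := Num.min (sup A + d) 1.
have sy : sup A <= y by rewrite le_min s1 andbT lerDl ltW.
have y1 : y <= 1 by rewrite ge_min lexx orbT.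
have ysd : y <= sup A + d by rewrite ge_min lexx.
have [/andP[x0 x1] Px] := Ax.
have Py : P 0 y.
  apply: (Padd _ x) => //; first exact: le_trans xs sy.
  apply: dP => //; first exact: le_trans xs sy.
    by rewrite ler_norml; apply/andP; split; lra.
  by rewrite ler_norml; apply/andP; split; lra.
have : A y by split => //; rewrite y1 (le_trans s0 sy).
move=> /(ub_le_sup (ex_intro _ _ Aub)) ys.
suff -> : 1 = y by [].
apply/eqP; rewrite eq_le y1 andbT leNgt; apply/negP => y1'.
have : y = sup A + d.
  rewrite /y; case: (leP (sup A + d) 1) => // h.
  by move: y1'; rewrite /y minEle leNgt h/= ltxx.
by move=> yE; move: ys; rewrite yE; lra.
Qed.

Section Clamp.
Context {R : realType}.

(** Extends functions of the radial variable continuously to the whole line: [clamp t * z] stays in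
    the disc for every real t, so measurability follows from global continuity. *)
Definition clamp (t : R) : R := Num.max 0 (Num.min t 1).

Lemma clamp_ge0 t : 0 <= clamp t. Proof. by rewrite le_max lexx. Qed.

Lemma clamp_le1 t : clamp t <= 1.
Proof. by rewrite ge_max ler01 ge_min lexx orbT. Qed.

Lemma clamp_id t : 0 <= t -> t <= 1 -> clamp t = t.
Proof. by move=> t0 t1; rewrite /clamp (min_idPl t1) (max_idPr t0). Qed.

Lemma continuous_clamp : continuous clamp.
Proof.
move=> t; apply: (@continuous_max R R (fun=> 0) (fun t => Num.min t 1)).
  exact: cst_continuous.
apply: (@continuous_min R R id (fun=> 1)); last exact: cst_continuous.
exact: cvg_id.
Qed.

End Clamp.

Section Transform.
Context {R : realType} (nu : {finite_measure set (measurableTypeR R) -> \bar R}).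
Implicit Types (g : R[i] -> R[i]) (z : R[i]).

(* [cesaro_op mu f] is [transform mu (fun z => f z / (1 - z))] by conversion. *)
Definition transform g z : R[i] :=
  complex_integral nu `[0, 1[ (fun t => g ((t%:C)%C * z)).

Lemma cabs_scale_lt1 (t : R) z : 0 <= t -> t <= 1 -> cabs z < 1 ->
  cabs ((t%:C)%C * z) < 1.
Proof.
move=> t0 t1 z1; rewrite cabsM cabs_real ger0_norm//.
by rewrite (le_lt_trans _ z1)// ler_piMl// cabs_ge0.
Qed.

Let ReM_real (t : R) z : complex.Re ((t%:C)%C * z) = t * complex.Re z.
Proof. by case: z => a b /=; rewrite mul0r subr0. Qed.

Let ImM_real (t : R) z : complex.Im ((t%:C)%C * z) = t * complex.Im z.
Proof. by case: z => a b /=; rewrite mul0r addr0. Qed.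

Section Radius.
Variables (g : R[i] -> R[i]) (z : R[i]).
Hypotheses (ge : forall w, cabs w < 1 -> expandable g w) (z1 : cabs z < 1).

Let phi (t : R) := (((clamp t)%:C)%C * z).

Let phi1 t : cabs (phi t) < 1.
Proof. by apply: cabs_scale_lt1; rewrite ?clamp_ge0 ?clamp_le1. Qed.

Let phiR : continuous (fun t => complex.Re (phi t)).
Proof.
rewrite (_ : (fun t => _) = fun t => clamp t * complex.Re z).
  by move=> t; apply: cvgMl; exact: continuous_clamp.
by apply/funext => t; rewrite ReM_real.
Qed.

Let phiI : continuous (fun t => complex.Im (phi t)).
Proof.
rewrite (_ : (fun t => _) = fun t => clamp t * complex.Im z).
  by move=> t; apply: cvgMl; exact: continuous_clamp.
by apply/funext => t; rewrite ImM_real.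
Qed.

Let phi_id t : 0 <= t < 1 -> phi t = (t%:C)%C * z.
Proof. by move=> /andP[t0 t1]; rewrite /phi clamp_id// ltW. Qed.

Lemma measurable_cabs_radius :
  measurable_fun (`[0, 1[ : set (measurableTypeR R)) (fun t => cabs (g ((t%:C)%C * z))).
Proof.
apply: (@eq_measurable_fun _ _ _ _ _ (fun t => cabs (g (phi t)))).
  by move=> t /set_mem/=; rewrite in_itv/= => /phi_id ->.
apply: measurable_funTS; apply: continuous_measurable_fun.
exact: continuous_cabs_disc.
Qed.

(** As [cabs z < 1], the closed segment, end point [t = 1] included, lies in the disc and the
    extreme value theorem applies. *)
Lemma radius_bounded : exists B : R, forall t, 0 <= t < 1 -> cabs (g ((t%:C)%C * z)) <= B.
Proof.
have [|c _ cP] := @EVT_max R (fun t => cabs (g (phi t))) 0 1 ler01.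
  by apply: continuous_subspaceT; exact: continuous_cabs_disc.
exists (cabs (g (phi c))) => t t01; rewrite -phi_id// cP//.
by move: t01; rewrite in_itv/= => /andP[-> /ltW].
Qed.

Lemma cintegrable_radius : cintegrable nu `[0, 1[ (fun t => g ((t%:C)%C * z)).
Proof.
have [B BP] := radius_bounded.
have [cR cI] := continuous_ReIm_disc _ _ ge phi1 phiR phiI.
split.
- apply: (@bounded_integrable _ _ _ _ B) => //.
    apply: (@eq_measurable_fun _ _ _ _ _ (fun t => complex.Re (g (phi t)))).
      by move=> t /set_mem/=; rewrite in_itv/= => /phi_id ->.
    by apply: measurable_funTS; apply: continuous_measurable_fun.
  by move=> t /=; rewrite in_itv/= => t01; apply: le_trans (Re_le_cabs _) (BP _ t01).
- apply: (@bounded_integrable _ _ _ _ B) => //.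
    apply: (@eq_measurable_fun _ _ _ _ _ (fun t => complex.Im (g (phi t)))).
      by move=> t /set_mem/=; rewrite in_itv/= => /phi_id ->.
    by apply: measurable_funTS; apply: continuous_measurable_fun.
  by move=> t /=; rewrite in_itv/= => t01; apply: le_trans (Im_le_cabs _) (BP _ t01).
Qed.

End Radius.

Lemma integrable_poly (a b t0 : R) (n m : nat) :
  nu.-integrable `[a, b[ (EFin \o (fun t => t ^+ n * (t - t0) ^+ m)).
Proof.
have cf : continuous (fun t : R => t ^+ n * (t - t0) ^+ m).
  move=> t; apply: cvgM; first exact: exprn_continuous.
  apply: (@cvg_comp _ _ _ (fun t : R => t - t0) (fun t => t ^+ m)).
    by apply: cvgB; [exact: cvg_id|exact: cvg_cst].
  exact: exprn_continuous.
have [ab|ba] := leP a b; last first.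
  by rewrite set_itv_ge ?bnd_simp -?leNgt ?ltW//; exact: integrable_set0.
have [|c _ cP] := @EVT_max R (fun t => `|t ^+ n * (t - t0) ^+ m|) a b ab.
  by apply: continuous_subspaceT => t; apply: cvg_norm; exact: cf.
apply: (@bounded_integrable _ _ _ _ `|c ^+ n * (c - t0) ^+ m|) => //.
  by apply: measurable_funTS; exact: continuous_measurable_fun.
by move=> t /=; rewrite in_itv/= => /andP[? /ltW ?]; apply: cP; rewrite in_itv/=; apply/andP.
Qed.

Lemma binomial_term_le (x y : R) k n : 0 <= x -> 0 <= y ->
  'C(k, n)%:R * (y ^+ n * x ^+ (k - n)) <= (x + y) ^+ k.
Proof.
move=> x0 y0; have [kn|nk] := ltnP k n.
  by rewrite bin_small// mul0r exprn_ge0// addr_ge0.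
rewrite GRing.exprDn (bigD1 (Ordinal (nk : (n < k.+1)%N)))//=.
rewrite mulr_natl mulrC lerDl; apply: sumr_ge0 => i _.
by rewrite mulrn_wge0// mulr_ge0// exprn_ge0.
Qed.

(* Re-expansion around [z0] of the power series of [g] at [t0 z0], integrated
   term by term over a short piece of the radius. *)
Lemma transform_piece_expandable g (t0 : R) z0 :
  (forall w, cabs w < 1 -> expandable g w) -> cabs z0 < 1 -> 0 <= t0 <= 1 ->
  exists2 d : R, 0 < d & forall a b, 0 <= a -> a <= b -> b <= 1 ->
    `|a - t0| <= d -> `|b - t0| <= d ->
    expandable (fun z => complex_integral nu `[a, b[ (fun t => g ((t%:C)%C * z))) z0.
Proof.
move=> ge z01 /andP[t00 t01].
(* The radius is shrunk below [1 - cabs z0] so that [z0 + h] stays in the disc. *)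
have [rho [M [c [rho0 cM gc rho1]]]] : exists (rho M : R) (c : nat -> R[i]),
    [/\ 0 < rho, forall k, cabs (c k) * rho ^+ k <= M,
    forall h n, cabs h <= rho / 2 ->
      cabs (g ((t0%:C)%C * z0 + h) - \sum_(k < n) c k * h ^+ k) <= M / 2 ^+ n &
    rho <= 1 - cabs z0].
  have [r [M [c [r0 cM gc]]]] := ge _ (cabs_scale_lt1 _ _ t00 t01 z01).
  pose r' := Num.min r (1 - cabs z0).
  have r'r : r' <= r by rewrite ge_min lexx.
  have r'0 : 0 < r' by rewrite lt_min r0 subr_gt0.
  exists r', M, c; split => // [k|h n hr|]; last by rewrite ge_min lexx orbT.
    exact: coef_le (cabs_ge0 _) r'0 r'r (cM k).
  by apply: gc; rewrite (le_trans hr)// ler_pM2r.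
have M0 := expandable_ge0 _ _ _ cM.
(* With [s = rho / 4] below, [t h + (t - t0) z0] has modulus at most [s / 2 + rho / 8 <= rho / 2],
   and [s + rho / 8 <= rho / 2] controls the binomial sums. *)
exists (rho / 8); first by rewrite divr_gt0.
move=> a b a0 ab b1 at0 bt0.
pose D : set (measurableTypeR R) := `[a, b[%classic.
have mD : measurable D by exact: measurable_itv.
pose V := fine (nu D).
have V0 : 0 <= V by rewrite fine_ge0.
pose s := rho / 4; have s0 : 0 < s by rewrite divr_gt0.
have Dt t : D t -> [/\ 0 <= t, t <= 1 & `|t - t0| <= rho / 8].
  rewrite /D/= in_itv/= => /andP[lat ltb]; split.
  - exact: le_trans lat.
  - exact: le_trans (ltW ltb) b1.
  - move: at0 bt0; rewrite !ler_norml => /andP[? ?] /andP[? ?].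
    by apply/andP; split; lra.
pose f k n (t : R) := t ^+ n * (t - t0) ^+ (k - n).
pose m k n := \int[nu]_(t in D) f k n t.
have fi k n : nu.-integrable D (EFin \o f k n) by exact: integrable_poly.
have mle k n : `|m k n| <= V * (rho / 8) ^+ (k - n).
  apply: (le_trans (le_normr_Rintegral mD (fi k n))).
  rewrite mulrC -Rintegral_cst//; apply: le_Rintegral => //.
  - exact: (integrable_norm (fi k n)).
  - exact: finite_measure_integrable_cst.
  - move=> t /Dt[t0' t1' tt0]; rewrite /f normrM !normrX -[leRHS]mul1r.
    apply: ler_pM; rewrite ?exprn_ge0//.
      by rewrite exprn_ile1// ger0_norm.
    by rewrite lerXn2r ?nnegrE// divr_ge0// ltW.
(* The contribution of [c k] to the coefficient of [h ^+ n]: a binomial term of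
   [(t h + (t - t0) z0) ^+ k], integrated in t. *)
pose e k n : R[i] := c k * z0 ^+ (k - n) *+ 'C(k, n) * ((m k n)%:C)%C.
have ele k n : cabs (e k n) * s ^+ n <= M * V / 2 ^+ k.
  rewrite /e -mulr_natr !cabsM cabsX cabs_nat cabs_real.
  set A := cabs z0 ^+ (k - n) * `|m k n|.
  have AP : A <= V * (rho / 8) ^+ (k - n).
    rewrite -[leRHS]mul1r /A; apply: ler_pM; rewrite ?exprn_ge0 ?cabs_ge0//.
    by rewrite exprn_ile1// ?cabs_ge0// ltW.
  rewrite (_ : _ * _ = cabs (c k) * ('C(k, n)%:R * (s ^+ n * A))); last by rewrite /A; ring.
  apply: (@le_trans _ _ (cabs (c k) * (V * (rho / 2) ^+ k))).
    rewrite ler_wpM2l ?cabs_ge0//.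
    apply: (@le_trans _ _ (V * ('C(k, n)%:R * (s ^+ n * (rho / 8) ^+ (k - n))))).
      rewrite [leRHS](_ : _ = 'C(k, n)%:R * (s ^+ n * (V * (rho / 8) ^+ (k - n)))); last by ring.
      by rewrite ler_wpM2l// ler_wpM2l// exprn_ge0// ltW.
    rewrite ler_wpM2l// (le_trans (binomial_term_le _ _ _ _ _ _))//.
    - by rewrite divr_ge0// ltW.
    - exact: ltW.
    - by rewrite lerXn2r// ?nnegrE ?addr_ge0 ?divr_ge0 ?(ltW rho0) ?(ltW s0)// /s; lra.
  rewrite expr_div_n [leLHS](_ : _ = V / 2 ^+ k * (cabs (c k) * rho ^+ k)); last by ring.
  rewrite [leRHS](_ : _ = V / 2 ^+ k * M); last by ring.
  by rewrite ler_wpM2l// divr_ge0// exprn_ge0.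
have e0 k n : (k < n)%N -> e k n = 0.
  by move=> kn; rewrite /e bin_small// mulr0n mul0r.
have exl n : exists l, forall K,
    cabs (l - \sum_(k < K) e k n * ((s%:C)%C) ^+ n) <= 4 * (M * V) / 2 ^+ K.
  apply: (geometric_cauchy (fun k => e k n * ((s%:C)%C) ^+ n)) => k.
  by rewrite cabsM cabsX cabs_real (ger0_norm (ltW s0)).
pose l n := projT1 (cid (exl n)).
have lP n K : cabs (l n - \sum_(k < K) e k n * ((s%:C)%C) ^+ n) <= 4 * (M * V) / 2 ^+ K.
  by rewrite /l; case: cid.
have sn0 : (s%:C)%C != 0 by rewrite -cabs_eq0 cabs_real normr_eq0 gt_eqF.
(* The new coefficient [d n] is the sum of [e k n] over k; after scaling by [s ^+ n] the rate of
   convergence does not depend on n. *)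
have [d dl] : exists d : nat -> R[i], forall n, d n * ((s%:C)%C) ^+ n = l n.
  by exists (fun n => l n / ((s%:C)%C) ^+ n) => n; rewrite divfK// expf_neq0.
exists s, (10 * (M * V)), d; split => // [n|h N hs].
  have -> : cabs (d n) * s ^+ n = cabs (l n).
    by rewrite -dl cabsM cabsX cabs_real (ger0_norm (ltW s0)).
  have := lP n 0%N; rewrite big_ord0 subr0 expr0 divr1 => /le_trans; apply.
  by rewrite ler_wpM2r ?mulr_ge0// ler_nat.
pose F k n (t : R) : R[i] := c k * z0 ^+ (k - n) *+ 'C(k, n) * h ^+ n * ((f k n t)%:C)%C.
pose P t := \sum_(k < N) \sum_(n < N) F k n t.
have Fi k n : cintegrable nu D (F k n) by exact: cintegrable_scale.
have Pi : cintegrable nu D P.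
  apply: (cintegrable_sum _ _ (fun k t => \sum_(n < N) F k n t)) => // k.
  exact: cintegrable_sum.
have IP : complex_integral nu D P = \sum_(k < N) \sum_(n < N) e k n * h ^+ n.
  rewrite (complex_integral_sum _ _ (fun k t => \sum_(n < N) F k n t))//; last first.
    by move=> k; exact: cintegrable_sum.
  apply: eq_bigr => k _; rewrite complex_integral_sum//; apply: eq_bigr => n _.
  by rewrite complex_integral_scale// /e -/(m k n); ring.
have PE t : P t = \sum_(k < N) c k * ((t%:C)%C * h + ((t - t0)%:C)%C * z0) ^+ k.
  apply: eq_bigr => k _; rewrite addrC GRing.exprDn mulr_sumr.
  rewrite (big_ord_widen N (fun i => c k * (((((t - t0)%:C)%C * z0) ^+ (k - i) *
    ((t%:C)%C * h) ^+ i) *+ 'C(k, i)))); last exact: ltn_ord.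
  rewrite [RHS]big_mkcond/=; apply: eq_bigr => n _; rewrite ltnS leqNgt.
  case: ltnP => kn /=; first by rewrite /F bin_small// mulr0n !mul0r.
  rewrite /F /f !exprMn rmorphM !rmorphXn/= !mulrnAl mulrnAr; congr (_ *+ _).
  move: (z0 ^+ (k - n)) (h ^+ n) (((t - t0)%:C)%C ^+ (k - n)) ((t%:C)%C ^+ n) (c k) => A1 A2 A3 A4 A5.
  by ring.
have small t : D t -> cabs ((t%:C)%C * h + ((t - t0)%:C)%C * z0) <= rho / 2.
  move=> /Dt[t0' t1' tt0]; apply: (le_trans (cabsD _ _)).
  rewrite !cabsM !cabs_real (ger0_norm t0').
  have -> : rho / 2 = 1 * (s / 2) + (rho / 8 + rho / 4) * 1 by rewrite /s; lra.
  apply: lerD; first by apply: ler_pM; rewrite ?cabs_ge0.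
  apply: ler_pM; rewrite ?cabs_ge0// ?(ltW z01)//.
  by rewrite (le_trans tt0)// lerDl divr_ge0// ltW.
have ghi : cintegrable nu D (fun t => g ((t%:C)%C * (z0 + h))).
  have z0h1 : cabs (z0 + h) < 1.
    by rewrite (le_lt_trans (cabsD _ _))//; move: hs rho0 rho1; rewrite /s; lra.
  have [hR hI] := cintegrable_radius _ _ ge z0h1.
  have sub : D `<=` `[0, 1[.
    move=> t; rewrite /D/= !in_itv/= => /andP[? ?].
    by apply/andP; split; [exact: le_trans a0 _|exact: lt_le_trans b1].
  by split; [exact: integrableS hR|exact: integrableS hI].
have errP : cabs (complex_integral nu D (fun t => g ((t%:C)%C * (z0 + h))) -
    complex_integral nu D P) <= 2 * (M / 2 ^+ N * V).
  rewrite -complex_integralB//; apply: complex_integral_le_cst => //.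
    by apply: cintegrableD => //; exact: cintegrableN.
  move=> t Dtt; rewrite PE.
  have -> : (t%:C)%C * (z0 + h) = (t0%:C)%C * z0 + ((t%:C)%C * h + ((t - t0)%:C)%C * z0).
    by rewrite rmorphB/=; ring.
  by apply: gc; exact: small.
(* [P] truncates at [N] in both indices. Truncating in k under the integral costs 2 units of the
   constant 10, and replacing each [d n] by its partial sum costs the other 8. *)
apply: (le_trans (cabs_triangle (complex_integral nu D P) _ _)).
have -> : 10 * (M * V) / 2 ^+ N =
    2 * (M / 2 ^+ N * V) + 2 * (4 * (M * V) / 2 ^+ N) / 2 ^+ 0.
  by rewrite expr0 divr1; ring.
apply: lerD => //.
rewrite IP exchange_big/= -sumrB -(big_mkord xpredT (fun n => \sum_(k < N) e k n * h ^+ n - d n * h ^+ n)).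
apply: sum_tail_le => n.
rewrite -mulr_suml -mulrBl.
apply: (term_le (fun n => \sum_(k < N) e k n - d n) s) => //=.
have -> : cabs (\sum_(k < N) e k n - d n) * s ^+ n =
    cabs (l n - \sum_(k < N) e k n * ((s%:C)%C) ^+ n).
  rewrite -mulr_suml -dl -mulrBl cabsM cabsX cabs_real (ger0_norm (ltW s0)).
  by rewrite cabs_subC.
exact: lP.
Qed.

(** Half-open pieces are disjoint, so their integrals add up. This is known only inside the disc,
    where the integrand is integrable, hence the passage through [eq_expandable] with radius
    [1 - cabs z]. *)
Lemma transform_expandable g : (forall w, cabs w < 1 -> expandable g w) ->
  forall z, cabs z < 1 -> expandable (transform g) z.
Proof.
move=> ge z z1.
apply: (interval_additive_ind (fun a b =>
  expandable (fun z => complex_integral nu `[a, b[ (fun t => g ((t%:C)%C * z))) z)).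
  by move=> t t01; exact: transform_piece_expandable.
move=> a b c a0 ab bc c1 eab ebc.
have e0 : 0 < 1 - cabs z by rewrite subr_gt0.
apply: (eq_expandable _ _ _ _ e0 _ (expandableD _ _ _ eab ebc)) => y yz.
have y1 : cabs y < 1.
  by rewrite -(subrK z y) (le_lt_trans (cabsD _ _))// -ltrBrDr.
have U : (`[a, b[ `|` `[b, c[ = `[a, c[ :> set R)%classic.
  by rewrite -itv_bndbnd_setU// bnd_simp.
rewrite -complex_integral_setU ?U//.
- apply/disj_setPS => t [/=]; rewrite !in_itv/= => /andP[_ tb] /andP[bt _].
  by move: tb; rewrite ltNge bt.
- have [hR hI] := cintegrable_radius _ _ ge y1.
  have sub : (`[a, c[%classic : set R) `<=` `[0, 1[%classic.
    move=> t; rewrite /= !in_itv/= => /andP[? ?].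
    by apply/andP; split; [exact: le_trans a0 _|exact: lt_le_trans c1].
  by split; [exact: integrableS hR|exact: integrableS hI].
Qed.

Lemma transform_analytic g : analytic_on_disc g -> analytic_on_disc (transform g).
Proof.
by move=> /analytic_expandable ga; apply/expandable_analytic/transform_expandable.
Qed.

End Transform.

(** * Minkowski's inequality for radial averages *)

(* No measurability is needed: the integral of a nonnegative function is a
   supremum over the simple functions below it. *)
Lemma ge0_le_integral_any {d} {T : measurableType d} {R : realType}
    (mu : {measure set T -> \bar R}) (D : set T) (f1 f2 : T -> \bar R) :
  (forall x, D x -> (0 <= f1 x)%E) -> (forall x, D x -> (f1 x <= f2 x)%E) ->
  (\int[mu]_(x in D) f1 x <= \int[mu]_(x in D) f2 x)%E.
Proof.
move=> f10 f12.
have f20 x : D x -> (0 <= f2 x)%E by move=> Dx; rewrite (le_trans (f10 _ Dx))// f12.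
rewrite !ge0_integralE//; apply: ereal_sup_le => _ [h hf1 <-].
exists h => // x; apply: le_trans (hf1 x) _.
by rewrite /patch; case: ifPn => // /set_mem /f12.
Qed.

(** The graph of [v ^ s] lies above its tangent at [l]. This is Young's inequality for [v] and
    [l ^ (s - 1)]; the case [s = 1], whose conjugate exponent is infinite, is treated apart. *)
Lemma young_tangent {R : realType} (s v l : R) : 1 <= s -> 0 <= v -> 0 <= l ->
  s * l `^ (s - 1) * v <= v `^ s + (s - 1) * l `^ s.
Proof.
rewrite le_eqVlt => /orP[/eqP<- v0 l0|s1 v0 l0].
  by rewrite subrr powRr0 powRr1// !mul1r mul0r addr0.
have s0 : 0 < s by rewrite (lt_trans ltr01).
have s10 : 0 < s - 1 by rewrite subr_gt0.
have sn0 : s != 0 by rewrite gt_eqF.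
have s1n0 : s - 1 != 0 by rewrite gt_eqF.
have e1 : s^-1 + (s - 1) / s = 1 by field.
have := @conjugate_powR R v (l `^ (s - 1)) s (s / (s - 1)) v0 (powR_ge0 _ _) s0.
rewrite divr_gt0// => /(_ isT).
rewrite -powRrM [(s - 1) * _]mulrC divfK// invf_div => /(_ e1)/(ler_wpM2l (ltW s0)).
rewrite (_ : s * (v `^ s / s + _) = v `^ s + (s - 1) * l `^ s); last by field.
by rewrite [v * _]mulrC mulrA.
Qed.

(* [h] is the limit of its step functions in the second variable. *)
Lemma measurable_caratheodory {R : realType} (h : R -> R -> R) :
  (forall t, measurable_fun setT (h ^~ t : measurableTypeR R -> measurableTypeR R)) ->
  (forall x, continuous (h x)) ->
  measurable_fun setT (fun u : measurableTypeR R * measurableTypeR R =>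
    h u.1 u.2 * \1_(`[0, 1[ : set (measurableTypeR R)) u.2 : measurableTypeR R).
Proof.
move=> mh ch.
pose B n k : set (measurableTypeR R) := `[k%:R / n.+1%:R, k.+1%:R / n.+1%:R[%classic.
pose H n (u : measurableTypeR R * measurableTypeR R) : measurableTypeR R :=
  \sum_(k < n.+1) h u.1 (k%:R / n.+1%:R) * \1_(B n k) u.2.
apply: (@measurable_fun_cvg _ _ _ _ H).
  move=> n; apply: measurable_sum => k; apply: measurable_funM.
    exact: (measurableT_comp (mh _) measurable_fst).
  apply: (measurableT_comp _ measurable_snd); apply: measurable_indic.
  exact: measurable_itv.
move=> [x t] _ /=; rewrite indicE /=.
have n0 n : 0 < n.+1%:R :> R by rewrite ltr0n.
have [t01|nt01] := boolP (t \in _); last first.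
  rewrite mulr0 (_ : H^~ (x, t) = cst 0); first exact: cvg_cst.
  apply/funext => n; rewrite /H /= big1// => k _.
  rewrite indicE memNset ?mulr0// /B/= in_itv/= => /andP[kt tk].
  move: nt01; rewrite notin_setE/=; apply; rewrite in_itv/=; apply/andP; split.
    by rewrite (le_trans _ kt)// divr_ge0.
  by rewrite (lt_le_trans tk)// ler_pdivrMr// mul1r ler_nat.
rewrite mulr1.
move: t01; rewrite inE/= in_itv/= => /andP[t0 t1].
(* The index of the cell of mesh [1 / n.+1] that contains t; [H n] samples [h x] at the left end of
   that cell. *)
pose K n := Num.truncn (t * n.+1%:R).
have KP n : (K n)%:R <= t * n.+1%:R < (K n).+1%:R.
  by apply: truncn_itv; rewrite mulr_ge0.
have Kn n : (K n < n.+1)%N.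
  rewrite -(ltr_nat R); have /andP[h1 _] := KP n.
  by rewrite (le_lt_trans h1)// gtr_pMl.
have HE n : H n (x, t) = h x ((K n)%:R / n.+1%:R).
  rewrite /H (bigD1 (Ordinal (Kn n)))//= big1 ?addr0.
    rewrite indicE mem_set ?mulr1// /B/= in_itv/= ler_pdivrMr// ltr_pdivlMr//.
  move=> k kK; rewrite indicE memNset ?mulr0// /B/= in_itv/=.
  rewrite ler_pdivrMr// ltr_pdivlMr// => /andP[h1 h2].
  have /andP[h3 h4] := KP n.
  move/negP: kK; apply; apply/eqP/val_inj => /=.
  have := le_lt_trans h1 h4; have := le_lt_trans h3 h2.
  by rewrite !ltr_nat !ltnS => ? ?; apply/eqP; rewrite eqn_leq; apply/andP.
rewrite (_ : H^~ (x, t) = fun n => h x ((K n)%:R / n.+1%:R)); last exact/funext.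
apply: (cvg_comp (fun n => (K n)%:R / n.+1%:R) (h x)); last exact: ch.
apply: (@squeeze_cvgr _ _ _ _ (fun n => t - n.+1%:R^-1) (fun=> t)).
- near=> n; have /andP[h1 h2] := KP n; apply/andP; split.
    rewrite lerBlDr -[X in _ + X]mul1r -mulrDl ler_pdivlMr//.
    by rewrite natr1; exact: ltW.
  by rewrite ler_pdivrMr.
- rewrite -[X in _ --> X]subr0; apply: cvgB; first exact: cvg_cst.
  exact: cvg_harmonic.
- exact: cvg_cst.
Unshelve. all: by end_near. Qed.

Section Circle.
Context {R : realType}.

Lemma circle_scale (t r theta : R) :
  (t%:C)%C * circle_point r theta = circle_point (t * r) theta.
Proof.
by apply/eqP; rewrite eq_complex/= !mul0r subr0 addr0 !mulrA !eqxx.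
Qed.

Lemma cabs_circle (r theta : R) : 0 <= r -> cabs (circle_point r theta) = r.
Proof.
move=> r0; rewrite /cabs/= !exprMn -mulrDr cos2Dsin2 mulr1 sqrtr_sqr ger0_norm//.
Qed.

End Circle.

Section Minkowski.
Context {R : realType} (nu : {finite_measure set (measurableTypeR R) -> \bar R}).
Let D : set (measurableTypeR R) := `[0, 1[%classic.
Variables (N : R -> R) (m M S : R).
Hypotheses (mN : measurable_fun (setT : set (measurableTypeR R)) N)
  (m0 : 0 < m) (Nm : forall t, m <= N t) (NM : forall t, N t <= M)
  (S0 : 0 < S) (NS : \int[nu]_(t in D) N t <= S).

Let mD : measurable D. Proof. exact: measurable_itv. Qed.

Let N0 t : 0 < N t. Proof. exact: lt_le_trans m0 (Nm t). Qed.

Let N_integrable : nu.-integrable D (EFin \o N).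
Proof.
apply: (bounded_integrable _ _ _ M) => //; first exact: measurable_funTS.
by move=> t _; rewrite gtr0_norm.
Qed.

Let weight_le (s : R) t : N t `^ (1 - s) <= m `^ (1 - s) + M `^ (1 - s).
Proof.
have [s1|s1] := leP 0 (1 - s).
  rewrite (@le_trans _ _ (M `^ (1 - s)))// ?lerDr ?powR_ge0//.
  by rewrite ge0_ler_powR// nnegrE ltW// (lt_le_trans (N0 t)).
rewrite (@le_trans _ _ (m `^ (1 - s)))// ?lerDl ?powR_ge0//.
rewrite -(opprK (1 - s)) !(powRN _ (- (1 - s))) lef_pV2 ?posrE ?powR_gt0//.
by rewrite ge0_ler_powR// ?nnegrE ?oppr_ge0 ?(ltW s1)// ltW.
Qed.

Let weight_integrable (s B : R) (h : R -> R) : 0 <= s ->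
  measurable_fun D h -> (forall t, D t -> 0 <= h t <= B) ->
  nu.-integrable D (EFin \o (fun t => N t `^ (1 - s) * h t `^ s)).
Proof.
move=> s0 mh hB.
apply: (bounded_integrable _ _ _ ((m `^ (1 - s) + M `^ (1 - s)) * B `^ s)) => //.
  apply: measurable_funM.
    apply: (measurableT_comp (measurable_powR (1 - s))); exact: measurable_funTS.
  exact: (measurableT_comp (measurable_powR s)).
move=> t Dt; have /andP[h0 hBt] := hB t Dt.
rewrite ger0_norm ?mulr_ge0 ?powR_ge0//.
apply: ler_pM; rewrite ?powR_ge0 ?weight_le//.
by rewrite ge0_ler_powR// nnegrE// (le_trans h0).
Qed.

(* Jensen's inequality for the weight [N], through the tangent of [v ^ s] at
   the mean value. *)
Lemma weighted_jensen (s B : R) (h : R -> R) : 1 <= s ->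
  measurable_fun D h -> (forall t, D t -> 0 <= h t <= B) ->
  (\int[nu]_(t in D) h t) `^ s <=
  S `^ (s - 1) * \int[nu]_(t in D) (N t `^ (1 - s) * h t `^ s).
Proof.
move=> s1 mh hB.
have s0 : 0 < s by rewrite (lt_le_trans ltr01).
have hi : nu.-integrable D (EFin \o h).
  apply: (bounded_integrable _ _ _ B) => //.
  by move=> t /hB/andP[h0 hb]; rewrite ger0_norm.
set G := \int[nu]_(t in D) h t.
set J := \int[nu]_(t in D) (N t `^ (1 - s) * h t `^ s).
have G0 : 0 <= G by apply: Rintegral_ge0 => t /hB/andP[].
(* The tangent point for [h / N]. Integrating the tangent inequality against [N] and using [NS]
   gives [s l^s S <= J + (s - 1) l^s S], that is [l^s S <= J]; multiplying by [S^(s - 1)] ends the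
   proof. *)
pose l := G / S; have l0 : 0 <= l by rewrite divr_ge0// ltW.
have GE : G = l * S by rewrite /l divfK// gt_eqF.
have Ji := weight_integrable _ _ _ (ltW s0) mh hB.
have pw t : D t -> s * l `^ (s - 1) * h t <=
    N t `^ (1 - s) * h t `^ s + (s - 1) * l `^ s * N t.
  move=> /hB /andP[h0 _].
  have Nn0 : N t != 0 by rewrite gt_eqF.
  have := young_tangent s (h t / N t) l s1 (divr_ge0 h0 (ltW (N0 t))) l0.
  move=> /(ler_wpM2l (ltW (N0 t))).
  rewrite (_ : N t * (s * _ * _) = s * l `^ (s - 1) * h t); last by field.
  rewrite mulrDr (_ : N t * ((s - 1) * _) = (s - 1) * l `^ s * N t); last by ring.
  rewrite powRM ?invr_ge0 ?(ltW (N0 t))// -(powR_inv1 (ltW (N0 t))) -powRrM mulN1r.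
  rewrite mulrCA; suff -> : N t * N t `^ (- s) = N t `^ (1 - s) by rewrite [h t `^ s * _]mulrC.
  by rewrite powRD ?Nn0 ?implybT// powRr1// ltW.
have : s * l `^ (s - 1) * G <= J + (s - 1) * l `^ s * \int[nu]_(t in D) N t.
  rewrite -!RintegralZl// -RintegralD//; last exact: (integrableZl mD _ N_integrable).
  apply: le_Rintegral => //; first exact: (integrableZl mD _ hi).
  have := integrableD mD Ji (integrableZl mD ((s - 1) * l `^ s) N_integrable).
  by apply: eq_integrable.
move=> /le_trans/(_ (lerD (lexx J) (ler_wpM2l _ NS))).
rewrite mulr_ge0 ?subr_ge0 ?powR_ge0// => /(_ isT).
rewrite GE (_ : s * l `^ (s - 1) * (l * S) = s * (l * l `^ (s - 1)) * S); last by ring.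
rewrite mulr_powRB1// => h1.
have h2 : l `^ s * S <= J by move: h1; lra.
rewrite powRM// ?(ltW S0)//.
rewrite -(mulr_powRB1 (ltW S0) s0) mulrA mulrC ler_wpM2l ?powR_ge0//.
Qed.

Section Means.
Variables (g : R[i] -> R[i]) (r : R).
Hypotheses (ge : forall w, cabs w < 1 -> expandable g w) (r0 : 0 < r) (r1 : r < 1).

Let k (theta t : R) := cabs (g (((clamp t)%:C)%C * circle_point r theta)).

Let kphi1 (theta t : R) : cabs (((clamp t)%:C)%C * circle_point r theta) < 1.
Proof. by apply: cabs_scale_lt1; rewrite ?clamp_ge0 ?clamp_le1// cabs_circle// ltW. Qed.

Let k_measurable t : measurable_fun setT (k ^~ t : measurableTypeR R -> measurableTypeR R).
Proof.
apply: continuous_measurable_fun; apply: continuous_cabs_disc => //.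
- rewrite (_ : (fun x => _) = fun x => (clamp t * r) * cos x).
    by move=> x; apply: cvgMr; exact: continuous_cos.
  by apply/funext => x; rewrite circle_scale.
- rewrite (_ : (fun x => _) = fun x => (clamp t * r) * sin x).
    by move=> x; apply: cvgMr; exact: continuous_sin.
  by apply/funext => x; rewrite circle_scale.
Qed.

Let k_continuous theta : continuous (k theta).
Proof.
apply: continuous_cabs_disc => //.
- rewrite (_ : (fun x => _) = fun x => clamp x * (r * cos theta)).
    by move=> x; apply: cvgMl; exact: continuous_clamp.
  by apply/funext => x; rewrite circle_scale/= mulrA.
- rewrite (_ : (fun x => _) = fun x => clamp x * (r * sin theta)).
    by move=> x; apply: cvgMl; exact: continuous_clamp.
  by apply/funext => x; rewrite circle_scale/= mulrA.
Qed.

Lemma transform_le (z : R[i]) : cabs z < 1 ->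
  cabs (transform nu g z) <= 2 * \int[nu]_(t in D) cabs (g ((t%:C)%C * z)).
Proof.
move=> z1; have [B BP] := radius_bounded g z ge z1.
apply: complex_integral_le => //; last exact: cintegrable_radius.
apply: (bounded_integrable _ _ _ B) => //.
  exact: measurable_cabs_radius.
by move=> t; rewrite /D/= in_itv/= => /BP; rewrite ger0_norm// cabs_ge0.
Qed.

(** By [weighted_jensen] the s-th power of the radial integral is at most [S^(s - 1)] times the
    integral of [N^(1 - s) h^s] in t. Averaging [h^s] over the circle first gives at most [N^s], so
    the integrand becomes [N^(1 - s) N^s = N] and the total is [S^s]. *)
Lemma integral_mean_transform_fin (s : R) : 1 <= s ->
  (forall t, 0 <= t < 1 -> (integral_mean s%:E g (t * r) <= (N t)%:E)%E) ->
  (integral_mean s%:E (transform nu g) r <= (2 * S)%:E)%E.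
Proof.
move=> s1 gN.
have s0 : 0 < s by rewrite (lt_le_trans ltr01).
have sn0 : s != 0 by rewrite gt_eqF.
have pi0 : 0 < 2 * pi :> R by rewrite mulr_gt0// pi_gt0.
pose A : set (measurableTypeR R) := `[0, 2 * pi]%classic.
pose C := 2 `^ s * S `^ (s - 1).
have C0 : 0 <= C by rewrite mulr_ge0// powR_ge0.
pose h theta t := cabs (g ((t%:C)%C * circle_point r theta)).
pose q theta t : R := N t `^ (1 - s) * h theta t `^ s / (2 * pi).
have q0 theta t : 0 <= q theta t.
  by rewrite divr_ge0 ?(ltW pi0)// mulr_ge0// powR_ge0.
have c1 theta : cabs (circle_point r theta) < 1 by rewrite cabs_circle// ltW.
have hk theta t : D t -> h theta t = k theta t.
  by rewrite /D/= in_itv/= => /andP[t0 t1]; rewrite /k clamp_id// ltW.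
(* Extension by zero to the plane, for Tonelli's theorem. The indicator of [D] sits inside the power
   because [measurable_caratheodory] provides that product; it still cuts off since [0 ^ s = 0]. *)
pose F (u : measurableTypeR R * measurableTypeR R) : measurableTypeR R :=
  \1_A u.1 * (N u.2 `^ (1 - s) * (k u.1 u.2 * \1_D u.2) `^ s / (2 * pi)).
have mF : measurable_fun setT F.
  apply: measurable_funM.
    apply: (measurableT_comp _ measurable_fst); apply: measurable_indic.
    exact: measurable_itv.
  apply: measurable_funM => //; apply: measurable_funM.
    apply: (measurableT_comp (measurable_powR (1 - s))).
    exact: (measurableT_comp mN measurable_snd).
  apply: (measurableT_comp (measurable_powR s)).
  exact: measurable_caratheodory.
have F0 u : 0 <= F u.
  by rewrite /F !mulr_ge0// ?powR_ge0 ?invr_ge0 ?(ltW pi0)// indicE.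
have FA theta t : A theta -> F (theta, t) = ((q theta) \_ D) t.
  move=> At; rewrite /F/= [X in X * _]indicE mem_set// mul1r /patch.
  case: ifPn => [/[dup] tD /set_mem Dt|tD].
    by rewrite indicE tD mulr1 /q (hk _ _ Dt).
  by rewrite indicE (negbTE tD) mulr0 powR0// mulr0 mul0r.
have FnA theta t : ~ A theta -> F (theta, t) = 0.
  by move=> At; rewrite /F/= [X in X * _]indicE memNset// mul0r.
have Fint theta : A theta ->
    (\int[nu]_t (F (theta, t))%:E = \int[nu]_(t in D) (q theta t)%:E)%E.
  move=> At; rewrite [RHS]integral_mkcond; apply: eq_integral => t _.
  by rewrite FA// restrict_EFin.
have pointwise theta : A theta ->
    ((cabs (transform nu g (circle_point r theta)) `^ s / (2 * pi))%:E <=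
     C%:E * \int[nu]_t (F (theta, t))%:E)%E.
  move=> At; rewrite Fint//.
  have [B BP] := radius_bounded g _ ge (c1 theta).
  have mh : measurable_fun D (h theta) by exact: measurable_cabs_radius.
  have hB t : D t -> 0 <= h theta t <= B.
    by rewrite /D/= in_itv/= => /BP ->; rewrite cabs_ge0.
  have Ji := weight_integrable _ _ _ (ltW s0) mh hB.
  have -> : (\int[nu]_(t in D) (q theta t)%:E)%E =
      (\int[nu]_(t in D) (q theta t))%:E.
    rewrite /Rintegral fineK// integrable_fin_num//.
    have := integrableZr mD (2 * pi)^-1 Ji; by apply: eq_integrable.
  rewrite -EFinM lee_fin /q RintegralZr// mulrA ler_pM2r ?invr_gt0//.
  apply: (@le_trans _ _ ((2 * \int[nu]_(t in D) h theta t) `^ s)).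
    rewrite ge0_ler_powR ?(ltW s0)// ?nnegrE ?cabs_ge0//.
      by rewrite mulr_ge0// Rintegral_ge0// => t _; exact: cabs_ge0.
    exact: transform_le.
  rewrite powRM//; last by rewrite Rintegral_ge0// => t _; exact: cabs_ge0.
  rewrite /C -mulrA ler_wpM2l ?powR_ge0//.
  exact: weighted_jensen mh hB.
have radial t : D t -> (\int[lebesgue_measure]_theta (F (theta, t))%:E <= (N t)%:E)%E.
  move=> Dt; have t01 : 0 <= t < 1 by move: Dt; rewrite /D/= in_itv.
  have Nt0 := N0 t.
  have FE theta : (F (theta, t))%:E =
      ((N t `^ (1 - s))%:E * ((fun x => (h x t `^ s / (2 * pi))%:E) \_ A) theta)%E.
    rewrite /patch; case: ifPn => [/set_mem At|/negP At].
      by rewrite FA// /patch mem_set// -EFinM /q mulrA.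
    by rewrite FnA ?mule0// => /mem_set.
  under eq_integral do rewrite FE.
  rewrite ge0_integralZl_EFin ?powR_ge0//; last 2 first.
  - by move=> x _; apply: erestrict_ge0 => y _; rewrite lee_fin divr_ge0 ?powR_ge0// ltW.
  - rewrite restrict_EFin; apply/measurable_EFinP.
    apply/(measurable_restrictT _ _).1; first exact: measurable_itv.
    apply: measurable_funM => //; apply: (measurableT_comp (measurable_powR s)).
    apply: (@eq_measurable_fun _ _ _ _ _ (k ^~ t)); first by move=> x _; rewrite hk.
    exact: (measurable_funTS (k_measurable t)).
  rewrite -integral_mkcond.
  pose I := (\int[lebesgue_measure]_(x in A) (h x t `^ s / (2 * pi))%:E)%E.
  have IN : (I `^ s^-1 <= (N t)%:E)%E.
    apply: le_trans (gN t t01); rewrite /integral_mean le_eqVlt; apply/orP; left.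
    by apply/eqP; congr (_ `^ _)%E; apply: eq_integral => x _; rewrite /h circle_scale.
  rewrite -/I.
  have I0 : (0 <= I)%E by apply: integral_ge0 => x _; rewrite lee_fin divr_ge0 ?powR_ge0// ltW.
  have IE : (I <= (N t `^ s)%:E)%E.
    rewrite -poweR_EFin -[leLHS]poweRe1// -(mulVf sn0) poweRrM.
    by apply: gt0_ler_poweR; rewrite ?(ltW s0)// in_itv/= leey andbT ?poweR_ge0// lee_fin ltW.
  apply: (@le_trans _ _ ((N t `^ (1 - s))%:E * (N t `^ s)%:E)%E).
    by rewrite lee_wpmul2l// lee_fin powR_ge0.
  rewrite -EFinM -powRD; last by rewrite (gt_eqF Nt0) implybT.
  by rewrite subrK powRr1// ltW.
have total : (\int[lebesgue_measure]_(theta in A)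
    ((cabs (transform nu g (circle_point r theta)) `^ s / (2 * pi))%:E) <= ((2 * S) `^ s)%:E)%E.
  apply: (@le_trans _ _ (\int[lebesgue_measure]_theta (C%:E * \int[nu]_t (F (theta, t))%:E))%E).
    rewrite integral_mkcond; apply: ge0_le_integral_any => x _.
      by apply: erestrict_ge0 => y _; rewrite lee_fin divr_ge0 ?powR_ge0// ltW.
    rewrite /patch; case: ifPn => [/set_mem /pointwise//|_].
    by rewrite mule_ge0// ?lee_fin// integral_ge0// => y _; rewrite lee_fin F0.
  have mF' : measurable_fun setT (EFin \o F) by exact/measurable_EFinP.
  have F0' u : (0 <= (EFin \o F) u)%E by rewrite /= lee_fin F0.
  rewrite ge0_integralZl_EFin//; last 2 first.
  - by move=> x _; apply: integral_ge0 => y _; rewrite lee_fin F0.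
  - exact: (measurable_fun_fubini_tonelli_F (m2 := nu) (EFin \o F) mF').
  rewrite (fubini_tonelli (m1 := lebesgue_measure) (m2 := nu) (EFin \o F) mF' F0').
  apply: (@le_trans _ _ (C%:E * \int[nu]_(t in D) (N t)%:E)%E).
    rewrite lee_wpmul2l ?lee_fin// [leRHS]integral_mkcond.
    apply: ge0_le_integral_any => t _; first by apply: integral_ge0 => y _; rewrite lee_fin F0.
    rewrite /patch; case: ifPn => [/set_mem /radial//|/negP tD].
    rewrite integral0_eq// => x _; rewrite /F/= [X in (k _ _ * X)]indicE.
    by rewrite memNset ?mulr0 ?powR0// ?mulr0 ?mul0r ?mulr0// => /mem_set.
  have -> : (\int[nu]_(t in D) (N t)%:E)%E = (\int[nu]_(t in D) N t)%:E.
    by rewrite /Rintegral fineK// integrable_fin_num.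
  rewrite -EFinM lee_fin powRM ?(ltW S0)// /C -mulrA ler_wpM2l ?powR_ge0//.
  apply: (@le_trans _ _ (S `^ (s - 1) * S)); first by rewrite ler_wpM2l// powR_ge0.
  by rewrite mulrC mulr_powRB1// ltW.
rewrite /integral_mean.
have -> : (2 * S)%:E = (((2 * S) `^ s)%:E `^ s^-1)%E.
  by rewrite poweR_EFin -powRrM divff// powRr1// mulr_ge0// ltW.
apply: gt0_ler_poweR; rewrite ?invr_ge0 ?(ltW s0)// in_itv/= leey andbT.
  by apply: integral_ge0 => x _; rewrite lee_fin divr_ge0 ?powR_ge0// ltW.
by rewrite lee_fin powR_ge0.
Qed.

Lemma integral_mean_transform (p : \bar R) : (1%:E <= p)%E ->
  (forall t, 0 <= t < 1 -> (integral_mean p g (t * r) <= (N t)%:E)%E) ->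
  (integral_mean p (transform nu g) r <= (2 * S)%:E)%E.
Proof.
case: p => [s||].
- by rewrite lee_fin; exact: integral_mean_transform_fin.
- move=> _ gN; apply: ge_ereal_sup => _ [z /= zr <-]; rewrite lee_fin.
  have z1 : cabs z < 1 by rewrite zr.
  apply: (@le_trans _ _ (2 * \int[nu]_(t in D) N t)); last by rewrite ler_pM2l.
  apply: complex_integral_le => //; first exact: cintegrable_radius.
  move=> t; rewrite /D/= in_itv/= => t01; have /andP[t0 _] := t01.
  rewrite -lee_fin; apply: le_trans (gN t t01); apply: ereal_sup_ubound.
  by exists ((t%:C)%C * z) => //=; rewrite cabsM cabs_real ger0_norm// zr.
- by [].
Qed.

End Means.
End Minkowski.

(** * A test function of fractional growth *)

Section GeometricMean.
Context {R : realType}.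

Lemma cabs_1B_ge (z : R[i]) : 1 - cabs z <= cabs (1 - z).
Proof. by have := cabs_sub_ge 1 z; rewrite cabs1. Qed.

Lemma cabs_1B_circle (r theta : R) :
  cabs (1 - circle_point r theta) ^+ 2 = 1 - 2 * r * cos theta + r ^+ 2.
Proof.
rewrite /cabs/= sqr_sqrtr ?addr_ge0 ?sqr_ge0// sub0r sqrrN.
have := cos2Dsin2 theta => cs.
have -> : 1 - 2 * r * cos theta + r ^+ 2 =
  1 - 2 * r * cos theta + r ^+ 2 * (cos theta ^+ 2 + sin theta ^+ 2) by rewrite cs mulr1.
by ring.
Qed.

(* The Poisson kernel has the smooth primitive [theta - 2 arg (1 - r e^(i theta))]. *)
Lemma poisson_integral (r : R) : 0 <= r < 1 ->
  (\int[lebesgue_measure]_(theta in `[0%R, (2 * pi)%R])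
    ((1 - r ^+ 2) / cabs (1 - circle_point r theta) ^+ 2)%R%:E = (2 * pi)%R%:E)%E.
Proof.
move=> /andP[r0 r1].
have pi0 : 0 < 2 * pi :> R by rewrite mulr_gt0// pi_gt0.
pose d x : R := 1 - 2 * r * cos x + r ^+ 2.
pose f x : R := (1 - r ^+ 2) / d x.
pose F x : R := x + 2 * atan (r * sin x / (1 - r * cos x)).
have rc x : 0 < 1 - r * cos x.
  rewrite subr_gt0; apply: le_lt_trans r1.
  by rewrite -[leRHS]mulr1 ler_wpM2l// cos_le1.
have d0 x : 0 < d x.
  have -> : d x = (1 - r * cos x) ^+ 2 + (r * sin x) ^+ 2.
    by rewrite /d !exprMn sin2cos2; ring.
  by rewrite ltr_wpDr ?sqr_ge0// exprn_gt0.
have dF (x : R) : is_derive x (1 : R) F (f x).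
  have n1 : 1 - r * cos x != 0 by rewrite gt_eqF.
  have nd : d x != 0 by rewrite gt_eqF.
  pose u y := r * sin y / (1 - r * cos y).
  have du : is_derive x 1 u ((r * cos x - r ^+ 2) / (1 - r * cos x) ^+ 2).
    rewrite /u; apply: is_derive_eq.
    rewrite /GRing.scale/=; move: n1 (sin2cos2 x); move: (sin x) (cos x) => S C n1 SC.
    rewrite [LHS](_ : _ = (r * C * (1 - r * C) - r ^+ 2 * S ^+ 2) / (1 - r * C) ^+ 2); last by field.
    by rewrite SC; congr (_ / _); ring.
  have da : is_derive x 1 (fun y => atan (u y))
      ((1 + u x ^+ 2)^-1 * ((r * cos x - r ^+ 2) / (1 - r * cos x) ^+ 2)).
    exact: is_derive1_comp.
  rewrite /F; apply: is_derive_eq.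
  have -> : 1 + u x ^+ 2 = d x / (1 - r * cos x) ^+ 2.
    have -> : d x = (1 - r * cos x) ^+ 2 + (r * sin x) ^+ 2.
      by rewrite /d !exprMn sin2cos2; ring.
    by rewrite /u; field.
  rewrite /GRing.scale/= /f.
  have -> : 1 - r ^+ 2 = d x + 2 * (r * cos x - r ^+ 2) by rewrite /d; ring.
  by field; rewrite nd n1.
have cont_f : continuous f.
  move=> x; apply: cvgM; first exact: cvg_cst.
  apply: cvgV; first by rewrite gt_eqF.
  apply: cvgD; last exact: cvg_cst.
  apply: cvgB; first exact: cvg_cst.
  by apply: cvgMr; exact: continuous_cos.
under eq_integral do rewrite cabs_1B_circle -/(d _) -/(f _).
rewrite (@continuous_FTC2 _ f F 0 (2 * pi)) //.
- rewrite /F (_ : 2 * pi = pi *+ 2); last by rewrite mulr_natl.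
  rewrite sin2pi sin0 !mulr0 !mul0r atan0 mulr0 !addr0 -EFinB subr0//.
- exact: continuous_subspaceT.
- have cF : continuous F.
    move=> x; apply: differentiable_continuous; apply/derivable1_diffP.
    by case: (dF x).
  split => [x _||]; first by case: (dF x).
    by apply: cvg_at_right_filter; exact: cF.
  by apply: cvg_at_left_filter; exact: cF.
- by move=> x _; rewrite derive1E; by case: (dF x).
Qed.

(* [1 / p]; the value [1 / +oo = 0] comes from [fine +oo = 0] and [0^-1 = 0]. *)
Definition inv_exponent (p : \bar R) : R := (fine p)^-1.

Lemma inv_exponent_ge0 (p : \bar R) : (0 <= p)%E -> 0 <= inv_exponent p.
Proof. by move=> p0; rewrite invr_ge0 fine_ge0. Qed.

Lemma inv_exponent_le1 (p : \bar R) : (1%:E <= p)%E -> inv_exponent p <= 1.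
Proof.
case: p => [s||//]; last by move=> _; rewrite /inv_exponent/= invr0 ler01.
by rewrite lee_fin /inv_exponent/= => s1; rewrite invf_le1// (lt_le_trans ltr01).
Qed.

Lemma integral_mean_le_cst (p : \bar R) (f : R[i] -> R[i]) (r B : R) : 0 <= r ->
  (1%:E <= p)%E -> (forall z, cabs z = r -> cabs (f z) <= B) ->
  (integral_mean p f r <= B%:E)%E.
Proof.
move=> r0 p1 fB.
have B0 : 0 <= B by apply: le_trans (fB (circle_point r 0) (cabs_circle _ _ r0)); exact: cabs_ge0.
case: p p1 => [s||//]; last first.
  by move=> _; apply: ge_ereal_sup => _ [z /= zr <-]; rewrite lee_fin fB.
rewrite lee_fin => s1; have s0 : 0 < s by rewrite (lt_le_trans ltr01).
have pi0 : 0 < 2 * pi :> R by rewrite mulr_gt0// pi_gt0.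
rewrite /integral_mean (_ : B%:E = ((B `^ s)%:E `^ s^-1)%E); last first.
  by rewrite poweR_EFin -powRrM divff ?gt_eqF// powRr1.
apply: gt0_ler_poweR; rewrite ?invr_ge0 ?(ltW s0)// ?in_itv/= ?leey ?andbT.
- by apply: integral_ge0 => x _; rewrite lee_fin divr_ge0 ?powR_ge0// ltW.
- by rewrite lee_fin powR_ge0.
apply: (@le_trans _ _ (\int[lebesgue_measure]_(theta in `[0%R, (2 * pi)%R])
   (B `^ s / (2 * pi))%R%:E)%E).
  apply: ge0_le_integral_any => x _; first by rewrite lee_fin divr_ge0 ?powR_ge0// ltW.
  rewrite lee_fin ler_pM2r ?invr_gt0//.
  by rewrite ge0_ler_powR ?(ltW s0)// ?nnegrE ?cabs_ge0// fB// cabs_circle.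
rewrite integral_cst//= lebesgue_measure_itv/= lte_fin pi0 -EFinB subr0 -EFinM.
by rewrite divfK// gt_eqF.
Qed.

(** As [m s >= 2], all but two of the [m s] factors [|1 - z|^-1] may be bounded by [(1 - r)^-1]. The
    remaining [|1 - z|^-2] is a Poisson kernel divided by [1 - r^2 >= 1 - r]. This is where [p >= 2]
    enters. *)
Lemma integral_mean_geometric (p : \bar R) (m : nat) (r : R) :
  (2%:E <= p)%E -> (0 < m)%N -> 0 <= r < 1 ->
  (integral_mean p (fun z => (1 - z) ^- m) r <= ((1 - r) `^ (inv_exponent p - m%:R))%:E)%E.
Proof.
move=> p2 m0 /andP[r0 r1].
have r10 : 0 < 1 - r by rewrite subr_gt0.
have kge z : cabs z = r -> 1 - r <= cabs (1 - z) by move=> <-; exact: cabs_1B_ge.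
case: p p2 => [s||//]; last first.
  move=> _; apply: (integral_mean_le_cst _ _ _ _ r0 (leey _)) => z /kge zr.
  rewrite /inv_exponent/= invr0 sub0r powR_invn ?(ltW r10)// cabsV cabsX.
  rewrite lef_pV2 ?posrE ?exprn_gt0// ?(lt_le_trans r10)//.
  by rewrite lerXn2r// nnegrE ?(ltW r10)// cabs_ge0.
rewrite lee_fin => s2; have s0 : 0 < s by rewrite (lt_le_trans _ s2).
have sn0 : s != 0 by rewrite gt_eqF.
have pi0 : 0 < 2 * pi :> R by rewrite mulr_gt0// pi_gt0.
have ms : 2 <= m%:R * s.
  by rewrite -[leLHS]mul1r; apply: ler_pM => //; rewrite ler1n.
have rr : 0 < 1 - r ^+ 2 by rewrite subr_gt0 expr_lt1.
pose C := (1 - r) `^ (2 - m%:R * s) / (2 * pi) / (1 - r ^+ 2).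
have C0 : 0 <= C by rewrite !divr_ge0 ?powR_ge0// ltW.
rewrite /integral_mean.
have -> : ((1 - r) `^ (inv_exponent s%:E - m%:R))%:E = (((1 - r) `^ (1 - m%:R * s))%:E `^ s^-1)%E.
  by rewrite poweR_EFin -powRrM /inv_exponent/= mulrBl mul1r mulfK.
apply: gt0_ler_poweR; rewrite ?invr_ge0 ?(ltW s0)// ?in_itv/= ?leey ?andbT.
- by apply: integral_ge0 => x _; rewrite lee_fin divr_ge0 ?powR_ge0// ltW.
- by rewrite lee_fin powR_ge0.
apply: (@le_trans _ _ (\int[lebesgue_measure]_(theta in `[0%R, (2 * pi)%R])
    (C%:E * ((1 - r ^+ 2) / cabs (1 - circle_point r theta) ^+ 2)%R%:E))%E).
  apply: ge0_le_integral_any => x _; first by rewrite lee_fin divr_ge0 ?powR_ge0// ltW.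
  rewrite -EFinM lee_fin cabsV cabsX.
  set a := cabs _; have a1 : 1 - r <= a by apply: kge; exact: cabs_circle.
  have a0 : 0 < a by rewrite (lt_le_trans r10).
  have -> : C * ((1 - r ^+ 2) / a ^+ 2) = (1 - r) `^ (2 - m%:R * s) * a ^- 2 / (2 * pi).
    rewrite /C; move: (2 * pi) pi0 => P P0.
    by field; rewrite (gt_eqF rr) (gt_eqF a0) (gt_eqF P0).
  rewrite ler_pM2r ?invr_gt0// -(powR_invn m (ltW a0)) -(powR_invn 2 (ltW a0)) -powRrM.
  have -> : - m%:R * s = (2 - m%:R * s) + - 2%:R by ring.
  rewrite powRD; last by rewrite (gt_eqF a0) implybT.
  rewrite ler_wpM2r ?powR_ge0//.
  rewrite -(opprK (2 - m%:R * s)) !(powRN _ (- (2 - m%:R * s))).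
  rewrite lef_pV2 ?posrE ?powR_gt0//.
  by rewrite ge0_ler_powR// ?nnegrE ?(ltW a0) ?(ltW r10)//; lra.
rewrite ge0_integralZl_EFin//; last 2 first.
- by move=> x _; rewrite lee_fin divr_ge0 ?sqr_ge0// ltW.
- apply/measurable_EFinP; apply: measurable_funM => //.
  apply: measurable_funTS; apply: continuous_measurable_fun => x.
  apply: cvgV; first by rewrite expf_neq0// gt_eqF// (lt_le_trans r10)// kge// cabs_circle.
  under eq_fun do rewrite cabs_1B_circle.
  rewrite cabs_1B_circle.
  apply: cvgD; last exact: cvg_cst.
  apply: cvgB; first exact: cvg_cst.
  by apply: cvgMr; exact: continuous_cos.
rewrite poisson_integral ?r0// -EFinM lee_fin /C.
rewrite [leLHS](_ : _ = (1 - r) `^ (2 - m%:R * s) / (1 - r ^+ 2)); last first.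
  by move: (2 * pi) pi0 => P P0; field; rewrite (gt_eqF rr) (gt_eqF P0).
rewrite (_ : 2 - m%:R * s = (1 - m%:R * s) + 1); last by ring.
rewrite powRD; last by rewrite (gt_eqF r10) implybT.
rewrite powRr1 ?(ltW r10)// -mulrA -[leRHS]mulr1 ler_wpM2l ?powR_ge0//.
rewrite ler_pdivrMr// mul1r; nra.
Qed.

End GeometricMean.

(** * Averages of geometric kernels over a power law *)

Section PowerMeasure.
Context {R : realType}.

Lemma powR_le1 (x a : R) : 0 <= x -> x <= 1 -> 0 <= a -> x `^ a <= 1.
Proof.
move=> x0 x1 a0; have -> : 1 = 1 `^ a by rewrite powR1.
by rewrite ge0_ler_powR// nnegrE.
Qed.

(* Averaging [(1 - t z) ^- m] over the law of [t = 1 - u ^ a], with [u] uniform,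
   replaces the fractional power [(1 - z) `^ (a^-1 - m)] of a complex number. *)
Lemma exists_power_measure (a : R) : 0 < a ->
  exists nu : {finite_measure set (measurableTypeR R) -> \bar R},
  forall f : R -> \bar R,
    measurable_fun (setT : set (measurableTypeR R)) f -> (forall t, 0 <= f t)%E ->
    (\int[nu]_(t in (`[0%R, 1%R[%classic : set (measurableTypeR R))) f t =
     \int[lebesgue_measure]_(u in `]0%R, 1%R]) f (1 - u `^ a)%R)%E.
Proof.
move=> a0.
pose X (u : measurableTypeR R) : measurableTypeR R := 1 - u `^ a.
have mX : measurable_fun setT X.
  by apply: measurable_funB => //; exact: measurable_powR.
pose Xm : {mfun measurableTypeR R >-> measurableTypeR R} := mfun_Sub (mem_set mX).
exists (distribution (uniform_prob (@ltr01 R)) Xm) => f mf f0.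
have mg : measurable_fun (setT : set (measurableTypeR R)) (f \_ `[0%R, 1%R[).
  by apply/(measurable_restrictT _ _).1; [exact: measurable_itv|exact: measurable_funTS].
have g0 t : (0 <= (f \_ `[0%R, 1%R[) t)%E by apply: erestrict_ge0.
rewrite integral_mkcond ge0_integral_distribution// integral_uniform//; last 2 first.
- exact: (measurableT_comp mg).
- by move=> x; exact: g0.
rewrite subr0 invr1 mul1e integral_mkcond [RHS]integral_mkcond.
apply: eq_integral => u _.
have [/andP[u0 u1]|nu01] := boolP (0 < u <= 1).
  have ua : u `^ a <= 1 by rewrite powR_le1// ltW.
  have m1 : u \in (`[0, 1]%classic : set R) by rewrite inE/= in_itv/= (ltW u0).
  have m2 : u \in (`]0, 1]%classic : set R) by rewrite inE/= in_itv/= u0.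
  have m3 : X u \in (`[0, 1[%classic : set R).
    by rewrite inE/= in_itv/= subr_ge0 ua ltrBlDr ltrDl powR_gt0.
  by rewrite /patch m1 m2 /= m3.
rewrite [RHS]/patch [in RHS]memNset/= ?in_itv//=; last exact/negP.
rewrite /patch; case: ifPn => //; rewrite inE/= in_itv/= => /andP[u0 u1].
have -> : u = 0.
  by apply/eqP; rewrite eq_le u0 andbT leNgt; apply: contra nu01 => ->.
by rewrite memNset//= /X powR0 ?gt_eqF// subr0 in_itv/= ltxx andbF.
Qed.

(** With [d = (1 - r)^(1/a)], the base [1 - (1 - u^a) r] is at least [d^a] and at least [u^a], hence
    at least [((d + u) / 2)^a]. The resulting power of [d + u] has exponent [- a b < -1], and its
    integral over [0, 1] is of order [d^(1 - a b)]. *)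
Lemma power_measure_upper (a b : R) : 0 < a -> 1 < a * b -> exists C : R, 0 < C /\
  forall r, 0 <= r < 1 ->
  (\int[lebesgue_measure]_(u in `]0%R, 1%R])
     ((1 - (1 - u `^ a) * r) `^ (- b))%R%:E <= (C * (1 - r) `^ (a^-1 - b))%R%:E)%E.
Proof.
move=> a0 ab; have b0 : 0 < b by rewrite -(pmulr_rgt0 _ a0) (lt_trans ltr01).
pose c := a * b; have c10 : 0 < c - 1 by rewrite subr_gt0.
exists (2 `^ c / (c - 1)); split; first by rewrite divr_gt0// powR_gt0.
move=> r /andP[r0 r1]; have r10 : 0 < 1 - r by rewrite subr_gt0.
pose d := (1 - r) `^ a^-1; have d0 : 0 < d by rewrite powR_gt0.
have da : d `^ a = 1 - r by rewrite /d -powRrM mulVf ?gt_eqF// powRr1// ltW.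
pose f u : R := 2 `^ c * (d + u) `^ (- c).
have f0 u : 0 <= f u by rewrite mulr_ge0// powR_ge0.
apply: (@le_trans _ _ (\int[lebesgue_measure]_(u in `[0%R, 1%R]) (f u)%:E)%E).
  rewrite integral_mkcond [leRHS]integral_mkcond; apply: ge0_le_integral_any => u _.
    by apply: erestrict_ge0 => y _; rewrite lee_fin powR_ge0.
  rewrite /patch; case: ifPn => u01; last by case: ifPn => _//; rewrite lee_fin.
  move: u01; rewrite inE/= in_itv/= => /andP[u0 u1].
  rewrite mem_set/= ?in_itv/= ?(ltW u0)// lee_fin /f.
  have ua0 : 0 <= u `^ a by exact: powR_ge0.
  have ua1 : u `^ a <= 1 by rewrite powR_le1// ltW.
  have w1 : d `^ a <= 1 - (1 - u `^ a) * r by rewrite da; nra.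
  have w2 : u `^ a <= 1 - (1 - u `^ a) * r by nra.
  have w0 : 0 < 1 - (1 - u `^ a) * r by rewrite (lt_le_trans _ w1)// powR_gt0.
  have du0 : 0 < d + u by rewrite addr_gt0.
  have half : ((d + u) / 2) `^ a <= 1 - (1 - u `^ a) * r.
    have [du|ud] := leP d u.
      apply: le_trans w2; rewrite ge0_ler_powR ?(ltW a0)// ?nnegrE ?(ltW u0)//; last by lra.
      by rewrite divr_ge0// ltW.
    apply: le_trans w1; rewrite ge0_ler_powR ?(ltW a0)// ?nnegrE ?(ltW d0)//; last by lra.
    by rewrite divr_ge0// ltW.
  have -> : 2 `^ c * (d + u) `^ (- c) = (((d + u) / 2) `^ a) `^ (- b).
    rewrite -powRrM mulrN -/c powRM ?invr_ge0 ?(ltW du0)// mulrC; congr (_ * _).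
    by rewrite -powR_inv1// -powRrM mulN1r opprK.
  rewrite !powRN lef_pV2 ?posrE ?powR_gt0 ?divr_gt0//.
  by rewrite ge0_ler_powR ?(ltW b0)// ?nnegrE ?powR_ge0// ltW.
pose F u : R := 2 `^ c / (1 - c) * (d + u) `^ (1 - c).
have dF (x : R) : 0 <= x -> is_derive x (1 : R) F (f x).
  move=> x0; have dx : 0 < d + x by rewrite ltr_wpDr.
  have h1 : is_derive x (1 : R) (fun u => (d + u) `^ (1 - c)) ((1 - c) * (d + x) `^ (1 - c - 1)).
    have h2 := is_derive1_powR (1 - c) dx.
    have h3 : is_derive x (1 : R) (fun u : R => d + u) 1.
      by rewrite -[X in is_derive _ _ _ X]add0r; exact: is_deriveD.
    rewrite -[X in is_derive _ _ _ X]mulr1; exact: (is_derive1_comp h2 h3).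
  rewrite /F; apply: is_derive_eq.
  rewrite /GRing.scale/= /f (_ : 1 - c - 1 = - c); last by ring.
  by field; rewrite -oppr_eq0 opprB gt_eqF.
have cf (x : R) : 0 <= x -> {for x, continuous f}.
  move=> x0; have dx : 0 < d + x by rewrite ltr_wpDr.
  apply: cvgM; first exact: cvg_cst.
  have cp : {for (d + x), continuous (fun u : R => u `^ (- c))}.
    apply: differentiable_continuous; apply/derivable1_diffP.
    by apply: derivable_powR; rewrite in_itv/= andbT.
  apply: (cvg_comp (fun u => d + u) (fun u => u `^ (- c))); last exact: cp.
  by apply: cvgD; [exact: cvg_cst|exact: cvg_id].
have cF (x : R) : 0 <= x -> {for x, continuous F}.
  move=> /dF[dFx _]; apply: differentiable_continuous; exact/derivable1_diffP.
rewrite (@continuous_FTC2 _ f F 0 1) //.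
- rewrite -EFinB lee_fin /F addr0.
  rewrite (_ : _ - _ = 2 `^ c / (c - 1) * (d `^ (1 - c) - (d + 1) `^ (1 - c))); last first.
    by field; rewrite gt_eqF//= -oppr_eq0 opprB gt_eqF.
  rewrite ler_pM2l; last by rewrite divr_gt0// powR_gt0.
  rewrite /d -powRrM (_ : a^-1 * (1 - c) = a^-1 - b); last first.
    by rewrite /c; field; rewrite gt_eqF.
  by rewrite lerBlDr lerDl powR_ge0.
- apply: continuous_in_subspaceT => x; rewrite inE/= in_itv/= => /andP[x0 _]; exact: cf.
- split => [x||].
  + by rewrite in_itv/= => /andP[/ltW/dF[]].
  + by apply: cvg_at_right_filter; exact: cF.
  + by apply: cvg_at_left_filter; exact: cF.
- by move=> x; rewrite in_itv/= => /andP[/ltW/dF[_ <-] _]; rewrite derive1E.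
Qed.

(** Only the range [u <= (1 - r)^(1/a)] is kept: there the base is at most [2 (1 - r)]. *)
Lemma power_measure_lower (a : R) (m : nat) : 0 < a -> exists c : R, 0 < c /\
  forall r, 0 <= r < 1 ->
  ((c * (1 - r) `^ (a^-1 - m%:R))%R%:E <=
   \int[lebesgue_measure]_(u in `]0%R, 1%R]) ((1 - (1 - u `^ a) * r) ^- m)%R%:E)%E.
Proof.
move=> a0; exists (2 ^- m); split; first by rewrite invr_gt0 exprn_gt0.
move=> r /andP[r0 r1]; have r10 : 0 < 1 - r by rewrite subr_gt0.
pose d := (1 - r) `^ a^-1; have d0 : 0 < d by rewrite powR_gt0.
have da : d `^ a = 1 - r by rewrite /d -powRrM mulVf ?gt_eqF// powRr1// ltW.
have d1 : d <= 1 by rewrite powR_le1 ?invr_ge0 ?(ltW a0) ?(ltW r10)//; lra.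
apply: (@le_trans _ _ (\int[lebesgue_measure]_(u in `]0%R, d]) ((2 * (1 - r)) ^- m)%:E)%E).
  rewrite integral_cst//= lebesgue_measure_itv/= lte_fin d0 -EFinB subr0 -EFinM lee_fin.
  rewrite powRB; last by rewrite (gt_eqF r10) implybT.
  rewrite -/d powR_mulrn ?(ltW r10)// exprMn invfM -mulrA (mulrC d)//.
rewrite integral_mkcond [leRHS]integral_mkcond; apply: ge0_le_integral_any => u _.
  by apply: erestrict_ge0 => y _; rewrite lee_fin invr_ge0 exprn_ge0// mulr_ge0// ltW.
rewrite /patch; case: ifPn => ud; last first.
  case: ifPn => // u01; move: u01; rewrite inE/= in_itv/= => /andP[u0 u1].
  rewrite lee_fin invr_ge0 exprn_ge0//.
  have ua1 : u `^ a <= 1 by rewrite powR_le1// ltW.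
  by have := powR_ge0 u a; nra.
move: ud; rewrite inE/= in_itv/= => /andP[u0 ud].
rewrite mem_set/= ?in_itv/= ?u0 ?(le_trans ud)// lee_fin.
have ua : u `^ a <= 1 - r by rewrite -da ge0_ler_powR ?nnegrE ?(ltW a0) ?(ltW u0) ?(ltW d0).
have ua0 := powR_ge0 u a.
have w0 : 0 < 1 - (1 - u `^ a) * r by nra.
rewrite lef_pV2 ?posrE ?exprn_gt0 ?mulr_gt0//.
by rewrite lerXn2r// ?nnegrE ?(ltW w0) ?mulr_ge0 ?(ltW r10)//; nra.
Qed.

End PowerMeasure.

(** * Kernels of almost zero argument near the positive radius *)

Section Sector.
Context {R : realType}.

Lemma cabs_expi_sub1 (theta : R) : 0 <= theta ->
  cabs (circle_point 1 theta - 1) <= 2 * theta.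
Proof.
rewrite le_eqVlt => /orP[/eqP<-|t0].
  rewrite mulr0 /circle_point cos0 sin0 mulr1 mulr0.
  by rewrite (_ : Complex 1 0 = 1)// subrr cabs0.
rewrite (le_trans (cabs_le_ReIm _))//= mul1r mul1r subr0 mulrDl mul1r.
have lip (f df : R -> R) : (forall x, is_derive x (1 : R) f (df x)) ->
    (forall x, `|df x| <= 1) -> `|f theta - f 0| <= theta.
  move=> fd d1.
  have [|c _ ->] := @MVT R f df 0 theta t0 (fun x _ => fd x).
    apply: continuous_subspaceT => x; apply: differentiable_continuous.
    by apply/derivable1_diffP; case: (fd x).
  by rewrite subr0 normrM (gtr0_norm t0) -[leRHS]mul1r ler_wpM2r// ltW.
apply: lerD.
- rewrite -cos0; apply: (lip cos (fun x => - sin x)) => x.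
  by rewrite normrN sin_max.
- rewrite -[X in `|X|]subr0 -[X in _ - X]sin0.
  by apply: (lip sin cos) => x; exact: cos_max.
Qed.

Lemma geometric_near1 (m : nat) : exists e : R, 0 < e /\ forall h h',
  cabs h <= e -> cabs h' <= e ->
  2^-1 <= complex.Re ((1 - h) ^- m * (1 - h')^-1).
Proof.
(* With both factors within 1/5 of 1, the product is within 1/25 + 1/5 + 1/5 < 1/2 of 1. *)
have near (k : nat) : exists e : R, 0 < e /\ forall h, cabs h <= e ->
    cabs ((1 - h) ^- k - 1) <= 5^-1.
  have z1 : cabs (0 : R[i]) < 1 by rewrite cabs0.
  have [r [L [r0 L0 hL]]] := expandable_lipschitz _ _ (expandable_geometric k _ z1).
  exists (Num.min r (5^-1 / (L + 1))).
  have L1 : 0 < L + 1 by lra.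
  split; first by rewrite lt_min r0 divr_gt0.
  move=> h; rewrite le_min => /andP[hr hl].
  have := hL h hr; rewrite add0r subr0 expr1n invr1 => /le_trans; apply.
  apply: (@le_trans _ _ (L * (5^-1 / (L + 1)))); first by rewrite ler_wpM2l.
  by rewrite mulrA ler_pdivrMr// mulrC ler_wpM2l//; lra.
have [e1 [e10 h1]] := near m; have [e2 [e20 h2]] := near 1%N.
exists (Num.min e1 e2); split; first by rewrite lt_min e10.
move=> h h'; rewrite !le_min => /andP[/h1 he1 _] /andP[_ /h2].
rewrite expr1.
set x := (1 - h) ^- m in he1 *; set y := (1 - h')^-1 => he2.
have : cabs (x * y - 1) <= 2^-1.
  have -> : x * y - 1 = (x - 1) * (y - 1) + (x - 1) + (y - 1) by ring.
  have h3 := cabsD ((x - 1) * (y - 1) + (x - 1)) (y - 1).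
  have h4 := cabsD ((x - 1) * (y - 1)) (x - 1).
  rewrite cabsM in h4.
  have h5 : cabs (x - 1) * cabs (y - 1) <= 5^-1 * 5^-1.
    by apply: ler_pM => //; exact: cabs_ge0.
  by lra.
move=> /(le_trans (Re_le_cabs _)); rewrite ler_norml => /andP[h3 _].
have : complex.Re (x * y - 1) = complex.Re (x * y) - 1 by case: (x * y).
by lra.
Qed.

(** For [0 <= x <= r], [1 - x e^(i theta) = (1 - x) (1 - h)] with
    [h = x (e^(i theta) - 1) / (1 - x)], and [|h| <= 2 theta / (1 - r) <= 2 e] is small. Taking
    [x = t s r] and [x = s r] reduces the claim to [geometric_near1]. *)
Lemma geometric_sector (m : nat) : exists e : R, [/\ 0 < e, e <= 1 &
  forall t s r theta, 0 <= t <= 1 -> 0 <= s <= 1 -> 0 < r < 1 ->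
    0 <= theta -> theta <= e * (1 - r) ->
  2^-1 * ((1 - t * s * r) ^- m / (1 - s * r)) <=
  complex.Re ((1 - (t%:C)%C * ((s%:C)%C * circle_point r theta)) ^- m /
     (1 - (s%:C)%C * circle_point r theta))].
Proof.
have [d [d0 hd]] := geometric_near1 m.
pose e := Num.min 1 (d / 2); have e0 : 0 < e by rewrite lt_min ltr01 divr_gt0.
exists e; split => //; first by rewrite ge_min lexx.
move=> t s r th /andP[t0 t1] /andP[s0 s1] /andP[r0 r1] th0 the.
have r10 : 0 < 1 - r by rewrite subr_gt0.
have dec (x : R) : 0 <= x -> x <= r -> exists2 h : R[i], cabs h <= d &
    1 - circle_point x th = ((1 - x)%:C)%C * (1 - h).
  move=> x0 xr; have x1 : 0 < 1 - x by lra.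
  have xn0 : ((1 - x)%:C)%C != 0 by rewrite -cabs_eq0 cabs_real normr_eq0 gt_eqF.
  exists ((x%:C)%C * (circle_point 1 th - 1) / ((1 - x)%:C)%C).
    rewrite cabs_div cabsM !cabs_real (ger0_norm x0) (gtr0_norm x1) ler_pdivrMr//.
    apply: (@le_trans _ _ (1 * (2 * th))).
      by apply: ler_pM; rewrite ?cabs_ge0 ?cabs_expi_sub1//; lra.
    have : e <= d / 2 by rewrite ge_min lexx orbT.
    by nra.
  rewrite mulrBr mulr1 mulrC divfK// -(mulr1 x) -circle_scale mulr1 rmorphB/= rmorph1; ring.
have tsr : 0 <= t * s * r by rewrite !mulr_ge0// ltW.
have sr : 0 <= s * r by rewrite mulr_ge0// ltW.
have sr1 : s * r <= r by nra.
have tsr1 : t * s * r <= r by nra.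
have [h hh he] := dec _ tsr tsr1; have [h' hh' he'] := dec _ sr sr1.
rewrite !circle_scale (mulrA t) he he'.
rewrite exprMn invfM invfM [X in complex.Re X](_ : _ =
   (((1 - t * s * r) ^- m / (1 - s * r))%:C)%C * ((1 - h) ^- m * (1 - h')^-1)); last first.
  rewrite rmorphM/= !fmorphV/= rmorphXn/= !rmorphB/= !rmorph1.
  by move: (_ ^- m) ((1 - h) ^- m) => A B; move: (_^-1) ((1 - h')^-1) => C D; ring.
have ReE (x : R) (z : R[i]) : complex.Re ((x%:C)%C * z) = x * complex.Re z.
  by case: z => a b /=; rewrite mul0r subr0.
rewrite ReE mulrC ler_wpM2l//; last exact: hd.
rewrite divr_ge0 ?invr_ge0 ?exprn_ge0//; lra.
Qed.

End Sector.

Section TestFunction.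
Context {R : realType}.

(** Brings the factor [(1 - w)^-1] under the integral that defines the test function, where
    [geometric_sector] applies pointwise. *)
Lemma Re_complex_integralM (nu : {finite_measure set (measurableTypeR R) -> \bar R})
    (D : set (measurableTypeR R)) (g : R -> R[i]) (k : R[i]) : measurable D ->
  cintegrable nu D g ->
  nu.-integrable D (EFin \o (fun t => complex.Re (g t * k))) /\
  complex.Re (complex_integral nu D g * k) = \int[nu]_(t in D) complex.Re (g t * k).
Proof.
move=> mD [gr gi]; case: k => a b.
have ReE z : complex.Re (z * Complex a b) = complex.Re z * a - complex.Im z * b.
  by case: z.
have i1 := integrableZr mD a gr; have i2 := integrableZr mD b gi.
split; first by apply: eq_integrable (integrableB mD i1 i2) => // t _ /=; rewrite ReE.
under [RHS]eq_Rintegral do rewrite ReE.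
by rewrite ReE/= -!RintegralZr// RintegralB.
Qed.

(** The lower bound concerns the integrand of [cesaro_op mu f]: the extra 1 in its exponent is due
    to the division by [1 - w]. Bounding the real part, not the modulus, excludes cancellation once
    this is integrated in s. *)
Lemma test_function (gamma : R) (p : \bar R) : 0 < gamma -> (2%:E <= p)%E ->
  exists (f : R[i] -> R[i]) (c e : R), [/\ 0 < c, 0 < e, e <= 1,
    mixed_norm_space p +oo%E gamma f &
    forall s r theta, 0 <= s < 1 -> 0 < r < 1 -> 0 <= theta -> theta <= e * (1 - r) ->
      c * (1 - s * r) `^ (- (gamma + inv_exponent p + 1)) <=
      complex.Re (f ((s%:C)%C * circle_point r theta) /
        (1 - (s%:C)%C * circle_point r theta))].
Proof.
move=> g0 p2.
have p1 : (1%:E <= p)%E by rewrite (le_trans _ p2)// lee_fin ler1n.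
have p0 : (0 <= p)%E by rewrite (le_trans _ p1)// lee_fin.
pose P := inv_exponent p; have P0 : 0 <= P by exact: inv_exponent_ge0.
have P1 : P <= 1 by exact: inv_exponent_le1.
pose alpha := gamma + P.
(* An integer above the wanted growth exponent [alpha]; averaging lowers the exponent from m to
   [alpha]. *)
pose m := (Num.truncn alpha).+1.
have am : alpha < m%:R.
  by have /andP[] : (Num.truncn alpha)%:R <= alpha < m%:R by apply: truncn_itv; rewrite addr_ge0// ltW.
(* Chosen so that [a^-1 - m = - alpha] in [power_measure_lower]. With [b = m - P], the exponent from
   [integral_mean_geometric], also [a^-1 - b = - gamma] in [power_measure_upper], and [1 < a b]
   amounts to [gamma > 0]. *)
pose a := (m%:R - alpha)^-1; have a0 : 0 < a by rewrite invr_gt0 subr_gt0.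
have aV : a^-1 = m%:R - alpha by rewrite invrK.
pose b := m%:R - P.
have ab : 1 < a * b.
  by rewrite /a mulrC ltr_pdivlMr ?subr_gt0// mul1r /b /alpha; lra.
have [nu nuP] := exists_power_measure _ a0.
have [C [C0 CP]] := power_measure_upper _ _ a0 ab.
have [c [c0 cP]] := power_measure_lower a m a0.
have [e [e0 e1 eP]] := @geometric_sector R m.
pose phi (z : R[i]) := (1 - z) ^- m.
have phiE w : cabs w < 1 -> expandable phi w by exact: expandable_geometric.
have mD : measurable (`[0%R, 1%R[%classic : set (measurableTypeR R)) by exact: measurable_itv.
have wcont (r : R) (x : R) : 0 <= r < 1 -> measurable_fun (setT : set (measurableTypeR R))
    (fun t => (1 - clamp t * r) `^ x).
  move=> _; apply: (measurableT_comp (measurable_powR x)).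
  apply: continuous_measurable_fun => t; apply: cvgB; first exact: cvg_cst.
  by apply: cvgMl; exact: continuous_clamp.
have wpos (r t : R) : 0 <= r < 1 -> 1 - r <= 1 - clamp t * r <= 1.
  move=> /andP[r0 r1]; have := clamp_ge0 t; have := clamp_le1 t => h1 h2.
  by apply/andP; split; nra.
exists (transform nu phi), (2^-1 * c), e; split => //.
- by rewrite mulr_gt0.
- split; first by apply: expandable_analytic; exact: transform_expandable.
  rewrite /mixed_norm; apply: (@le_lt_trans _ _ (2 * C)%:E); last by rewrite ltry.
  apply: ge_ereal_sup => _ [r /= rI <-]; move: rI; rewrite in_itv/= => /andP[r0 r1].
  have r01 : 0 <= r < 1 by rewrite (ltW r0).
  have r10 : 0 < 1 - r by rewrite subr_gt0.
  pose N t := (1 - clamp t * r) `^ (- b).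
  have wp t : 0 < 1 - clamp t * r by have /andP[h _] := wpos r t r01; rewrite (lt_le_trans r10).
  have b0 : 0 <= b by rewrite /b subr_ge0 (le_trans P1)// ler1n.
  have N1 t : 1 <= N t.
    rewrite /N powRN -[leLHS]invr1 lef_pV2 ?posrE ?powR_gt0//.
    have /andP[_ h] := wpos r t r01; by apply: powR_le1 => //; exact: ltW.
  have NM t : N t <= (1 - r) `^ (- b).
    rewrite /N !powRN lef_pV2 ?posrE ?powR_gt0//.
    by rewrite ge0_ler_powR// ?nnegrE ?(ltW r10) ?(ltW (wp t))//; have /andP[] := wpos r t r01.
  have S0 : 0 < C * (1 - r) `^ (- gamma) by rewrite mulr_gt0// powR_gt0.
  have NS : \int[nu]_(t in `[0%R, 1%R[) N t <= C * (1 - r) `^ (- gamma).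
    have mEN : measurable_fun (setT : set (measurableTypeR R)) (fun t => (N t)%:E).
      by apply/measurable_EFinP; exact: wcont.
    have bnd : (\int[nu]_(t in `[0%R, 1%R[) (N t)%:E <= (C * (1 - r) `^ (- gamma))%:E)%E.
      rewrite nuP//; last by move=> t; rewrite lee_fin (le_trans ler01).
      rewrite (_ : - gamma = a^-1 - b); last by rewrite aV /b /alpha; ring.
      apply: le_trans (CP r r01); rewrite le_eqVlt; apply/orP; left; apply/eqP.
      apply: eq_integral => u; rewrite inE/= in_itv/= => /andP[u0 u1]; rewrite /N clamp_id//.
        by rewrite subr_ge0 powR_le1// ltW.
      by rewrite lerBlDr lerDl powR_ge0.
    rewrite /Rintegral -lee_fin fineK// ge0_fin_numE.
      by rewrite (le_lt_trans bnd)// ltry.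
    by apply: integral_ge0 => t _; rewrite lee_fin (le_trans ler01).
  have gN t : 0 <= t < 1 -> (integral_mean p phi (t * r) <= (N t)%:E)%E.
    move=> /andP[t0 t1]; have := @integral_mean_geometric R p m (t * r) p2 isT.
    rewrite mulr_ge0 ?(ltW r0)//= (_ : t * r < 1)/=; last by nra.
    by move=> /(_ isT); rewrite /N clamp_id// ?(ltW t1)// /b opprB.
  have := integral_mean_transform nu N 1 _ _ (wcont _ _ r01) ltr01 N1 NM S0 NS _ _ phiE r0 r1 _ p1 gN.
  have rg0 : (0 <= ((1 - r) `^ gamma)%:E)%E by rewrite lee_fin powR_ge0.
  move=> /(lee_wpmul2l rg0) => h; apply: (le_trans h).
  rewrite -EFinM lee_fin powRN mulrCA [X in _ * X]mulrCA divff ?mulr1//.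
  by rewrite gt_eqF// powR_gt0.
move=> s r th s01 r01 th0 the.
have /andP[s0 s1] := s01; have /andP[r0 r1] := r01.
pose w := (s%:C)%C * circle_point r th.
have w1 : cabs w < 1 by apply: cabs_scale_lt1 => //; rewrite ?(ltW s1)// cabs_circle// ltW.
rewrite -/w.
have [ii ->] := Re_complex_integralM nu _ _ (1 - w)^-1 mD (cintegrable_radius nu _ _ phiE w1).
have sr0 : 0 <= s * r by rewrite mulr_ge0// ltW.
have sr1 : s * r < 1 by nra.
have sr01 : 0 <= s * r < 1 by rewrite sr0.
pose N t := (1 - clamp t * (s * r)) ^- m.
have wp t : 0 < 1 - clamp t * (s * r).
  by have /andP[h _] := wpos _ t sr01; rewrite (lt_le_trans _ h)// subr_gt0.
have NE : N = fun t => (1 - clamp t * (s * r)) `^ (- m%:R).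
  by apply/funext => t; rewrite powR_invn// ltW.
have mN : measurable_fun (setT : set (measurableTypeR R)) N by rewrite NE; exact: wcont.
have Ni : nu.-integrable (`[0%R, 1%R[%classic : set (measurableTypeR R)) (EFin \o N).
  apply: (bounded_integrable _ _ _ ((1 - s * r) ^- m)) => //; first exact: measurable_funTS.
  move=> t _; rewrite ger0_norm ?invr_ge0 ?exprn_ge0 ?(ltW (wp t))//.
  rewrite lef_pV2 ?posrE ?exprn_gt0// ?subr_gt0//.
  have /andP[h _] := wpos _ t sr01.
  by rewrite lerXn2r// nnegrE ltW// subr_gt0.
have low : c * (1 - s * r) `^ (- alpha) <= \int[nu]_(t in `[0%R, 1%R[) N t.
  rewrite /Rintegral -lee_fin fineK; last exact: integrable_fin_num.
  rewrite nuP; last 2 first.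
  - by apply/measurable_EFinP.
  - by move=> t; rewrite lee_fin invr_ge0 exprn_ge0// ltW.
  rewrite (_ : - alpha = a^-1 - m%:R); last by rewrite aV; ring.
  apply: (le_trans (cP _ sr01)); rewrite le_eqVlt; apply/orP; left; apply/eqP.
  apply: eq_integral => u; rewrite inE/= in_itv/= => /andP[u0 u1]; rewrite /N clamp_id//.
    by rewrite subr_ge0 powR_le1// ltW.
  by rewrite lerBlDr lerDl powR_ge0.
apply: (@le_trans _ _ (\int[nu]_(t in `[0%R, 1%R[) (2^-1 * (1 - s * r)^-1 * N t))).
  have srp : 0 < 1 - s * r by rewrite subr_gt0.
  rewrite RintegralZl// -/alpha opprD powRD; last by rewrite (gt_eqF srp) implybT.
  rewrite powR_inv1; last by rewrite subr_ge0 ltW.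
  rewrite [leLHS](_ : _ = 2^-1 * (1 - s * r)^-1 * (c * (1 - s * r) `^ (- alpha))); last by ring.
  by rewrite ler_wpM2l// mulr_ge0// invr_ge0 subr_ge0 ltW.
apply: le_Rintegral => //; first exact: (integrableZl mD _ Ni).
move=> t; rewrite /= in_itv/= => /andP[t0 t1].
have := eP t s r th; rewrite t0 (ltW t1) s0 (ltW s1) => /(_ isT isT r01 th0 the).
apply: le_trans; rewrite /N clamp_id ?(ltW t1)// (mulrA t s).
by rewrite -mulrA ler_pM2l// mulrC.
Qed.

End TestFunction.

(** * Dyadic sums *)

Section Sequences.
Context {R : realType}.
Implicit Types (x y e q : R).

Lemma powR_comparable x y e : 0 < x -> 0 < y -> x <= 2 * y -> y <= 2 * x ->
  x `^ e <= 2 `^ `|e| * y `^ e.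
Proof.
move=> x0 y0 xy yx; have [e0|e0] := leP 0 e.
  by rewrite ger0_norm// -powRM// ?(ltW y0)// ge0_ler_powR// ?nnegrE ?mulr_ge0// ltW.
rewrite ltr0_norm// -(opprK e) !(powRN _ (- e)) opprK.
rewrite ler_pdivlMr ?powR_gt0// mulrC ler_pdivrMr ?powR_gt0// -powRM// ?(ltW x0)//.
by rewrite ge0_ler_powR// ?nnegrE ?mulr_ge0 ?oppr_ge0// ltW.
Qed.

(** Handles [q < 1] and [q >= 1] alike: if [y <= d x], then y is absorbed by raising l to
    [l + d < 1]; otherwise x is less than [y / d]. *)
Lemma powR_affine (l q : R) : 0 <= l -> l < 1 -> 0 < q -> exists l' C : R,
  [/\ 0 <= l', l' < 1, 0 <= C & forall x y, 0 <= x -> 0 <= y ->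
    (l * x + y) `^ q <= l' * x `^ q + C * y `^ q].
Proof.
move=> l0 l1 q0; pose d := (1 - l) / 2; have d0 : 0 < d by rewrite divr_gt0// subr_gt0.
have ld0 : 0 <= l + d by rewrite addr_ge0// ltW.
have ld1 : l + d < 1 by rewrite /d; lra.
exists ((l + d) `^ q), ((l / d + 1) `^ q); split; rewrite ?powR_ge0//.
  have -> : 1 = 1 `^ q by rewrite powR1.
  by rewrite gt0_ltr_powR// nnegrE.
move=> x y x0 y0; have l0d : 0 <= l / d + 1 by rewrite addr_ge0// divr_ge0// ltW.
have lxy : 0 <= l * x + y by rewrite addr_ge0// mulr_ge0.
have [yx|xy] := leP y (d * x).
  apply: (@le_trans _ _ ((l + d) `^ q * x `^ q)).
    rewrite -powRM// ge0_ler_powR ?(ltW q0) ?nnegrE ?mulr_ge0//; lra.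
  by rewrite lerDl mulr_ge0 ?powR_ge0.
apply: (@le_trans _ _ ((l / d + 1) `^ q * y `^ q)).
  rewrite -powRM// ge0_ler_powR ?(ltW q0) ?nnegrE ?mulr_ge0//.
  rewrite mulrDl mul1r lerD2r mulrAC ler_pdivlMr// -mulrA ler_wpM2l//.
  by rewrite mulrC ltW.
by rewrite lerDr mulr_ge0 ?powR_ge0.
Qed.

(** Summing [powR_affine] along the recursion bounds a partial sum of [b^q] by [l' < 1] times the
    previous one plus a constant; the former is absorbed on the left. *)
Lemma geometric_recursion_summable (l q : R) (a b : nat -> R) (B : R) :
  0 <= l -> l < 1 -> 0 < q -> (forall k, 0 <= a k) -> 0 <= b 0%N ->
  (forall k, b k.+1 = l * b k + a k.+1) ->
  (forall J, \sum_(k < J) a k `^ q <= B) ->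
  exists B', forall J, \sum_(k < J) b k `^ q <= B'.
Proof.
move=> l0 l1 q0 a0 b0 bS aB.
have bk k : 0 <= b k.
  by elim: k => // k IH; rewrite bS addr_ge0// mulr_ge0.
have [l' [C [l'0 l'1 C0 lC]]] := powR_affine _ _ l0 l1 q0.
exists ((b 0%N `^ q + C * B) / (1 - l')) => J.
have step J' : \sum_(k < J'.+1) b k `^ q <=
    b 0%N `^ q + l' * \sum_(k < J') b k `^ q + C * \sum_(k < J'.+1) a k `^ q.
  elim: J' => [|J' IH].
    by rewrite !big_ord_recl !big_ord0 !mulr0 !addr0 lerDl mulr_ge0 ?powR_ge0.
  rewrite big_ord_recr [X in _ <= _ + l' * X + _]big_ord_recr.
  rewrite [X in _ <= _ + C * X]big_ord_recr/= !mulrDr.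
  have := lC (b J') (a J'.+1) (bk _) (a0 _); rewrite -bS.
  by move: IH; lra.
have aB' J' : C * \sum_(k < J') a k `^ q <= C * B by rewrite ler_wpM2l.
case: J => [|J].
  rewrite big_ord0 divr_ge0//; last by rewrite subr_ge0 ltW.
  rewrite addr_ge0 ?powR_ge0//.
  by have := aB' 0%N; rewrite big_ord0 mulr0.
rewrite ler_pdivlMr ?subr_gt0// mulrBr mulr1.
have mono : \sum_(k < J) b k `^ q <= \sum_(k < J.+1) b k `^ q.
  by rewrite big_ord_recr/= lerDl powR_ge0.
have := ler_wpM2l l'0 mono; have := step J; have := aB' J.+1; lra.
Qed.

Lemma nneseries_lty_bounded (y : nat -> R) : (forall n, 0 <= y n) ->
  (\sum_(0 <= n <oo) (y n)%:E < +oo)%E <-> exists B, forall N, \sum_(n < N) y n <= B.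
Proof.
move=> y0; have y0' n : xpredT n -> (0 <= (y n)%:E)%E by rewrite lee_fin.
have S0 : (0 <= \sum_(0 <= n <oo) (y n)%:E)%E by apply: nneseries_ge0 => n _ _; rewrite lee_fin.
split=> [yoo|[B yB]].
- exists (fine (\sum_(0 <= n <oo) (y n)%:E)%E) => N.
  rewrite -lee_fin fineK ?ge0_fin_numE// -sumEFin -(big_mkord xpredT (fun n => (y n)%:E)).
  by apply: nneseries_lim_ge => n _ _; rewrite lee_fin.
- apply: (@le_lt_trans _ _ B%:E); last by rewrite ltry.
  apply: lime_le; first by apply: is_cvg_nneseries => n _ _; rewrite lee_fin.
  by near=> N; rewrite big_mkord sumEFin lee_fin.
Unshelve. all: by end_near. Qed.

(** The q-th powers are [x_n^q (n+1)^(q-1)]. On a block [2^k <= n < 2^(k+1)] the second factor is of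
    order [2^(k(q-1))], up to [D] whatever the sign of [q - 1], and there are [2^k] terms. *)
Lemma ell_condensation (x : nat -> R) (q : R) : 0 < q -> (forall n, 0 <= x n) ->
  (forall m n, (m <= n)%N -> x n <= x m) ->
  ell q (fun n => x n * n.+1%:R `^ (1 - q^-1)) <->
  exists B, forall J, \sum_(k < J) (2 ^+ k * x (2 ^ k)%N) `^ q <= B.
Proof.
move=> q0 x0 xd.
pose y n := x n `^ q * n.+1%:R `^ (q - 1).
have yE n : `|x n * n.+1%:R `^ (1 - q^-1)| `^ q = y n.
  rewrite ger0_norm ?mulr_ge0 ?powR_ge0// powRM ?powR_ge0// -powRrM mulrBl mul1r.
  by rewrite mulVf ?gt_eqF.
have y0 n : 0 <= y n by rewrite mulr_ge0 ?powR_ge0.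
have -> : ell q (fun n => x n * n.+1%:R `^ (1 - q^-1)) <->
    exists B, forall N, \sum_(n < N) y n <= B.
  rewrite -nneseries_lty_bounded// /ell/=.
  by under eq_eseriesr do rewrite yE.
pose A k := (2 ^+ k * x (2 ^ k)%N) `^ q.
have A0 k : 0 <= A k by exact: powR_ge0.
pose D : R := 2 `^ `|q - 1|; have D0 : 0 < D by rewrite powR_gt0.
have P0 k : 0 < 2 ^+ k :> R by rewrite exprn_gt0.
have nat2 k : (2 ^ k)%N%:R = 2 ^+ k :> R by rewrite natrX.
have comp k n : (2 ^ k <= n < 2 ^ k.+1)%N ->
    n.+1%:R `^ (q - 1) <= D * (2 ^+ k) `^ (q - 1) /\
    (2 ^+ k) `^ (q - 1) <= D * n.+1%:R `^ (q - 1).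
  move=> /andP[h1 h2].
  have h3 : 2 ^+ k <= n.+1%:R :> R by rewrite -nat2 ler_nat ltnW.
  have h4 : n.+1%:R <= 2 * 2 ^+ k :> R by rewrite -exprS -nat2 ler_nat.
  have n0 : 0 < n.+1%:R :> R by rewrite ltr0n.
  by split; apply: powR_comparable => //; have := P0 k; lra.
have AE k (z : R) : 0 <= z -> 2 ^+ k * (z `^ q * (2 ^+ k) `^ (q - 1)) = (2 ^+ k * z) `^ q.
  move=> z0; rewrite powRM ?(ltW (P0 k))// mulrCA mulr_powRB1 ?(ltW (P0 k))//.
  by rewrite mulrC.
have split2 k : \sum_(n < 2 ^ k.+1) y n = \sum_(n < 2 ^ k) y n + \sum_(2 ^ k <= n < 2 ^ k.+1) y n.
  by rewrite -!(big_mkord xpredT) -big_cat_nat//= leq_pexp2l.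
have size2 k : (2 ^ k.+1 - 2 ^ k)%N = (2 ^ k)%N by rewrite expnS mul2n -addnn addnK.
have up k : \sum_(2 ^ k <= n < 2 ^ k.+1) y n <= D * A k.
  apply: (@le_trans _ _ (\sum_(2 ^ k <= n < 2 ^ k.+1) (D * (x (2 ^ k)%N `^ q * (2 ^+ k) `^ (q - 1))))).
    apply: ler_sum_nat => n nk; rewrite mulrCA; apply: ler_pM; rewrite ?powR_ge0//.
      have /andP[h _] := nk.
      by rewrite ge0_ler_powR ?(ltW q0) ?nnegrE// xd.
    by have [] := comp _ _ nk.
  by rewrite sumr_const_nat size2 -[X in X <= _]mulr_natl nat2 mulrCA AE.
(* By monotonicity the k-th block controls the next condensed term, at the price [2^q]; the term
   [A 0 = x_1^q] is counted separately below. *)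
have low k : A k.+1 <= 2 `^ q * D * \sum_(2 ^ k <= n < 2 ^ k.+1) y n.
  have h : \sum_(2 ^ k <= n < 2 ^ k.+1) (x (2 ^ k.+1)%N `^ q * (2 ^+ k) `^ (q - 1)) <=
      D * \sum_(2 ^ k <= n < 2 ^ k.+1) y n.
    rewrite mulr_sumr; apply: ler_sum_nat => n nk; rewrite [leRHS]mulrCA.
    apply: ler_pM; rewrite ?powR_ge0//.
      have /andP[_ h] := nk.
      by rewrite ge0_ler_powR ?(ltW q0) ?nnegrE// xd// ltnW.
    by have [] := comp _ _ nk.
  rewrite sumr_const_nat size2 -[X in X <= _]mulr_natl nat2 AE// in h.
  rewrite /A exprS -mulrA powRM// ?mulr_ge0 ?(ltW (P0 k))//.
  by rewrite -mulrA ler_wpM2l ?powR_ge0.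
have big1 : \sum_(n < 2 ^ 0) y n = y 0%N by rewrite big_ord_recl big_ord0 addr0.
split=> [[B yB]|[B AB]].
- exists (x 1%N `^ q + 2 `^ q * D * B) => J.
  have key : \sum_(k < J.+1) A k <= x 1%N `^ q + 2 `^ q * D * \sum_(n < 2 ^ J) y n.
    elim: J => [|J IH].
      rewrite big_ord_recl big_ord0 addr0 /A expr0 mul1r lerDl.
      by rewrite !mulr_ge0 ?powR_ge0// sumr_ge0.
    rewrite big_ord_recr/= split2 mulrDr addrA lerD//; exact: low.
  apply: (@le_trans _ _ (\sum_(k < J.+1) A k)).
    by rewrite big_ord_recr/= lerDl.
  apply: (le_trans key); rewrite lerD2l ler_wpM2l ?yB//.
  by rewrite mulr_ge0 ?powR_ge0.
- exists (y 0%N + D * B) => N.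
  have key J : \sum_(n < 2 ^ J) y n <= y 0%N + D * \sum_(k < J) A k.
    elim: J => [|J IH]; first by rewrite big1 big_ord0 mulr0 addr0.
    by rewrite split2 big_ord_recr/= mulrDr addrA lerD.
  apply: (@le_trans _ _ (\sum_(n < 2 ^ N) y n)).
    rewrite -!(big_mkord xpredT) (@big_cat_nat _ _ _ N 0 (2 ^ N))//=; last exact/ltnW/ltn_expl.
    by rewrite lerDl sumr_ge0.
  by apply: (le_trans (key N)); rewrite lerD2l ler_wpM2l ?(ltW D0)// AB.
Qed.

End Sequences.

(** * Dyadic decomposition of the radial integral *)

Section Dyadic.
Context {R : realType}.

(** Closed on the right, so that these intervals tile (0, 1) exactly, starting with []0, 1/2]] for
    [j = 0]. *)
Definition dyadic (j : nat) : set (measurableTypeR R) :=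
  `]1 - 2 ^- j, 1 - 2 ^- j.+1]%classic.

Lemma measurable_dyadic j : measurable (dyadic j).
Proof. exact: measurable_itv. Qed.

Let e2_gt0 j : 0 < 2 ^- j :> R. Proof. by rewrite invr_gt0 exprn_gt0. Qed.

Let e2S j : 2 ^- j = 2 * 2 ^- j.+1 :> R.
Proof. by rewrite exprS invfM mulrA divff ?mul1r. Qed.

Lemma dyadicP j r : dyadic j r -> 2 ^- j.+1 <= 1 - r < 2 ^- j.
Proof. by rewrite /dyadic/= in_itv/= => /andP[? ?]; apply/andP; split; lra. Qed.

Lemma dyadic01 j r : dyadic j r -> 0 < r < 1.
Proof.
move=> /dyadicP/andP[h1 h2]; have := e2_gt0 j.+1.
have : 2 ^- j <= 1 :> R by rewrite invf_le1 ?exprn_gt0// exprn_ege1// ler1n.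
by move=> *; apply/andP; split; lra.
Qed.

Lemma dyadic_cover r : 0 < r < 1 -> exists j, dyadic j r.
Proof.
move=> /andP[r0 r1]; have r10 : 0 < 1 - r by rewrite subr_gt0.
have ex : exists j, 2 ^- j.+1 <= 1 - r.
  have := @cvg_geometric2 R 1; move=> /cvgrPdist_le/(_ _ r10)[n _ /(_ n.+1 (leqnSn n))].
  rewrite sub0r normrN mul1r ger0_norm ?(ltW (e2_gt0 _))// => h.
  by exists n.
case: (ex_minnP ex) => j jr jmin; exists j; rewrite /dyadic/= in_itv/=.
apply/andP; split; last by lra.
suff : 1 - r < 2 ^- j by lra.
case: j jr jmin => [_ _|j jr jmin]; first by rewrite expr0 invr1; lra.
by rewrite ltNge; apply/negP => /jmin; rewrite ltnn.
Qed.

Lemma dyadic_inj j k r : dyadic j r -> dyadic k r -> j = k.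
Proof.
have half i i' : dyadic i r -> dyadic i' r -> (i <= i')%N.
  move=> /dyadicP/andP[_ h1] /dyadicP/andP[h2 _].
  have := le_lt_trans h2 h1; rewrite ltf_pV2 ?posrE ?exprn_gt0//.
  by rewrite ltr_eXn2l ?ltr1n.
by move=> jr kr; apply/eqP; rewrite eqn_leq (half _ _ jr kr) (half _ _ kr jr).
Qed.

Lemma lebesgue_dyadic j : (lebesgue_measure (dyadic j) = (2 ^- j.+1)%:E)%E.
Proof.
rewrite /dyadic lebesgue_measure_itv/= lte_fin ifT; last first.
  by have := e2_gt0 j.+1; have := e2S j; lra.
by rewrite -EFinB; congr EFin; have := e2S j; lra.
Qed.

(** Comparison with a series of multiples of indicators, integrated term by term: the radial
    dependence of [integral_mean] is known only through bounds on each interval. *)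
Lemma dyadic_integral_le (G : R -> \bar R) (c : nat -> R) (B : R) :
  (forall r, 0 < r < 1 -> (0 <= G r)%E) -> (forall j, 0 <= c j) ->
  (forall j r, dyadic j r -> (G r <= (c j)%:E)%E) ->
  (forall J, \sum_(j < J) c j / 2 ^+ j.+1 <= B) ->
  (\int[lebesgue_measure]_(r in `]0%R, 1%R[) G r <= B%:E)%E.
Proof.
move=> G0 c0 Gc cB.
pose F j (r : measurableTypeR R) : \bar R := (c j * \1_(dyadic j) r)%:E.
have F0 j r : (0 <= F j r)%E by rewrite lee_fin mulr_ge0// indicE.
apply: (@le_trans _ _ (\int[lebesgue_measure]_r (\sum_(0 <= j <oo) F j r))%E).
  rewrite integral_mkcond; apply: ge0_le_integral_any => r _.
    by apply: erestrict_ge0 => x /=; rewrite in_itv/=; exact: G0.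
  rewrite /patch; case: ifPn => [|_]; last by apply: nneseries_ge0 => n _ _.
  rewrite inE/= in_itv/= => /dyadic_cover[j jr].
  apply: (le_trans (Gc j r jr)).
  have := @nneseries_lim_ge R (F^~ r) xpredT 0 j.+1 (fun k _ _ => F0 k r).
  apply: le_trans; rewrite big_nat_recr//= (@le_trans _ _ (F j r))//.
    by rewrite /F indicE mem_set// mulr1.
  by rewrite leeDr// sume_ge0.
rewrite integral_nneseries//; last first.
  move=> j; apply/measurable_EFinP; apply: measurable_funM => //.
  by apply: measurable_indic; exact: measurable_dyadic.
have FE j : (\int[lebesgue_measure]_r F j r = (c j / 2 ^+ j.+1)%:E)%E.
  rewrite /F; under eq_integral do rewrite EFinM.
  rewrite ge0_integralZl_EFin//; last first.
    by apply/measurable_EFinP; apply: measurable_indic; exact: measurable_dyadic.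
  rewrite integral_indic; [|exact: measurableT|exact: measurable_dyadic].
  by rewrite setIT; exact: (congr1 (fun x => (c j)%:E * x)%E (lebesgue_dyadic j)).
under eq_eseriesr do rewrite FE.
apply: lime_le.
  by apply: is_cvg_nneseries => j _ _; rewrite lee_fin divr_ge0.
by near=> J; rewrite big_mkord sumEFin lee_fin.
Unshelve. all: by end_near. Qed.

Lemma dyadic_integral_ge (G : R -> \bar R) (c : nat -> R) J :
  (forall r, 0 < r < 1 -> (0 <= G r)%E) -> (forall j, 0 <= c j) ->
  (forall j r, dyadic j r -> ((c j)%:E <= G r)%E) ->
  ((\sum_(j < J) c j / 2 ^+ j.+1)%:E <= \int[lebesgue_measure]_(r in `]0%R, 1%R[) G r)%E.
Proof.
move=> G0 c0 Gc.
pose F j (r : measurableTypeR R) : \bar R := (c j * \1_(dyadic j) r)%:E.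
have F0 j r : (0 <= F j r)%E by rewrite lee_fin mulr_ge0// indicE.
have mF j : measurable_fun setT (F j).
  apply/measurable_EFinP; apply: measurable_funM => //.
  by apply: measurable_indic; exact: measurable_dyadic.
have FE j : (\int[lebesgue_measure]_r F j r = (c j / 2 ^+ j.+1)%:E)%E.
  rewrite /F; under eq_integral do rewrite EFinM.
  rewrite ge0_integralZl_EFin//; last first.
    by apply/measurable_EFinP; apply: measurable_indic; exact: measurable_dyadic.
  rewrite integral_indic; [|exact: measurableT|exact: measurable_dyadic].
  by rewrite setIT; exact: (congr1 (fun x => (c j)%:E * x)%E (lebesgue_dyadic j)).
rewrite -sumEFin; under eq_bigr do rewrite -FE.
rewrite -(big_mkord xpredT (fun j => \int[lebesgue_measure]_r F j r)%E).
rewrite -ge0_integral_sum//.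
rewrite [leRHS]integral_mkcond; apply: ge0_le_integral_any => r _; first by rewrite sume_ge0.
have F_out j : ~ dyadic j r -> F j r = 0%E by move=> jr; rewrite /F indicE memNset// mulr0.
rewrite /patch; case: ifPn; last first.
  rewrite notin_setE/= in_itv/= => r01; rewrite big1// => j _.
  by apply: F_out => /dyadic01.
rewrite inE/= in_itv/= => r01; have [k kr] := dyadic_cover _ r01.
apply: (@le_trans _ _ (F k r)); last by rewrite /F indicE mem_set// mulr1 Gc.
rewrite big_mkord; have [kJ|Jk] := ltnP k J.
  rewrite (bigD1 (Ordinal kJ))//= big1 ?adde0// => i ik.
  apply: F_out => ir; move/negP: ik; apply; apply/eqP/val_inj => /=.
  exact: dyadic_inj ir kr.
rewrite big1// => i _; apply: F_out => ir.
by move: (ltn_ord i); rewrite (dyadic_inj _ _ _ ir kr) ltnNge Jk.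
Qed.

End Dyadic.

(** * Moments, dyadic kernels and powers of [1 - t r] *)

Section Moments.
Context {R : realType} (mu : {finite_measure set (measurableTypeR R) -> \bar R}).
Let D : set (measurableTypeR R) := `[0, 1[%classic.

Let mD : measurable D. Proof. exact: measurable_itv. Qed.

Lemma integrable_exprn n : mu.-integrable D (EFin \o (fun t => t ^+ n)).
Proof.
apply: (bounded_integrable _ _ _ 1) => // t; rewrite /D/= in_itv/= => /andP[t0 t1].
by rewrite ger0_norm ?exprn_ge0// exprn_ile1// ltW.
Qed.

Lemma moment_ge0 n : 0 <= moment mu n.
Proof.
by apply: Rintegral_ge0 => t; rewrite /= in_itv/= => /andP[t0 _]; rewrite exprn_ge0.
Qed.

Lemma moment_decreasing m n : (m <= n)%N -> moment mu n <= moment mu m.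
Proof.
move=> mn; apply: le_Rintegral => //; [exact: integrable_exprn|exact: integrable_exprn|].
move=> t; rewrite /= in_itv/= => /andP[t0 t1].
by apply: ler_wiXn2l => //; exact: ltW.
Qed.

(** The sequence increases from its value 1/4 at [j = 0], because [(1 - x)^2 >= 1 - 2 x]. *)
Lemma dyadic_power_ge (j : nat) : 4^-1 <= (1 - 2 ^- j.+1) ^+ (2 ^ j.+1) :> R.
Proof.
elim: j => [|j IH]; first by rewrite expr1 expn1; lra.
apply: (le_trans IH); rewrite [in leRHS]expnS exprM.
have e0 : 0 < 2 ^- j.+1 :> R by rewrite invr_gt0 exprn_gt0.
have e1 : 2 ^- j.+1 <= 1 :> R by rewrite invf_le1 ?exprn_gt0// exprn_ege1// ler1n.
have e2 : 2 ^- j.+1 = 2 * 2 ^- j.+2 :> R by rewrite (exprS _ j.+1) invfM mulrA divff ?mul1r.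
by rewrite lerXn2r ?nnegrE ?exprn_ge0//; nra.
Qed.

(* A dyadic partial sum comparable with [min (2 ^ j, 1 / (1 - t)) ^ b]. *)
Fixpoint dyadic_kernel (b : R) (j : nat) (t : R) : R :=
  if j is i.+1 then dyadic_kernel b i t + (2 ^+ j) `^ b * t ^+ (2 ^ j) else 1.

(** The bottom term is [moment mu 0], the integral of the 1 in the kernel, and not the first moment:
    [t ^+ (2 ^ 0)] vanishes at [t = 0] and could not bound the kernel from below there. *)
Fixpoint dyadic_moment (b : R) (j : nat) : R :=
  if j is i.+1 then dyadic_moment b i + (2 ^+ j) `^ b * moment mu (2 ^ j) else moment mu 0.

Lemma dyadic_kernel_ge0 b j t : 0 <= t -> 0 <= dyadic_kernel b j t.
Proof.
by move=> t0; elim: j => [|j IH] //=; rewrite addr_ge0// mulr_ge0 ?powR_ge0// exprn_ge0.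
Qed.

Lemma dyadic_kernel_integral b j :
  mu.-integrable D (EFin \o dyadic_kernel b j) /\
  \int[mu]_(t in D) dyadic_kernel b j t = dyadic_moment b j.
Proof.
elim: j => [|j [IH1 IH2]] /=.
  split; first exact: finite_measure_integrable_cst.
  by apply: eq_Rintegral => t _; rewrite expr0.
have h := integrableZl mD ((2 ^+ j.+1) `^ b) (integrable_exprn (2 ^ j.+1)).
split; first by apply: eq_integrable (integrableD mD IH1 h).
by rewrite RintegralD// IH2 RintegralZl//; exact: integrable_exprn.
Qed.

(** One term suffices. If [1 - t] is below the scale of the top term, [dyadic_power_ge] bounds that
    term below, which gives the factor 4; otherwise [x >= 1 - t] is large enough for the previous
    index. The factor [2^b] is the ratio of consecutive scales. *)
Lemma kernel_le (b : R) (j : nat) (t x : R) : 0 < b -> 0 <= t < 1 -> 2 ^- j.+1 <= x ->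
  1 - t <= x -> x `^ (- b) <= 2 `^ b * 4 * dyadic_kernel b j t.
Proof.
move=> b0 /andP[t0 t1].
have t10 : 0 < 1 - t by rewrite subr_gt0.
have b20 : 0 < 2 `^ b :> R by rewrite powR_gt0.
have up i : 2 ^- i.+1 <= x -> x `^ (- b) <= 2 `^ b * (2 ^+ i) `^ b.
  have e0 : 0 < 2 ^- i.+1 :> R by rewrite invr_gt0 exprn_gt0.
  move=> ix; have x0 : 0 < x by rewrite (lt_le_trans e0).
  rewrite -powRM ?exprn_ge0// -exprS powRN -[leRHS]invrK.
  rewrite lef_pV2 ?posrE ?powR_gt0 ?invr_gt0 ?powR_gt0 ?exprn_gt0//.
  rewrite -powRN -mulN1r powRrM powR_inv1 ?exprn_ge0//.
  by rewrite ge0_ler_powR ?(ltW b0) ?nnegrE ?(ltW e0) ?(ltW x0).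
elim: j => [|j IH] /= jx tx.
  have := up 0%N jx; rewrite expr0 powR1 mulr1 => /le_trans; apply.
  by move: b20; lra.
rewrite mulrDr.
have k0 := dyadic_kernel_ge0 b j t t0.
have w0 : 0 <= (2 ^+ j.+1) `^ b * t ^+ (2 ^ j.+1) by rewrite mulr_ge0 ?powR_ge0 ?exprn_ge0.
have c0 : 0 <= 2 `^ b * 4 :> R by rewrite mulr_ge0// ltW.
have [h|h] := leP (1 - t) (2 ^- j.+1); last first.
  by rewrite (le_trans (IH (le_trans (ltW h) tx) tx))// lerDl mulr_ge0.
apply: (le_trans (up j.+1 jx)).
rewrite (@le_trans _ _ (2 `^ b * 4 * ((2 ^+ j.+1) `^ b * t ^+ (2 ^ j.+1))))//; last first.
  by rewrite lerDr mulr_ge0.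
have t4 : 4^-1 <= t ^+ (2 ^ j.+1).
  apply: (le_trans (dyadic_power_ge j)); rewrite lerXn2r ?nnegrE//; last by lra.
  by rewrite subr_ge0 invf_le1 ?exprn_gt0// exprn_ege1// ler1n.
have Q0 : 0 <= 2 `^ b * (2 ^+ j.+1) `^ b :> R by rewrite mulr_ge0 ?powR_ge0.
rewrite [leRHS](_ : _ = 2 `^ b * (2 ^+ j.+1) `^ b * (4 * t ^+ (2 ^ j.+1))); last by ring.
by rewrite -[leLHS]mulr1 ler_wpM2l//; lra.
Qed.

(* With [y = n (1 - s r)], [y ^ k s ^ n <= k ^ k e] because [s ^ n <= exp (- n (1 - s))]. *)
Lemma moment_kernel_ge (k : R) : 0 < k -> exists E : R, 0 < E /\
  forall (n : nat) (s r : R), (0 < n)%N -> 0 <= s < 1 -> 0 <= r < 1 -> 1 - r <= n%:R^-1 ->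
  n%:R `^ k * s ^+ n <= E * (1 - s * r) `^ (- k).
Proof.
move=> k0; exists (k `^ k * expR 1); split; first by rewrite mulr_gt0 ?powR_gt0 ?expR_gt0.
move=> n s r n0 /andP[s0 s1] /andP[r0 r1] rn.
have nR : 0 < n%:R :> R by rewrite ltr0n.
have sr1 : 0 < 1 - s * r by rewrite subr_gt0; nra.
rewrite powRN ler_pdivlMr ?powR_gt0// mulrAC -powRM ?(ltW nR) ?(ltW sr1)//.
set y := n%:R * (1 - s * r); have y0 : 0 < y by rewrite mulr_gt0.
have yle : y <= n%:R * (1 - s) + 1.
  have : n%:R * (1 - r) <= 1 by rewrite mulrC -ler_pdivlMr// mul1r.
  have -> : y = n%:R * (1 - s) + s * (n%:R * (1 - r)) by rewrite /y; ring.
  move=> h; rewrite lerD2l; have : 0 <= n%:R * (1 - r) by rewrite mulr_ge0//; lra.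
  by move: h; nra.
have sn : s ^+ n <= expR (1 - y).
  apply: (@le_trans _ _ (expR (- (1 - s)) ^+ n)).
    rewrite lerXn2r ?nnegrE ?expR_ge0//.
    by have := expR_ge1Dx (- (1 - s)); apply: le_trans; lra.
  by rewrite -expRM_natl ler_expR mulrN; lra.
have yk : y `^ k <= k `^ k * expR y.
  have yk1 : y / k <= expR (y / k).
    by apply: le_trans (expR_ge1Dx _); rewrite lerDr.
  have yk0 : 0 <= y / k by rewrite divr_ge0// ltW.
  have -> : y `^ k = k `^ k * (y / k) `^ k.
    by rewrite -powRM ?(ltW k0)// mulrC divfK// gt_eqF.
  rewrite ler_wpM2l ?powR_ge0//.
  have -> : expR y = (expR (y / k)) `^ k.
    by rewrite -expRM divfK// gt_eqF.
  by rewrite ge0_ler_powR ?(ltW k0)// nnegrE expR_ge0.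
apply: (@le_trans _ _ (k `^ k * expR y * expR (1 - y))).
  by apply: ler_pM; rewrite ?powR_ge0 ?exprn_ge0.
by rewrite -mulrA -expRD addrC subrK.
Qed.

End Moments.

(** * Bounds for the Cesaro-type operator *)

Section IntegralMean.
Context {R : realType}.

Lemma integral_mean_ge0 (p : \bar R) (f : R[i] -> R[i]) (r : R) : 0 <= r ->
  (0 <= integral_mean p f r)%E.
Proof.
move=> r0; case: p => [s||] //=; first exact: poweR_ge0.
apply: ereal_sup_ge; exists (cabs (f (circle_point r 0)))%:E.
  by exists (circle_point r 0) => //=; exact: cabs_circle.
by rewrite lee_fin cabs_ge0.
Qed.

Lemma integral_mean_arc_ge (p : \bar R) (f : R[i] -> R[i]) (r d L : R) : 0 <= r ->
  (1%:E <= p)%E -> 0 < d -> d <= 2 * pi -> 0 <= L ->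
  (forall theta, 0 <= theta -> theta <= d -> L <= cabs (f (circle_point r theta))) ->
  ((L * (d / (2 * pi)) `^ inv_exponent p)%:E <= integral_mean p f r)%E.
Proof.
move=> r0 p1 d0 d2 L0 fL.
have pi0 : 0 < 2 * pi :> R by rewrite mulr_gt0// pi_gt0.
case: p p1 => [s||//]; last first.
  move=> _; rewrite /inv_exponent/= invr0 powRr0 mulr1; apply: ereal_sup_ge.
  exists (cabs (f (circle_point r 0)))%:E; last by rewrite lee_fin fL// ltW.
  by exists (circle_point r 0) => //=; exact: cabs_circle.
rewrite lee_fin => s1; have s0 : 0 < s by rewrite (lt_le_trans ltr01).
rewrite /inv_exponent/=.
have -> : (L * (d / (2 * pi)) `^ s^-1)%:E = ((L `^ s * (d / (2 * pi)))%:E `^ s^-1)%E.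
  rewrite poweR_EFin [in RHS]powRM ?powR_ge0 ?divr_ge0 ?(ltW d0) ?(ltW pi0)//.
  by rewrite -powRrM divff ?gt_eqF// powRr1.
apply: gt0_ler_poweR; rewrite ?invr_ge0 ?(ltW s0)// ?in_itv/= ?leey ?andbT.
- by rewrite lee_fin mulr_ge0 ?powR_ge0// divr_ge0// ltW.
- by apply: integral_ge0 => x _; rewrite lee_fin divr_ge0 ?powR_ge0// ltW.
apply: (@le_trans _ _ (\int[lebesgue_measure]_(x in `[0%R, d]) (L `^ s / (2 * pi))%R%:E)%E).
  rewrite integral_cst//= lebesgue_measure_itv/= lte_fin d0 -EFinB subr0 -EFinM lee_fin.
  by rewrite mulrA mulrAC.
rewrite integral_mkcond [leRHS]integral_mkcond; apply: ge0_le_integral_any => x _.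
  by apply: erestrict_ge0 => y _; rewrite lee_fin divr_ge0 ?powR_ge0// ltW.
rewrite /patch; case: ifPn => [|_]; last first.
  by case: ifPn => // _; rewrite lee_fin divr_ge0 ?powR_ge0// ltW.
rewrite inE/= in_itv/= => /andP[x0 xd].
rewrite mem_set/= ?in_itv/= ?x0 ?(le_trans xd)// lee_fin ler_pM2r ?invr_gt0//.
by rewrite ge0_ler_powR ?(ltW s0) ?nnegrE ?cabs_ge0// fL.
Qed.

Lemma integral_mean_scale (p : \bar R) (f g : R[i] -> R[i]) (r k : R) :
  (forall w, cabs w < 1 -> expandable f w) -> 0 <= r < 1 -> (1%:E <= p)%E -> 0 <= k ->
  (forall z, cabs z = r -> cabs (g z) <= k * cabs (f z)) ->
  (integral_mean p g r <= k%:E * integral_mean p f r)%E.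
Proof.
move=> fe /andP[r0 r1] p1 k0 gf.
have pi0 : 0 < 2 * pi :> R by rewrite mulr_gt0// pi_gt0.
case: p p1 => [s||//]; last first.
  move=> _; apply: ge_ereal_sup => _ [z /= zr <-].
  apply: (@le_trans _ _ (k%:E * (cabs (f z))%:E)%E); first by rewrite -EFinM lee_fin gf.
  by rewrite lee_wpmul2l ?lee_fin//; apply: ereal_sup_ubound; exists z.
rewrite lee_fin => s1; have s0 : 0 < s by rewrite (lt_le_trans ltr01).
rewrite /integral_mean.
have -> : k%:E = ((k `^ s)%:E `^ s^-1)%E.
  by rewrite poweR_EFin -powRrM divff ?gt_eqF// powRr1.
have c0 x : 0 <= cabs (f (circle_point r x)) `^ s / (2 * pi).
  by rewrite divr_ge0 ?powR_ge0// ltW.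
have mf : measurable_fun (setT : set (measurableTypeR R)) (fun x => cabs (f (circle_point r x))).
  apply: continuous_measurable_fun; apply: continuous_cabs_disc => //.
  - by move=> x; rewrite cabs_circle.
  - by move=> x; apply: cvgMr; exact: continuous_cos.
  - by move=> x; apply: cvgMr; exact: continuous_sin.
rewrite -poweRM; last 2 first.
- by rewrite lee_fin powR_ge0.
- by apply: integral_ge0 => x _; rewrite lee_fin.
rewrite -ge0_integralZl_EFin ?powR_ge0//; last 2 first.
- by move=> x _; rewrite lee_fin.
- apply/measurable_EFinP; apply: measurable_funM => //.
  by apply: measurable_funTS; apply: (measurableT_comp (measurable_powR s)).
apply: gt0_ler_poweR; rewrite ?invr_ge0 ?(ltW s0)// ?in_itv/= ?leey ?andbT.
- by apply: integral_ge0 => x _; rewrite lee_fin divr_ge0 ?powR_ge0// ltW.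
- by apply: integral_ge0 => x _; rewrite -EFinM lee_fin mulr_ge0 ?powR_ge0.
apply: ge0_le_integral_any => x _.
  by rewrite lee_fin divr_ge0 ?powR_ge0// ltW.
rewrite -EFinM lee_fin mulrA ler_pM2r ?invr_gt0// -powRM ?cabs_ge0//.
by rewrite ge0_ler_powR ?(ltW s0) ?nnegrE ?mulr_ge0 ?cabs_ge0// gf// cabs_circle.
Qed.

(** The weight and the length [2^-(j+1)] of the interval combine to [2^(-(j+1) gamma q)], which
    cancels the growth [2^(j gamma q)] of the means and leaves a constant. *)
Lemma dyadic_weight (gamma q x : R) (j : nat) : 0 < gamma -> 0 < q -> 0 <= x ->
  (2 ^- j.+1) `^ (gamma * q - 1) * ((2 ^+ j) `^ gamma * x) `^ q / 2 ^+ j.+1 =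
  2^-1 `^ (gamma * q) * x `^ q.
Proof.
move=> g0 q0 x0; have P0 : 0 < 2 ^+ j :> R by rewrite exprn_gt0.
have u0 : 0 <= 2 ^- j.+1 :> R by rewrite invr_ge0 exprn_ge0.
rewrite mulrC mulrA mulr_powRB1 ?mulr_gt0// powRM ?powR_ge0// -powRrM mulrA -powRM ?(ltW P0)//.
by rewrite exprS invfM -mulrA mulVf ?gt_eqF// mulr1.
Qed.

End IntegralMean.

(** * The two implications *)

Section Cesaro.
Context {R : realType} (mu : {finite_measure set (measurableTypeR R) -> \bar R}).
Variables (gamma q : R) (p : \bar R).
Hypotheses (g0 : 0 < gamma) (p2 : (2%:E <= p)%E) (q0 : 0 < q).

Let p1 : (1%:E <= p)%E. Proof. by rewrite (le_trans _ p2)// lee_fin ler1n. Qed.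

Let A (j : nat) : R := 2 ^+ j * moment mu (2 ^ j).

Let A0 j : 0 <= A j. Proof. by rewrite mulr_ge0 ?exprn_ge0 ?moment_ge0. Qed.

Let P0 j : 0 < 2 ^+ j :> R. Proof. by rewrite exprn_gt0. Qed.

Let ell_A : ell q (fun n => moment mu n * n.+1%:R `^ (1 - q^-1)) <->
  exists B, forall J, \sum_(k < J) A k `^ q <= B.
Proof.
by apply: ell_condensation => //; [exact: moment_ge0|exact: moment_decreasing].
Qed.

(** The added 1 makes [S] positive in the next lemma even when all moments vanish, as Minkowski's
    inequality above asks; it obeys the same recursion. *)
Let b (j : nat) : R := (2 ^+ j) `^ (- gamma) * (dyadic_moment mu (gamma + 1) j + 1).

Let b_rec j : b j.+1 = 2 `^ (- gamma) * b j + A j.+1.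
Proof.
have P0S := P0 j.+1.
have -> : 2 `^ (- gamma) * b j =
    (2 ^+ j.+1) `^ (- gamma) * (dyadic_moment mu (gamma + 1) j + 1).
  by rewrite /b mulrA -powRM ?(ltW (P0 j))// -exprS.
rewrite /b [dyadic_moment _ _ j.+1]/= addrAC mulrDr; congr (_ + _).
rewrite mulrA -powRD; last by rewrite (gt_eqF P0S) implybT.
by rewrite addrA addNr add0r powRr1 ?(ltW P0S).
Qed.

Lemma integral_mean_cesaro_le (f : R[i] -> R[i]) :
  mixed_norm_space p +oo%E gamma f -> exists D : R, 0 <= D /\
  forall j r, dyadic j r ->
  (integral_mean p (cesaro_op mu f) r <= (D * ((2 ^+ j) `^ gamma * b j))%:E)%E.
Proof.
move=> [fa fn].
have fe := analytic_expandable _ fa.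
pose g z := f z / (1 - z).
have ge w : cabs w < 1 -> expandable g w.
  by move=> w1; apply: expandable_cesaro => //; exact: fe.
have n0 : (0 <= mixed_norm p +oo%E gamma f)%E.
  have h2 : 2^-1 < 1 :> R by lra.
  apply: ereal_sup_ge; exists (((1 - 2^-1) `^ gamma)%R%:E * integral_mean p f 2^-1)%E.
    by exists 2^-1 => //; rewrite /= in_itv/= invr_gt0 ltr0n h2.
  by rewrite mule_ge0 ?integral_mean_ge0 ?lee_fin ?powR_ge0.
pose K0 := fine (mixed_norm p +oo%E gamma f).
have K0E : mixed_norm p +oo%E gamma f = K0%:E by rewrite /K0 fineK// ge0_fin_numE.
(* The norm controls the means for [0 < r < 1] only, whereas [t * r] takes the value 0 at [t = 0],
   so [f 0] is included. The added 1 makes [K] positive. *)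
pose K := Num.max K0 (cabs (f 0)) + 1.
have K00 : 0 <= K0 by rewrite fine_ge0.
have K0K : K0 <= K by rewrite /K (@le_trans _ _ (Num.max K0 (cabs (f 0))))// ?lerDl// le_max lexx.
have fK : cabs (f 0) <= K by rewrite /K (@le_trans _ _ (Num.max K0 (cabs (f 0))))// ?lerDl// le_max lexx orbT.
have Kp : 0 < K by rewrite /K ltr_wpDl// le_max K00.
pose beta := gamma + 1; have beta0 : 0 < beta by rewrite addr_gt0.
have gmean t : 0 <= t < 1 -> (integral_mean p g t <= (K * (1 - t) `^ (- beta))%:E)%E.
  move=> t01; have /andP[t0 t1] := t01.
  move: t0; rewrite le_eqVlt => /orP[/eqP t00|t0].
    rewrite -t00 subr0 powR1 mulr1; apply: integral_mean_le_cst => // z /eqP.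
    by rewrite cabs_eq0 => /eqP ->; rewrite /g subr0 divr1.
  have t10 : 0 < 1 - t by rewrite subr_gt0.
  have fm : (integral_mean p f t <= (K0 * (1 - t) `^ (- gamma))%:E)%E.
    have : (((1 - t) `^ gamma)%:E * integral_mean p f t <= K0%:E)%E.
      by rewrite -K0E; apply: ereal_sup_ubound; exists t => //; rewrite /= in_itv/= t0.
    by rewrite -lee_pdivlMl ?powR_gt0// powRN mulrC EFinM.
  apply: (le_trans (integral_mean_scale p f g t (1 - t)^-1 fe t01 p1 _ _)).
  - by rewrite invr_ge0 ltW.
  - move=> z zt; rewrite /g cabs_div mulrC ler_wpM2r ?cabs_ge0//.
    have h : 1 - t <= cabs (1 - z) by rewrite -zt; exact: cabs_1B_ge.
    by rewrite lef_pV2 ?posrE// (lt_le_trans t10).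
  apply: (@le_trans _ _ ((1 - t)^-1%:E * (K0 * (1 - t) `^ (- gamma))%:E)%E).
    by rewrite lee_wpmul2l// lee_fin invr_ge0 ltW.
  rewrite -EFinM lee_fin /beta opprD powRD; last by rewrite (gt_eqF t10) implybT.
  rewrite powR_inv1 ?(ltW t10)// mulrC mulrA ler_pM2r ?invr_gt0//.
  by rewrite ler_wpM2r ?powR_ge0.
pose C := 2 `^ beta * 4 : R; have C0 : 0 < C by rewrite mulr_gt0// powR_gt0.
exists (2 * (K * C)); split; first by rewrite !mulr_ge0// ltW.
move=> j r jr; have /andP[r0 r1] := dyadic01 _ _ jr.
have /andP[jr1 _] := dyadicP _ _ jr.
have r10 : 0 < 1 - r by rewrite subr_gt0.
pose N t := K * (1 - clamp t * r) `^ (- beta).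
have wpos t : 1 - r <= 1 - clamp t * r <= 1.
  have := clamp_ge0 t; have := clamp_le1 t => h1 h2.
  by apply/andP; split; nra.
have wp t : 0 < 1 - clamp t * r by have /andP[h _] := wpos t; rewrite (lt_le_trans r10).
have mN : measurable_fun (setT : set (measurableTypeR R)) N.
  apply: measurable_funM => //; apply: (measurableT_comp (measurable_powR (- beta))).
  apply: continuous_measurable_fun => t; apply: cvgB; first exact: cvg_cst.
  by apply: cvgMl; exact: continuous_clamp.
have NK t : K <= N t.
  rewrite -[leLHS]mulr1 ler_wpM2l ?(ltW Kp)// powRN -[leLHS]invr1.
  rewrite lef_pV2 ?posrE ?powR_gt0//.
  by have /andP[_ h] := wpos t; rewrite powR_le1// ltW.
have NM t : N t <= K * (1 - r) `^ (- beta).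
  rewrite ler_wpM2l ?(ltW Kp)// !powRN lef_pV2 ?posrE ?powR_gt0//.
  by rewrite ge0_ler_powR ?(ltW beta0) ?nnegrE ?(ltW r10) ?(ltW (wp t))//; have /andP[] := wpos t.
have dm0 i : 0 <= dyadic_moment mu beta i.
  by elim: i => [|i IH] /=; rewrite ?addr_ge0 ?moment_ge0// mulr_ge0 ?powR_ge0 ?moment_ge0.
pose S := K * C * (dyadic_moment mu beta j + 1).
have S0 : 0 < S by rewrite !mulr_gt0// ltr_wpDl.
have mD : measurable (`[0%R, 1%R[%classic : set (measurableTypeR R)) by exact: measurable_itv.
(* [kernel_le] is applied at [x = 1 - t r], which is at least [1 - t] and at least
   [1 - r >= 2^-(j+1)]. *)
have NS : \int[mu]_(t in `[0%R, 1%R[) N t <= S.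
  rewrite /S; have [ki <-] := dyadic_kernel_integral mu beta j.
  apply: (@le_trans _ _ (K * C * \int[mu]_(t in `[0%R, 1%R[) dyadic_kernel beta j t)).
    rewrite -RintegralZl//; apply: le_Rintegral => //.
    - apply: (bounded_integrable _ _ _ (K * (1 - r) `^ (- beta))) => //.
        exact: measurable_funTS.
      by move=> t _; rewrite ger0_norm// (le_trans (ltW Kp)).
    - exact: (integrableZl mD _ ki).
    - move=> t; rewrite /= in_itv/= => t01; rewrite -mulrA ler_wpM2l ?(ltW Kp)//.
      have /andP[t0 t1] := t01; apply: kernel_le => //.
        by apply: (le_trans jr1); have /andP[] := wpos t.
      by rewrite clamp_id ?(ltW t1)//; nra.
  by rewrite ler_wpM2l ?(ltW (mulr_gt0 Kp C0))// lerDl.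
have gN t : 0 <= t < 1 -> (integral_mean p g (t * r) <= (N t)%:E)%E.
  move=> /andP[t0 t1]; rewrite /N clamp_id ?(ltW t1)//; apply: gmean.
  by apply/andP; split; nra.
have := integral_mean_transform mu N K _ _ mN Kp NK NM S0 NS g r ge r0 r1 p p1 gN.
rewrite (_ : 2 * S = 2 * (K * C) * ((2 ^+ j) `^ gamma * b j))//.
rewrite /b /S (mulrA (_ `^ gamma)) -powRD; last by rewrite subrr eqxx/= gt_eqF.
by rewrite subrr powRr0 mul1r mulrA.
Qed.

Lemma cesaro_maps : ell q (fun n => moment mu n * n.+1%:R `^ (1 - q^-1)) ->
  forall f, mixed_norm_space p +oo%E gamma f ->
    mixed_norm_space p q%:E gamma (cesaro_op mu f).
Proof.
move=> /ell_A[B AB] f fH; have [fa _] := fH.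
split.
  apply: (transform_analytic mu (fun z => f z / (1 - z))).
  apply: expandable_analytic => w w1; apply: expandable_cesaro => //.
  exact: analytic_expandable.
have [D [D0 DP]] := integral_mean_cesaro_le f fH.
have b00 : 0 <= b 0%N by rewrite mulr_ge0 ?powR_ge0// addr_ge0// moment_ge0.
have l1 : 2 `^ (- gamma) < 1 :> R.
  rewrite powRN invf_lt1 ?powR_gt0//.
  have : 1 `^ gamma < 2 `^ gamma :> R.
    by apply: gt0_ltr_powR; rewrite ?nnegrE ?ltr1n.
  by rewrite powR1.
have b_ge0 j : 0 <= b j.
  by elim: j => // j IH; rewrite b_rec addr_ge0// mulr_ge0 ?powR_ge0.
have [B' bB'] := geometric_recursion_summable _ q A b B (powR_ge0 _ _) l1 q0 A0 b00 b_rec AB.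
rewrite /mixed_norm; apply: poweR_lty.
(* On the j-th interval [1 - r] and [2^-(j+1)] differ by a factor at most 2, so the first factor
   compares the weights whatever the sign of [gamma * q - 1]. *)
pose c j := 2 `^ `|gamma * q - 1| * ((2 ^- j.+1) `^ (gamma * q - 1)) * (D * ((2 ^+ j) `^ gamma * b j)) `^ q.
pose E := 2 `^ `|gamma * q - 1| * D `^ q * 2^-1 `^ (gamma * q).
have wb0 j : 0 <= (2 ^+ j) `^ gamma * b j by exact: mulr_ge0 (powR_ge0 _ _) (b_ge0 j).
have cE j : c j / 2 ^+ j.+1 = E * b j `^ q.
  rewrite /c (powRM _ D0 (wb0 j)).
  rewrite [LHS](_ : _ = 2 `^ `|gamma * q - 1| * D `^ q *
     ((2 ^- j.+1) `^ (gamma * q - 1) * ((2 ^+ j) `^ gamma * b j) `^ q / 2 ^+ j.+1)); last by ring.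
  by rewrite dyadic_weight// mulrA.
apply: (@le_lt_trans _ _ (E * B')%:E); last by rewrite ltry.
apply: (dyadic_integral_le _ c).
- by move=> r /andP[r0 _]; rewrite mule_ge0 ?poweR_ge0// lee_fin powR_ge0.
- by move=> j; rewrite !mulr_ge0 ?powR_ge0.
- move=> j r jr; have /andP[jr1 jr2] := dyadicP _ _ jr.
  have /andP[r0 r1] := dyadic01 _ _ jr.
  rewrite /c EFinM; apply: lee_pmul; rewrite ?lee_fin ?powR_ge0 ?poweR_ge0//.
    apply: powR_comparable; rewrite ?subr_gt0// ?invr_gt0//.
    - rewrite exprS invfM mulrA divff// mul1r; exact: ltW.
    - by move: jr1 r1; lra.
  rewrite -poweR_EFin; apply: gt0_ler_poweR; rewrite ?(ltW q0)// ?in_itv/= ?leey ?andbT.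
  + by apply: integral_mean_ge0; exact: ltW.
  + by rewrite lee_fin (mulr_ge0 D0 (wb0 j)).
  + exact: DP.
- move=> J; under eq_bigr do rewrite cE.
  by rewrite -mulr_sumr ler_wpM2l// !mulr_ge0 ?powR_ge0.
Qed.

Lemma moment_summable_of_cesaro : (forall f, mixed_norm_space p +oo%E gamma f ->
    mixed_norm_space p q%:E gamma (cesaro_op mu f)) ->
  ell q (fun n => moment mu n * n.+1%:R `^ (1 - q^-1)).
Proof.
move=> H; apply/ell_A.
have [f [c [e [c0 e0 e1 fH fRe]]]] := test_function gamma p g0 p2.
have [fa _] := fH.
have fe := analytic_expandable _ fa.
pose g z := f z / (1 - z).
have ge w : cabs w < 1 -> expandable g w.
  by move=> w1; apply: expandable_cesaro => //; exact: fe.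
pose P := inv_exponent p; have P_ge0 : 0 <= P.
  by apply: inv_exponent_ge0; rewrite (le_trans _ p1)// lee_fin.
pose kappa := gamma + P + 1.
have kappa0 : 0 < kappa by rewrite ltr_wpDl// addr_ge0// ltW.
have [E [E0 EP]] := moment_kernel_ge kappa kappa0.
have mD : measurable (`[0%R, 1%R[%classic : set (measurableTypeR R)) by exact: measurable_itv.
have pi0 : 0 < 2 * pi :> R by rewrite mulr_gt0// pi_gt0.
have pi1 : 1 <= 2 * pi :> R by have := @pi_ge2 R; lra.
(* The angle is admissible for [fRe] because [2^-(j+1) <= 1 - r]. The power of [1 - s r] is traded
   for [s ^+ (2 ^ j)] by [moment_kernel_ge] with [n = 2^j], which uses [1 - r < 2^-j]. *)
have arc j r theta : dyadic j r -> 0 <= theta -> theta <= e * 2 ^- j.+1 ->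
    c / E * ((2 ^+ j) `^ kappa * moment mu (2 ^ j)) <= cabs (cesaro_op mu f (circle_point r theta)).
  move=> jr th0 the; have /andP[jr1 jr2] := dyadicP _ _ jr.
  have r01 := dyadic01 _ _ jr; have /andP[r0 r1] := r01.
  pose z := circle_point r theta.
  have z1 : cabs z < 1 by rewrite cabs_circle// ltW.
  apply: le_trans (Re_le_cabs _); apply: le_trans (ler_norm _).
  have ci := cintegrable_radius mu g z ge z1.
  rewrite (mulrA (c / E)) -RintegralZl//; last exact: integrable_exprn.
  apply: le_Rintegral => //.
  - exact: (integrableZl mD _ (integrable_exprn mu (2 ^ j))).
  - by case: ci.
  move=> s; rewrite /= in_itv/= => s01.
  have the' : theta <= e * (1 - r) by rewrite (le_trans the)// ler_pM2l.
  apply: le_trans (fRe s r theta s01 r01 th0 the').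
  have := EP (2 ^ j)%N s r; rewrite expn_gt0/= natrX (ltW r0) r1 => /(_ isT s01 isT (ltW jr2)).
  by move=> h; rewrite -!mulrA ler_pM2l// mulrC ler_pdivrMr// [leRHS]mulrC.
(* The arc of length [e 2^-(j+1)] fills the fraction [(e / (4 pi)) 2^-j] of the circle. Its P-th
   power cancels the P in [kappa] and leaves [2^(j gamma) 2^j]. *)
pose c3 := c / E * (e / (4 * pi)) `^ P.
have c30 : 0 <= c3 by rewrite mulr_ge0 ?powR_ge0// divr_ge0// ltW.
have mean_ge j r : dyadic j r ->
    ((c3 * ((2 ^+ j) `^ gamma * A j))%:E <= integral_mean p (cesaro_op mu f) r)%E.
  move=> jr; have /andP[r0 r1] := dyadic01 _ _ jr.
  have e2 : 0 < 2 ^- j.+1 :> R by rewrite invr_gt0.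
  have L0 : 0 <= c / E * ((2 ^+ j) `^ kappa * moment mu (2 ^ j)).
    by rewrite mulr_ge0 ?divr_ge0 ?mulr_ge0 ?powR_ge0 ?moment_ge0// ltW.
  have d2 : e * 2 ^- j.+1 <= 2 * pi.
    apply: le_trans pi1; rewrite -[leRHS]mulr1; apply: ler_pM; rewrite ?(ltW e0) ?(ltW e2)//.
    by rewrite invf_le1// exprn_ege1// ler1n.
  have := integral_mean_arc_ge p (cesaro_op mu f) r _ _ (ltW r0) p1 (mulr_gt0 e0 e2) d2 L0
    (fun theta => arc j r theta jr).
  rewrite -/P; apply: le_trans; rewrite lee_fin le_eqVlt; apply/orP; left; apply/eqP.
  have -> : e * 2 ^- j.+1 / (2 * pi) = e / (4 * pi) * 2 ^- j.
    rewrite exprS; have := @pi_gt0 R; have := P0 j.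
    move: (2 ^+ j) (@pi R) => x y x0 y0; field; by rewrite !gt_eqF.
  rewrite powRM ?divr_ge0 ?mulr_ge0 ?invr_ge0 ?(ltW e0) ?(ltW (pi_gt0 R)) ?(ltW (P0 j))//.
  have -> : (2 ^+ j) `^ kappa = (2 ^+ j) `^ gamma * 2 ^+ j * (2 ^+ j) `^ P.
    rewrite /kappa !powRD ?(gt_eqF (P0 j)) ?implybT//.
    by rewrite powRr1 ?(ltW (P0 j))// mulrAC.
  rewrite /c3 /A.
  have -> : (2 ^- j) `^ P = ((2 ^+ j) `^ P)^-1 :> R.
    by rewrite -powR_inv1 ?(ltW (P0 j))// -powRrM mulN1r powRN.
  have Q0 : (2 ^+ j) `^ P != 0 :> R by rewrite gt_eqF// powR_gt0.
  move: ((2 ^+ j) `^ P) ((2 ^+ j) `^ gamma) (moment mu (2 ^ j)) (2 ^+ j) Q0 => X Y Z W X0.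
  move: ((e / (4 * pi)) `^ P) => V.
  by field; rewrite X0 gt_eqF.
have [_] := H f fH; rewrite /mixed_norm => /(lty_poweRy (invr_neq0 (lt0r_neq0 q0))).
set I := (\int[_]_(_ in _) _)%E => Ioo.
have G0 r : 0 < r < 1 -> (0 <= ((1 - r) `^ (gamma * q - 1))%R%:E * integral_mean p (cesaro_op mu f) r `^ q)%E.
  by move=> /andP[r0 _]; rewrite mule_ge0 ?poweR_ge0// lee_fin powR_ge0.
have I0 : (0 <= I)%E by apply: integral_ge0 => r /=; rewrite in_itv/=; exact: G0.
pose w := 2 `^ `|gamma * q - 1| : R; have w0 : 0 < w by rewrite powR_gt0.
pose cc j := w^-1 * ((2 ^- j.+1) `^ (gamma * q - 1)) * (c3 * ((2 ^+ j) `^ gamma * A j)) `^ q.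
pose F := w^-1 * c3 `^ q * 2^-1 `^ (gamma * q).
have cc0 : 0 < c3 by rewrite !mulr_gt0 ?invr_gt0 ?powR_gt0 ?divr_gt0// mulr_gt0// pi_gt0.
have F0 : 0 < F by rewrite !mulr_gt0 ?invr_gt0 ?powR_gt0 ?invr_gt0.
have wA0 j : 0 <= (2 ^+ j) `^ gamma * A j by exact: mulr_ge0 (powR_ge0 _ _) (A0 j).
have ccE j : cc j / 2 ^+ j.+1 = F * A j `^ q.
  rewrite /cc (powRM _ c30 (wA0 j)).
  rewrite [LHS](_ : _ = w^-1 * c3 `^ q *
     ((2 ^- j.+1) `^ (gamma * q - 1) * ((2 ^+ j) `^ gamma * A j) `^ q / 2 ^+ j.+1)); last by ring.
  by rewrite dyadic_weight// mulrA.
exists (fine I / F) => J; rewrite ler_pdivlMr// mulrC mulr_sumr.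
under eq_bigr do rewrite -ccE.
rewrite -lee_fin fineK ?ge0_fin_numE//.
apply: dyadic_integral_ge => //.
- by move=> j; rewrite !mulr_ge0 ?powR_ge0 ?invr_ge0 ?(ltW w0).
- move=> j r jr; have /andP[jr1 jr2] := dyadicP _ _ jr.
  have /andP[r0 r1] := dyadic01 _ _ jr.
  have e2 : 0 < 2 ^- j.+1 :> R by rewrite invr_gt0.
  rewrite /cc EFinM; apply: lee_pmul; rewrite ?lee_fin ?mulr_ge0 ?invr_ge0 ?powR_ge0//.
    rewrite ler_pdivrMl//; apply: powR_comparable; rewrite ?subr_gt0//.
    - by move: jr1 r1; lra.
    - move: jr2; rewrite exprS invfM => h.
      have : 2 ^- j = 2 * (2^-1 * 2 ^- j) :> R by rewrite mulrA divff// mul1r.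
      by lra.
  rewrite -poweR_EFin; apply: gt0_ler_poweR; rewrite ?(ltW q0)// ?in_itv/= ?leey ?andbT.
  + by rewrite lee_fin (mulr_ge0 c30 (wA0 j)).
  + by apply: integral_mean_ge0; exact: ltW.
  + exact: mean_ge.
Qed.

End Cesaro.

Theorem corollary7p6 (R : realType)
    (mu : {finite_measure set (measurableTypeR R) -> \bar R})
    (hmu : mu (~` `[0, 1[) = 0%E)
    (gamma : R) (hgamma : 0 < gamma)
    (p : \bar R) (hp : (2%:E <= p)%E)
    (q : R) (hq : 0 < q) :
  (forall f : R[i] -> R[i],
      mixed_norm_space p +oo%E gamma f ->
      mixed_norm_space p q%:E gamma (cesaro_op mu f))
  <->
  ell q (fun n : nat => moment mu n * n.+1%:R `^ (1 - q^-1)).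
Proof.
by split; [exact: moment_summable_of_cesaro|exact: cesaro_maps].
Qed.
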